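(* Let $f(z)$ be a rational function of the complex variable $z$ such that the degree of the denominator exceeds the degree of the numerator by at least $1$ and such that $f$ has no poles on the real axis. For every nonnegative integer $k$ let $$I_k:=\int_0^{\infty}f(x)\cos x\,\log^k x\,dx,\qquad J_k:=\int_0^{\infty}f(x)\sin x\,\log^k x\,dx.$$ Let $m$ be a nonnegative integer and let $$S:=2\pi i\sum_{U}\operatorname{Res}\left(e^{iz}f(z)\log^m z;\,z_j\right),$$ where the sum is over all poles $z_j$ of $e^{iz}f(z)\log^m z$ lying in the open upper half-plane $U$. (i) If $f$ is even, then $$S=\sum_{k=0}^m\binom{m}{k}(i\pi)^{m-k}(I_k-iJ_k)+(I_m+iJ_m).$$ (ii) If $f$ is odd, then $$S=-\sum_{k=0}^m\binom{m}{k}(i\pi)^{m-k}(I_k-iJ_k)+(I_m+iJ_m).$$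
   Context: $\operatorname{Res}(F(z);z_0)$ denotes the residue of $F$ at the pole $z_0$. The branch of $\log z$ is the one with $-\frac{\pi}{2}<\arg z\le\frac{3\pi}{2}$ (so $\log x$ is the usual real logarithm for $x>0$), and $\log^k z=(\log z)^k$, with $\log^0 z=1$. The integrals over $(0,\infty)$ are (possibly conditionally convergent) improper integrals, i.e. $\lim_{\varepsilon\to0^+,\,R\to\infty}\int_\varepsilon^R$. *)

(* Defs.v *)
From HB Require Import structures.
From mathcomp Require Import all_boot all_order all_algebra.
From mathcomp Require Import complex.
From mathcomp Require Import all_classical all_reals all_analysis.

Set Implicit Arguments.
Unset Strict Implicit.
Unset Printing Implicit Defensive.

Import Order.TTheory GRing.Theory Num.Theory.
Import numFieldNormedType.Exports.

Local Open Scope classical_set_scope.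
Local Open Scope ring_scope.
Local Open Scope complex_scope.

(* These instances give R[i] the topology and normed-module structure (over
   itself) that mathcomp-analysis puts on every numFieldType. *)
HB.instance Definition _ (R : realType) := GRing.ComAlgebra.copy R[i] R[i]^o.
HB.instance Definition _ (R : realType) := Vector.copy R[i] R[i]^o.
HB.instance Definition _ (R : realType) := NormedModule.copy R[i] R[i]^o.

Section ComplexFunctions.
Variable R : realType.
Implicit Types (z w c : R[i]) (F g : R[i] -> R[i]).

Definition cexp z : R[i] :=
  (expR (complex.Re z))%:C * (cos (complex.Im z) +i* sin (complex.Im z)).

(* The logarithm with argument in ]-pi/2, 3pi/2]; its value at 0 is junk. *)
Definition clog z : R[i] :=
  xget 0 [set w | cexp w = z /\ - (pi / 2) < complex.Im w <= 3 * pi / 2].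

(* If p and q are coprime, the roots of q are exactly the poles of p / q; the
   value there is the junk value 0. *)
Definition ratfun (p q : {poly R[i]}) z : R[i] := p.[z] / q.[z].

(* This is complex differentiability: the scalar field here is R[i]. *)
Definition holomorphic_near g z := \forall w \near z, derivable g w 1.

(* An isolated singularity at which |F| tends to infinity. The value F z0 is
   irrelevant. *)
Definition is_pole F z0 :=
  (\forall w \near z0^', derivable F w 1) /\
  Normc.normc (F w) @[w --> z0^'] --> +oo.

(* c is the coefficient of (z - z0)^-1 in the Laurent expansion at z0, i.e. in
   F(z) = a_n (z - z0)^-n + ... + a_1 (z - z0)^-1 + g(z), with g holomorphic
   at z0; a_k is written a (k - 1). *)
Definition is_residue F z0 c :=
  exists (n : nat) (a : nat -> R[i]) (g : R[i] -> R[i]),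
    [/\ (0 < n)%N,
        holomorphic_near g z0,
        (\forall z \near z0^',
           F z = \sum_(k < n) a k / (z - z0) ^+ k.+1 + g z)
      & c = a 0%N].

Definition residue F z0 : R[i] := xget 0 (is_residue F z0).

Definition cintegral (h : R -> R[i]) (a b : R) : R[i] :=
  (\int[lebesgue_measure]_(x in `[a, b]) complex.Re (h x)) +i*
  (\int[lebesgue_measure]_(x in `[a, b]) complex.Im (h x)).

(* The integrals over [eps, T], filtered by eps -> 0+ and, independently,
   T -> +oo. *)
Definition improper_integral_filter (h : R -> R[i]) : set_system R[i] :=
  cintegral h ab.1 ab.2 @[ab --> filter_prod (0 : R)^'+ +oo].

Definition improper_integral (h : R -> R[i]) : R[i] :=
  lim (improper_integral_filter h).

Definition cos_log_integrand F (k : nat) (x : R) : R[i] :=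
  F x%:C * (cos x)%:C * (ln x ^+ k)%:C.

Definition sin_log_integrand F (k : nat) (x : R) : R[i] :=
  F x%:C * (sin x)%:C * (ln x ^+ k)%:C.

Definition exp_log_fun F (m : nat) z : R[i] :=
  cexp ('i%C * z) * F z * clog z ^+ m.

End ComplexFunctions.

(* Main.v *)
Require Import Defs.
From mathcomp Require Import all_boot all_order all_algebra.
From mathcomp Require Import complex.
From mathcomp Require Import all_classical all_reals all_analysis.
From mathcomp Require Import ring lra.

Set Implicit Arguments.
Unset Strict Implicit.
Unset Printing Implicit Defensive.

Import Order.TTheory GRing.Theory Num.Theory.
Import numFieldNormedType.Exports.

Local Open Scope classical_set_scope.
Local Open Scope ring_scope.
Local Open Scope complex_scope.

Import Normc.
Local Notation Re := (@complex.Re _).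
Local Notation Im := (@complex.Im _).

(** Why the theorem holds.

    Put F(z) = e^(iz) f(z) log^m z. On the negative axis the chosen branch is
    log (- x) = ln x + i pi, so for even or odd f the binomial theorem
    ([integrand_fold]) turns F(x) + F(- x) into the combination of the integrands of
    the I_k and J_k that occurs on the right-hand side. It therefore suffices to
    prove the convergence of the I_k and J_k and the formula
    int_0^oo (F(x) + F(- x)) dx = 2 pi i sum_U Res F, which is [residue_formula].

    Convergence ([oscillating_integral]) comes from integration by parts at infinity.
    Integrals are handled through primitives: a bound for an integral is a mean value
    inequality for its primitive ([mean_value_le]).

    For the residue formula, let T be the sum over the poles z_j in U of the principal
    parts of F, where a_0 / (z - z_j) is replaced by
    a_0 (1 / (z - z_j) - 1 / (z - conj z_j)). The extra pole is in the lower half plane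
    and makes T decay like 1 / z^2, and T has an explicit primitive on the real line,
    in which a_0 is the coefficient of a multiple of an arctangent: the integral of T
    over the line is 2 pi i sum a_0 ([corrected_part_odd_cvgy]). The difference
    F - T extends holomorphically to the closed upper half plane without 0. The change of
    variable z = e^w maps a rectangle onto a half annulus, so Cauchy's theorem for
    rectangles ([goursat], proved by repeated quartering) bounds the integral of F - T over
    [eps, R] and [- R, - eps] by those over two half circles ([half_annulus]). The
    large one tends to 0 by Jordan's inequality ([jordan_increment]), the small one since
    powers of the logarithm are negligible against the radius.

    The poles of F in U are the zeros of the denominator ([is_pole_integrand]), and
    Laurent expansions exist there because exponential, logarithm and reciprocals
    have polynomial expansions to all orders ([peano_ode], [ex_residue]); no power
    series are involved. *)

(** * Norm and derivatives over the complex numbers *)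

Section ComplexNorm.
Context {R : realType}.
Implicit Types (z w : R[i]).

Lemma normc_ge0 z : 0 <= normc z.
Proof. by case: z => a b; exact: sqrtr_ge0. Qed.

Lemma normc_norm z : `|z| = (normc z)%:C. Proof. by []. Qed.

Lemma normc_eq0 z : (normc z == 0) = (z == 0).
Proof. by apply/eqP/eqP => [/eq0_normc//|->]; rewrite normc0. Qed.

Lemma normc_gt0 z : (0 < normc z) = (z != 0).
Proof. by rewrite lt0r normc_eq0 normc_ge0 andbT. Qed.

Lemma ler_normcD z w : normc (z + w) <= normc z + normc w.
Proof. exact: le_normcD. Qed.

Lemma normcB z w : normc (z - w) = normc (w - z).
Proof. by rewrite -opprB; exact: normcN. Qed.

Lemma normcNE z : normc (- z) = normc z. Proof. exact: normcN. Qed.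

Lemma ler_normcB z w : normc (z - w) <= normc z + normc w.
Proof. by rewrite (le_trans (ler_normcD _ _))// normcNE. Qed.

Lemma lerB_normc z w : normc z - normc w <= normc (z - w).
Proof. by rewrite lerBlDr -[leLHS](_ : normc ((z - w) + w) = _) ?ler_normcD// subrK. Qed.

Lemma normcX z n : normc (z ^+ n) = normc z ^+ n.
Proof. by elim: n => [|n ih]; rewrite ?expr0 ?normc1// !exprS normcM ih. Qed.

Lemma normc_real (x : R) : normc x%:C = `|x|.
Proof. by rewrite /= expr0n/= addr0 sqrtr_sqr. Qed.

Lemma normc_i : normc ('i : R[i]) = 1.
Proof. by rewrite /= expr0n/= add0r expr1n sqrtr1. Qed.

Lemma ler_normc_sum (I : Type) (r : seq I) (P : pred I) (F : I -> R[i]) :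
  normc (\sum_(i <- r | P i) F i) <= \sum_(i <- r | P i) normc (F i).
Proof.
elim/big_rec2: _ => [|i y x _ h]; first by rewrite normc0.
by rewrite (le_trans (ler_normcD _ _))// lerD2l.
Qed.

Lemma sqr_normcE z : normc z ^+ 2 = Re z ^+ 2 + Im z ^+ 2.
Proof. by case: z => a b /=; rewrite sqr_sqrtr// addr_ge0 ?sqr_ge0. Qed.

Lemma ler_Re_normc z : `|Re z| <= normc z.
Proof.
rewrite -(@ler_pXn2r _ 2)// ?nnegrE ?normr_ge0 ?normc_ge0//.
by rewrite sqr_normcE real_normK ?num_real// lerDl sqr_ge0.
Qed.

Lemma ler_Im_normc z : `|Im z| <= normc z.
Proof.
rewrite -(@ler_pXn2r _ 2)// ?nnegrE ?normr_ge0 ?normc_ge0//.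
by rewrite sqr_normcE real_normK ?num_real// lerDr sqr_ge0.
Qed.

Lemma normc_le_ReIm z : normc z <= `|Re z| + `|Im z|.
Proof.
rewrite -(@ler_pXn2r _ 2)// ?nnegrE ?normr_ge0 ?normc_ge0// ?addr_ge0//.
rewrite sqr_normcE sqrrD !real_normK ?num_real//.
by rewrite addrAC lerDl mulrn_wge0// mulr_ge0.
Qed.

Lemma reD z w : Re (z + w) = Re z + Re w. Proof. by case: z; case: w. Qed.
Lemma imD z w : Im (z + w) = Im z + Im w. Proof. by case: z; case: w. Qed.
Lemma reN z : Re (- z) = - Re z. Proof. by case: z. Qed.
Lemma imN z : Im (- z) = - Im z. Proof. by case: z. Qed.
Lemma reM z w : Re (z * w) = Re z * Re w - Im z * Im w.
Proof. by case: z; case: w. Qed.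
Lemma imM z w : Im (z * w) = Re z * Im w + Im z * Re w.
Proof. by case: z; case: w. Qed.
Lemma complexP z w : Re z = Re w -> Im z = Im w -> z = w.
Proof. by case: z => a b; case: w => c d /= -> ->. Qed.

Definition reimE := (reD, imD, reN, imN, reM, imM).

(** The topology of R[i] comes from a norm with values in R[i] itself; these
    characterisations replace its complex radii by real ones. *)
Lemma nearcP (z : R[i]) (A : set R[i]) :
  (\forall w \near z, A w) <-> exists2 e : R, 0 < e & forall w, normc (w - z) < e -> A w.
Proof.
split.
- move=> /nbhs_normP[[e e'] /=]; rewrite ltcE/= => /andP[/eqP/esym e'0 e0] h.
  exists e => // w we; apply: h; rewrite /= /ball_/= ltcE/= -e'0 eqxx/=.
  by rewrite normcB in we.
- move=> [e e0 h]; apply/nbhs_normP; exists e%:C => /=; first by rewrite ltcR.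
  by move=> w; rewrite /= /ball_/= normc_norm ltcR normcB; exact: h.
Qed.

Lemma dnearcP (z : R[i]) (A : set R[i]) :
  (\forall w \near z^', A w) <->
  exists2 e : R, 0 < e & forall w, 0 < normc (w - z) < e -> A w.
Proof.
split=> [|[e e0 h]].
- rewrite /dnbhs/within/= => /nearcP[e e0 h]; exists e => // w /andP[w0 we].
  by apply: h => //; move: w0; rewrite normc_gt0 subr_eq0.
- rewrite /dnbhs/within/=; apply/nearcP; exists e => // w we wz.
  by apply: h; rewrite we normc_gt0 subr_eq0 wz.
Qed.

Lemma cvgcP {T : Type} (F : set_system T) {FF : Filter F} (f : T -> R[i]) (l : R[i]) :
  f @ F --> l <-> forall e : R, 0 < e -> \forall x \near F, normc (f x - l) < e.
Proof.
split=> [fl e e0|h].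
- have /fl : \forall w \near l, normc (w - l) < e by apply/nearcP; exists e.
  exact.
- apply/cvgrPdist_lt => -[e e']; rewrite ltcE/= => /andP[/eqP e'0 e0].
  by apply: filterS (h _ e0) => x; rewrite normc_norm ltcE/= e'0 eqxx/= normcB.
Qed.

Lemma cvgcD {T : Type} (G : set_system T) {FG : Filter G} (f g : T -> R[i]) (a b : R[i]) :
  f @ G --> a -> g @ G --> b -> (fun x => f x + g x) @ G --> a + b.
Proof.
move=> /cvgcP hf /cvgcP hg; apply/cvgcP => e e0.
have e20 : 0 < e / 2 by rewrite divr_gt0.
apply: filterS2 (hf _ e20) (hg _ e20) => x k k'.
have -> : f x + g x - (a + b) = (f x - a) + (g x - b) by ring.
by apply: le_lt_trans (ler_normcD _ _) _; lra.
Qed.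

Lemma cvgc_ReIm {T : Type} (F : set_system T) {FF : Filter F} (f : T -> R[i]) (l : R[i]) :
  f @ F --> l <-> ((Re (f x) @[x --> F] --> Re l) /\ (Im (f x) @[x --> F] --> Im l)).
Proof.
split=> [/cvgcP h|[h1 h2]]; [split|].
- apply/cvgrPdist_lt => e e0; apply: filterS (h _ e0) => x; apply: le_lt_trans.
  by rewrite distrC -reN -reD ler_Re_normc.
- apply/cvgrPdist_lt => e e0; apply: filterS (h _ e0) => x; apply: le_lt_trans.
  by rewrite distrC -imN -imD ler_Im_normc.
- apply/cvgcP => e e0; have e20 : 0 < e / 2 by rewrite divr_gt0.
  move/cvgrPdist_lt : h1 => /(_ _ e20); move/cvgrPdist_lt : h2 => /(_ _ e20).
  apply: filterS2 => x h1 h2; apply: (le_lt_trans (normc_le_ReIm _)).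
  rewrite !reimE/= (distrC (Re _)) (distrC (Im _)); lra.
Qed.

(** Clearing the denominator of the difference quotient lets the increment
    vanish, which is what compositions need. *)
Lemma is_derivecP (g : R[i] -> R[i]) (z d : R[i]) :
  is_derive z 1 g d <-> forall e : R, 0 < e -> exists2 r : R, 0 < r &
    forall w, normc (w - z) < r -> normc (g w - g z - d * (w - z)) <= e * normc (w - z).
Proof.
split.
- move=> [dg Dg] e e0; have : h^-1 *: ((g \o shift z) h%:A - g z) @[h --> 0^'] --> d.
    by rewrite -Dg; exact: dg.
  move=> /cvgcP/(_ _ e0)/dnearcP[r r0 h]; exists r => // w wr.
  have [->|wz] := eqVneq w z; first by rewrite !subrr mulr0 subrr normc0 mulr0.
  have := h (w - z); rewrite subr0 normc_gt0 subr_eq0 wz wr => /(_ isT).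
  have -> : g w - g z - d * (w - z) =
      ((w - z)^-1 *: ((g \o shift z) (w - z)%:A - g z) - d) * (w - z).
    by rewrite /= /GRing.scale/= mulr1 subrK; field; rewrite subr_eq0.
  by rewrite normcM => k; rewrite ler_wpM2r ?normc_ge0// ltW.
- move=> h; have H : h^-1 *: ((g \o shift z) h%:A - g z) @[h --> 0^'] --> d.
    apply/cvgcP => e e0; have e20 : 0 < e / 2 by rewrite divr_gt0.
    have [r r0 k] := h _ e20; apply/dnearcP; exists r => // w /andP[].
    rewrite subr0 => w0 wr; have := k (w + z); rewrite addrK => /(_ wr) l.
    rewrite normc_gt0 in w0.
    have -> : w^-1 *: ((g \o shift z) w%:A - g z) - d = (g (w + z) - g z - d * w) / w.
      by rewrite /= /GRing.scale/= mulr1; field.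
    rewrite normcM normcV ltr_pdivrMr ?normc_gt0//.
    apply: (le_lt_trans l); rewrite ltr_pM2r ?normc_gt0//; lra.
  by split; [apply/cvg_ex; exists d | exact: cvg_lim].
Qed.

Lemma cderiv_eq (f g : R[i] -> R[i]) (z d e : R[i]) :
  f = g -> d = e -> is_derive z 1 f d -> is_derive z 1 g e.
Proof. by move=> -> ->. Qed.

Lemma cderiv_cst (a z : R[i]) : is_derive z 1 (fun=> a) 0.
Proof. exact: is_derive_cst. Qed.

Lemma cderiv_id (z : R[i]) : is_derive z 1 (fun w : R[i] => w) 1.
Proof. exact: is_derive_id. Qed.

Lemma cderivD (f g : R[i] -> R[i]) (z d e : R[i]) :
  is_derive z 1 f d -> is_derive z 1 g e -> is_derive z 1 (fun w => f w + g w) (d + e).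
Proof. exact: is_deriveD. Qed.

Lemma cderivB (f g : R[i] -> R[i]) (z d e : R[i]) :
  is_derive z 1 f d -> is_derive z 1 g e -> is_derive z 1 (fun w => f w - g w) (d - e).
Proof. exact: is_deriveB. Qed.

Lemma cderivM (f g : R[i] -> R[i]) (z d e : R[i]) :
  is_derive z 1 f d -> is_derive z 1 g e ->
  is_derive z 1 (fun w => f w * g w) (d * g z + f z * e).
Proof.
move=> df dg; have := is_deriveM df dg; apply: cderiv_eq => //.
by rewrite /GRing.scale/= addrC (mulrC d).
Qed.

Lemma cderivZ (a : R[i]) (f : R[i] -> R[i]) (z d : R[i]) :
  is_derive z 1 f d -> is_derive z 1 (fun w => a * f w) (a * d).
Proof.
by move=> df; have := cderivM (cderiv_cst a z) df; apply: cderiv_eq; rewrite ?mul0r ?add0r.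
Qed.

Lemma cderiv_comp (g f : R[i] -> R[i]) (z d e : R[i]) :
  is_derive z 1 f d -> is_derive (f z) 1 g e -> is_derive z 1 (g \o f) (e * d).
Proof.
move=> /is_derivecP hf /is_derivecP hg; apply/is_derivecP => eps eps0.
have K0 : 0 < normc d + 1 by rewrite ltr_wpDl ?normc_ge0.
have L0 : 0 < normc e + 1 by rewrite ltr_wpDl ?normc_ge0.
have e1 : 0 < eps / 2 / (normc d + 1) by rewrite !divr_gt0.
have e2 : 0 < eps / 2 / (normc e + 1) by rewrite !divr_gt0.
have [r1 r10 k1] := hg _ e1; have [r2 r20 k2] := hf _ e2; have [r3 r30 k3] := hf _ ltr01.
have r10' : 0 < r1 / (normc d + 1) by rewrite divr_gt0.
exists (Num.min (Num.min r2 r3) (r1 / (normc d + 1))); first by rewrite !lt_min r20 r30.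
move=> w; rewrite !lt_min => /andP[/andP[y2 y3] y1].
have l : normc (f w - f z) <= (normc d + 1) * normc (w - z).
  have := ler_normcD (f w - f z - d * (w - z)) (d * (w - z)).
  rewrite subrK normcM => /le_trans; apply.
  by rewrite mulrDl addrC lerD2l; exact: k3.
have := k1 (f w).
have -> : normc (f w - f z) < r1.
  by apply: (le_lt_trans l); rewrite mulrC -ltr_pdivlMr.
move=> /(_ isT) m1; have m2 := k2 _ y2.
have -> : (g \o f) w - (g \o f) z - e * d * (w - z) =
  (g (f w) - g (f z) - e * (f w - f z)) + e * (f w - f z - d * (w - z)).
  by rewrite /comp; ring.
apply: (le_trans (ler_normcD _ _)); rewrite normcM.
have : eps / 2 / (normc d + 1) * normc (f w - f z) <= eps / 2 * normc (w - z).
  by rewrite -!mulrA ler_pM2l// ler_pM2l// ler_pdivrMl.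
have : normc e * normc (f w - f z - d * (w - z)) <= eps / 2 * normc (w - z).
  apply: (@le_trans _ _ ((normc e + 1) * normc (f w - f z - d * (w - z)))).
    by rewrite ler_wpM2r ?normc_ge0// lerDl.
  by rewrite -ler_pdivlMl// mulrA (mulrC _^-1).
lra.
Qed.

Lemma cderivX (f : R[i] -> R[i]) (z d : R[i]) (n : nat) : is_derive z 1 f d ->
  is_derive z 1 (fun w => f w ^+ n) (n%:R * f z ^+ n.-1 * d).
Proof.
move=> df; elim: n => [|n ih].
  by apply: cderiv_eq (cderiv_cst 1 z); rewrite ?mul0r.
have := cderivM df ih; apply: cderiv_eq.
  by apply/funext => w; rewrite exprS.
case: n {ih} => [|n]; first by rewrite expr0 !mul0r mulr0 addr0 !mulr1 mul1r.
by rewrite [in RHS]mulrSr/= exprS; ring.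
Qed.

Lemma cderivV (z : R[i]) : z != 0 -> is_derive z 1 (fun w : R[i] => w^-1) (- z ^- 2).
Proof.
move=> z0; have n0 : 0 < normc z by rewrite normc_gt0.
apply/is_derivecP => e e0.
exists (Num.min (normc z / 2) (e * normc z ^+ 3 / 2)).
  by rewrite lt_min !divr_gt0// mulr_gt0// exprn_gt0.
move=> w; rewrite lt_min => /andP[w1 w2].
have wn : normc z / 2 < normc w.
  by have := lerB_normc z (z - w); rewrite subKr normcB; lra.
have w0 : w != 0 by rewrite -normc_gt0; lra.
have wn0 : 0 < normc w by rewrite normc_gt0.
have -> : w^-1 - z^-1 - - z ^- 2 * (w - z) = (w - z) ^+ 2 / (w * z ^+ 2).
  by field; rewrite w0 z0.
rewrite normcM normcX normcV normcM normcX [normc (w - z) ^+ 2]expr2 -mulrA [leLHS]mulrC ler_wpM2r ?normc_ge0//.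
rewrite ler_pdivrMr ?mulr_gt0 ?exprn_gt0//.
apply: le_trans (ltW w2) _.
have -> : e * normc z ^+ 3 / 2 = e * (normc z / 2 * normc z ^+ 2) by field.
by rewrite ler_pM2l// ler_pM2r ?exprn_gt0// ltW.
Qed.

Lemma cderivable_continuous (f : R[i] -> R[i]) (z : R[i]) (e : R) :
  derivable f z 1 -> 0 < e ->
  exists2 r : R, 0 < r & forall w, normc (w - z) < r -> normc (f w - f z) < e.
Proof.
move=> /derivableP; set d := 'D_1 f z => /is_derivecP/(_ _ ltr01)[r r0 h] e0.
have K0 : 0 < normc d + 1 by rewrite ltr_wpDl ?normc_ge0.
exists (Num.min r (e / (normc d + 1))); first by rewrite lt_min r0 divr_gt0.
move=> w; rewrite lt_min => /andP[w1 w2].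
have := ler_normcD (f w - f z - d * (w - z)) (d * (w - z)); rewrite subrK normcM.
move=> /le_lt_trans; apply; apply: (@le_lt_trans _ _ ((normc d + 1) * normc (w - z))).
  by rewrite mulrDl addrC lerD2l; exact: h.
by rewrite mulrC -ltr_pdivlMr.
Qed.

End ComplexNorm.

(** * Curves in the complex plane *)

Section RealVariable.
Context {R : realType}.
Implicit Types (z w : R[i]) (P Q : R -> R[i]).

(** R[i] is normed over itself, not over R, so the derivative of a curve is taken
    coordinatewise. *)
Definition rderiv P (x : R) (d : R[i]) :=
  is_derive x 1 (Re \o P) (Re d) /\ is_derive x 1 (Im \o P) (Im d).

Lemma is_derive_epsP (f : R -> R) (x d : R) :
  is_derive x 1 f d <-> forall e : R, 0 < e -> exists2 r : R, 0 < r &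
    forall y, `|y - x| < r -> `|f y - f x - d * (y - x)| <= e * `|y - x|.
Proof.
split.
- move=> [df Df] e e0; have : h^-1 *: ((f \o shift x) h%:A - f x) @[h --> 0^'] --> d.
    by rewrite -Df; exact: df.
  move=> /cvgrPdist_lt/(_ _ e0)[r /= r0 h]; exists r => // y yr.
  have [->|yx] := eqVneq y x; first by rewrite !subrr mulr0 subrr normr0 mulr0.
  have := h (y - x); rewrite /ball_/= sub0r normrN subr_eq0 => /(_ yr yx).
  have -> : f y - f x - d * (y - x) =
      - (d - (y - x)^-1 *: (f ((y - x) *: 1 + x) - f x)) * (y - x).
    by rewrite /= /GRing.scale/= mulr1 subrK; field; rewrite subr_eq0.
  by rewrite normrM normrN => k; rewrite ler_wpM2r// ltW.
- move=> h; have H : h^-1 *: ((f \o shift x) h%:A - f x) @[h --> 0^'] --> d.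
    apply/cvgrPdist_lt => e e0; have e20 : 0 < e / 2 by rewrite divr_gt0.
    have [r r0 k] := h _ e20; exists r => //= y /=; rewrite sub0r normrN => yr y0.
    have := k (y + x); rewrite addrK => /(_ yr) l.
    have -> : d - y^-1 *: (f (y%:A + x) - f x) = - ((f (y + x) - f x - d * y) / y).
      by rewrite /= /GRing.scale/= mulr1; field.
    rewrite normrN normrM normfV ltr_pdivrMr ?normr_gt0//.
    apply: (le_lt_trans l); rewrite ltr_pM2r ?normr_gt0//; lra.
  by split; [apply/cvg_ex; exists d | exact: cvg_lim].
Qed.

Lemma rderivP P x d : rderiv P x d <->
  forall e : R, 0 < e -> exists2 r : R, 0 < r &
    forall y, `|y - x| < r -> normc (P y - P x - d * (y - x)%:C) <= e * `|y - x|.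
Proof.
split=> [[/is_derive_epsP h1 /is_derive_epsP h2] e e0|h].
- have e20 : 0 < e / 2 by rewrite divr_gt0.
  have [r1 r10 k1] := h1 _ e20; have [r2 r20 k2] := h2 _ e20.
  exists (Num.min r1 r2); first by rewrite lt_min r10.
  move=> y; rewrite lt_min => /andP[/k1/= l1 /k2/= l2].
  apply: (le_trans (normc_le_ReIm _)); rewrite !reimE/= mulr0 subr0 mulr0 add0r.
  lra.
- split; apply/is_derive_epsP => e e0; have [r r0 k] := h _ e0; exists r => // y /k;
    apply: le_trans.
  + by apply: le_trans (ler_Re_normc _); rewrite !reimE/= mulr0 subr0.
  + by apply: le_trans (ler_Im_normc _); rewrite !reimE/= mulr0 add0r.
Qed.

Lemma rderiv_cst z x : rderiv (fun=> z) x 0.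
Proof. by split; exact: is_derive_cst. Qed.

Lemma rderiv_real (f : R -> R) (x d : R) :
  is_derive x 1 f d -> rderiv (fun y => (f y)%:C) x d%:C.
Proof. by move=> h; split => //; exact: is_derive_cst. Qed.

Lemma rderivD P Q x d e :
  rderiv P x d -> rderiv Q x e -> rderiv (fun y => P y + Q y) x (d + e).
Proof.
move=> [p1 p2] [q1 q2]; split.
- rewrite reD (_ : _ \o _ = (Re \o P) + (Re \o Q)); first exact: is_deriveD.
  by apply/funext => y; rewrite /= reD.
- rewrite imD (_ : _ \o _ = (Im \o P) + (Im \o Q)); first exact: is_deriveD.
  by apply/funext => y; rewrite /= imD.
Qed.

Lemma rderivM P Q x d e : rderiv P x d -> rderiv Q x e ->
  rderiv (fun y => P y * Q y) x (d * Q x + P x * e).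
Proof.
move=> [p1 p2] [q1 q2]; split.
- rewrite (_ : _ \o _ = (Re \o P) * (Re \o Q) - (Im \o P) * (Im \o Q)); last first.
    by apply/funext => y; rewrite /= reM.
  apply: (is_derive_eq (is_deriveB (is_deriveM p1 q1) (is_deriveM p2 q2))); rewrite !reimE/= /GRing.scale/=; ring.
- rewrite (_ : _ \o _ = (Re \o P) * (Im \o Q) + (Im \o P) * (Re \o Q)); last first.
    by apply/funext => y; rewrite /= imM.
  apply: (is_derive_eq (is_deriveD (is_deriveM p1 q2) (is_deriveM p2 q1))); rewrite !reimE/= /GRing.scale/=; ring.
Qed.

Lemma rderiv_eq P Q x d e : P = Q -> d = e -> rderiv P x d -> rderiv Q x e.
Proof. by move=> -> ->. Qed.

Lemma rderivZ z P x d : rderiv P x d -> rderiv (fun y => z * P y) x (z * d).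
Proof.
by move=> h; apply: rderiv_eq (rderivM (rderiv_cst z x) h); rewrite ?mul0r ?add0r.
Qed.

Lemma rderivN P x d : rderiv P x d -> rderiv (fun y => - P y) x (- d).
Proof.
move=> /(rderivZ (-1)); apply: rderiv_eq; rewrite ?mulN1r//.
by apply/funext => y; rewrite mulN1r.
Qed.

Lemma rderivB P Q x d e :
  rderiv P x d -> rderiv Q x e -> rderiv (fun y => P y - Q y) x (d - e).
Proof. by move=> p /rderivN; exact: rderivD. Qed.

Lemma rderiv_sum (I : Type) (r : seq I) (P : I -> R -> R[i]) (d : I -> R[i]) x :
  (forall i, rderiv (P i) x (d i)) ->
  rderiv (fun y => \sum_(i <- r) P i y) x (\sum_(i <- r) d i).
Proof.
move=> h; elim: r => [|i r ih].
  rewrite big_nil; apply: rderiv_eq (rderiv_cst 0 x) => //.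
  by apply/funext => y; rewrite big_nil.
rewrite big_cons; apply: rderiv_eq (rderivD (h i) ih) => //.
by apply/funext => y; rewrite big_cons.
Qed.

Lemma rderiv_comp (g : R[i] -> R[i]) P x d e :
  is_derive (P x) 1 g e -> rderiv P x d -> rderiv (g \o P) x (e * d).
Proof.
move=> /is_derivecP hg /rderivP hP; apply/rderivP => eps eps0.
have K0 : 0 < normc d + 1 by rewrite ltr_wpDl ?normc_ge0.
have L0 : 0 < normc e + 1 by rewrite ltr_wpDl ?normc_ge0.
have e1 : 0 < eps / 2 / (normc d + 1) by rewrite !divr_gt0.
have e2 : 0 < eps / 2 / (normc e + 1) by rewrite !divr_gt0.
have [r1 r10 k1] := hg _ e1; have [r2 r20 k2] := hP _ e2; have [r3 r30 k3] := hP _ ltr01.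
have r10' : 0 < r1 / (normc d + 1) by rewrite divr_gt0.
exists (Num.min (Num.min r2 r3) (r1 / (normc d + 1))); first by rewrite !lt_min r20 r30.
move=> y; rewrite !lt_min => /andP[/andP[y2 y3] y1].
have l : normc (P y - P x) <= (normc d + 1) * `|y - x|.
  have := ler_normcD (P y - P x - d * (y - x)%:C) (d * (y - x)%:C).
  rewrite subrK normcM normc_real => /le_trans; apply.
  by rewrite mulrDl addrC lerD2l; exact: k3.
have := k1 (P y).
have -> : normc (P y - P x) < r1.
  by apply: (le_lt_trans l); rewrite mulrC -ltr_pdivlMr.
move=> /(_ isT) m1; have m2 := k2 _ y2.
have -> : (g \o P) y - (g \o P) x - e * d * (y - x)%:C =
  (g (P y) - g (P x) - e * (P y - P x)) + e * (P y - P x - d * (y - x)%:C) by rewrite /=; ring.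
apply: (le_trans (ler_normcD _ _)); rewrite normcM.
have : eps / 2 / (normc d + 1) * normc (P y - P x) <= eps / 2 * `|y - x|.
  by rewrite -!mulrA ler_pM2l// ler_pM2l// ler_pdivrMl.
have : normc e * normc (P y - P x - d * (y - x)%:C) <= eps / 2 * `|y - x|.
  apply: (@le_trans _ _ ((normc e + 1) * normc (P y - P x - d * (y - x)%:C))).
    by rewrite ler_wpM2r ?normc_ge0// lerDl.
  by rewrite -ler_pdivlMl// mulrA (mulrC _^-1).
lra.
Qed.

Lemma rderiv_comp_real (u : R -> R) P (x a : R) d :
  is_derive x 1 u a -> rderiv P (u x) d -> rderiv (P \o u) x (a%:C * d).
Proof.
move=> hu [h1 h2]; split.
- by rewrite !reimE/= mul0r subr0 mulrC; exact: is_derive1_comp.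
- by rewrite !reimE/= mul0r addr0 mulrC; exact: is_derive1_comp.
Qed.

Lemma rderiv_continuous P x d : rderiv P x d ->
  {for x, continuous (Re \o P)} /\ {for x, continuous (Im \o P)}.
Proof.
by move=> [[h1 _] [h2 _]]; split; apply: differentiable_continuous; apply/derivable1_diffP.
Qed.

(** Multiplying P by the conjugate of [P b - P a] and taking real parts reduces the
    complex inequality to the real mean value theorem, for a function whose
    derivative is at most [normc (P b - P a) * g]. *)
Lemma mean_value_le (P h : R -> R[i]) (G g : R -> R) (a b : R) : a <= b ->
  (forall x, a <= x <= b -> rderiv P x (h x)) ->
  (forall x, a <= x <= b -> is_derive x 1 G (g x)) ->
  (forall x, a <= x <= b -> normc (h x) <= g x) ->
  normc (P b - P a) <= G b - G a.
Proof.
move=> ab hP hG hle; have [->|nz] := eqVneq (P b - P a) 0.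
  rewrite normc0 subr_ge0.
  have [->//|ab'] := eqVneq a b; have {}ab' : a < b by rewrite lt_neqAle ab'.
  have sub x : x \in `]a, b[ -> a <= x <= b by rewrite in_itv/= => /andP[/ltW-> /ltW->].
  have [|c cab] := @MVT R G g a b ab' (fun x xab => hG x (sub x xab)).
    apply: derivable_within_continuous => x; rewrite in_itv/= => /hG[]//.
  rewrite -subr_ge0 => ->; rewrite mulr_ge0 ?subr_ge0//.
  by rewrite (le_trans (normc_ge0 (h c)))// hle// sub.
have ab' : a < b.
  by rewrite lt_neqAle ab andbT; apply: contraNneq nz => ->; rewrite subrr.
have sub x : x \in `]a, b[ -> a <= x <= b by rewrite in_itv/= => /andP[/ltW-> /ltW->].
set c := (P b - P a)^*%C; set k := normc (P b - P a).
pose phi := (Re \o (fun x => c * P x)) - k *: G.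
pose dphi x := Re (c * h x) - k * g x.
have hphi x : a <= x <= b -> is_derive x 1 phi (dphi x).
  by move=> xab; have [h1 _] := rderivZ c (hP x xab); have h2 := hG x xab; apply: is_derive_eq.
have [|t tab] := @MVT R phi dphi a b ab' (fun x xab => hphi x (sub x xab)).
  apply: derivable_within_continuous => x; rewrite in_itv/= => /hphi[]//.
have nc : normc c = k.
  by rewrite /c /k; case: (P b - P a) => u v /=; rewrite sqrrN.
have k0 : 0 < k by rewrite normc_gt0.
have le0 : dphi t <= 0.
  rewrite subr_le0; apply: le_trans (ler_norm _) _; apply: le_trans (ler_Re_normc _) _.
  by rewrite normcM nc ler_wpM2l ?(ltW k0)// hle// sub.
move=> e; have : phi b - phi a <= 0.
  by rewrite e mulr_le0_ge0// subr_ge0.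
rewrite /phi /= !fctE /= => {e}.
have -> : Re (c * P b) - k *: G b - (Re (c * P a) - k *: G a) =
  Re (c * (P b - P a)) - k * (G b - G a).
  by rewrite /GRing.scale /= !reimE; ring.
have -> : Re (c * (P b - P a)) = k * k.
  rewrite -expr2 sqr_normcE /c; case: (P b - P a) => u v /=; ring.
by rewrite subr_le0 ler_pM2l.
Qed.

Lemma ex_primitive_right (h : R -> R) (a : R) : continuous h ->
  exists H : R -> R, forall x, a < x -> is_derive x 1 H (h x).
Proof.
move=> ch; exists (fun x => \int[lebesgue_measure]_(t in `[a, x]) h t) => x ax.
have xu : x < x + 1 by rewrite ltrDl.
have [|dH DH] := @continuous_FTC1_closed R h a x (x + 1) xu _ ax (ch x).
  apply: continuous_compact_integrable; first exact: segment_compact.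
  by apply: continuous_subspaceT.
by split; [exact: dH|rewrite -derive1E; exact: DH].
Qed.

Lemma is_derive_near (f g : R -> R) (x d r : R) : 0 < r ->
  (forall y, `|y - x| < r -> f y = g y) -> is_derive x 1 f d -> is_derive x 1 g d.
Proof.
move=> r0 fg /is_derive_epsP h; apply/is_derive_epsP => e /h[s s0 k].
exists (Num.min r s); first by rewrite lt_min r0.
move=> y; rewrite lt_min => /andP[yr ys]; rewrite -!fg//; first exact: k.
by rewrite subrr normr0.
Qed.

Lemma is_derive_reflect (f : R -> R) (x d : R) :
  is_derive (- x) 1 f d -> is_derive x 1 (fun y => f (- y)) (- d).
Proof.
move=> df; have := @is_derive1_comp R f -%R x d (-1) df (is_deriveNid x 1).
by rewrite mulrN1.
Qed.

(** The integral from a base point is a primitive to the right of that point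
    only, so primitives on two half-lines are glued. *)
Lemma ex_primitive (h : R -> R) : continuous h ->
  exists H : R -> R, forall x : R, is_derive x 1 H (h x).
Proof.
move=> ch; have [H1 d1] := ex_primitive_right (-1) ch.
have chN : continuous (fun x => h (- x)).
  move=> x; apply: (@continuous_comp _ _ _ -%R h); last exact: ch.
  exact: opp_continuous.
have [H2 d2] := ex_primitive_right (-1) chN.
have d2N (x : R) : x < 1 -> is_derive x 1 (fun y => - H2 (- y)) (h x).
  move=> x1; have := is_deriveN (is_derive_reflect (d2 (- x) _)).
  by rewrite !opprK; apply; rewrite ltrN2.
have agree (y : R) : -1 < y -> y <= 0 -> H1 y - H1 0 = H2 0 - H2 (- y).
  move=> y1 y0; apply/eqP; rewrite -subr_eq0 -normr_eq0 eq_le normr_ge0 andbT.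
  pose D t : R[i] := (H1 t - - H2 (- t))%:C.
  rewrite -normc_real -[X in _ <= X](subrr (0 : R)).
  have -> : (H1 y - H1 0 - (H2 0 - H2 (- y)))%:C = - (D 0 - D y) :> R[i].
    by rewrite /D oppr0; apply: complexP; rewrite !reimE/=; ring.
  rewrite normcNE.
  apply: (@mean_value_le D (fun=> 0) (fun=> 0) (fun=> 0)) => // [t /andP[yt t0]|t _]; last first.
    by rewrite normc0.
  have dt1 := d1 t (lt_le_trans y1 yt); have dt2 := d2N t (le_lt_trans t0 ltr01).
  have := rderiv_real (is_deriveB dt1 dt2); apply: rderiv_eq => //.
  by rewrite subrr.
pose H x := if 0 <= x then H1 x - H1 0 else H2 0 - H2 (- x).
exists H => x; have [x0|x0] := ltP (-1) x.
  have r0 : 0 < x + 1 by rewrite -ltrBlDr sub0r.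
  apply: (@is_derive_near (fun y => H1 y - H1 0) _ _ _ _ r0) => [y yr|].
    rewrite /H; case: (leP 0 y) => // y0; apply: agree (ltW y0).
    by move: yr; rewrite ltr_norml => /andP[]; lra.
  by have := is_deriveB (d1 x x0) (is_derive_cst (H1 0) x 1); rewrite subr0; exact.
have r0 : 0 < - x by rewrite oppr_gt0 (le_lt_trans x0)// ltrN10.
apply: (@is_derive_near (fun y => - H2 (- y) + H2 0) _ _ _ _ r0) => [y yr|].
  have y0 : y < 0 by move: yr; rewrite ltr_norml => /andP[]; lra.
  by rewrite /H leNgt y0/= addrC.
have x1 : x < 1 by rewrite (le_lt_trans x0)// (@lt_trans _ _ 0)// ltrN10.
by have := is_deriveD (d2N x x1) (is_derive_cst (H2 0) x 1); rewrite addr0; exact.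
Qed.

End RealVariable.

(** * Cauchy's theorem for rectangles *)

Section Goursat.
Context {R : realType}.
Implicit Types (a b c d : R) (Phi : R[i] -> R[i]) (X Y : R -> R -> R[i]).

(** X y and Y x play the role of primitives of a function along the horizontal line
    of height y and the vertical line of abscissa x. With fixed primitives, the
    additivity of the boundary integral under subdivision is a telescoping. *)
Definition rectangle_integral X Y a b c d : R[i] :=
  (X c b - X c a) + 'i * (Y b d - Y b c) - (X d b - X d a) - 'i * (Y a d - Y a c).

Definition edge_primitives Phi X Y a b c d :=
  (forall y x, c <= y <= d -> a <= x <= b -> rderiv (X y) x (Phi (x +i* y))) /\
  (forall x y, a <= x <= b -> c <= y <= d -> rderiv (Y x) y (Phi (x +i* y))).

Lemma edge_primitives_sub Phi X Y a b c d a' b' c' d' :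
  a <= a' -> b' <= b -> c <= c' -> d' <= d ->
  edge_primitives Phi X Y a b c d -> edge_primitives Phi X Y a' b' c' d'.
Proof.
move=> aa bb cc dd [h1 h2]; split=> [y x|x y] /andP[? ?] /andP[? ?].
  by apply: h1; apply/andP; split; lra.
by apply: h2; apply/andP; split; lra.
Qed.

Lemma rderiv_horizontal (x y : R) : rderiv (fun x => x +i* y) x 1.
Proof. by split; [exact: is_derive_id|exact: is_derive_cst]. Qed.

Lemma rderiv_vertical (x y : R) : rderiv (fun y => x +i* y) y 'i.
Proof. by split; [exact: is_derive_cst|exact: is_derive_id]. Qed.

(** Affine functions have complex primitives, whose increments around the rectangle
    cancel; only the distance to an affine function matters. *)
Lemma rectangle_integral_affine_le Phi X Y a b c d (z0 D : R[i]) (M : R) :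
  a <= b -> c <= d -> edge_primitives Phi X Y a b c d ->
  (forall x y, a <= x <= b -> c <= y <= d ->
     normc (Phi (x +i* y) - Phi z0 - D * (x +i* y - z0)) <= M) ->
  normc (rectangle_integral X Y a b c d) <= M * (2 * ((b - a) + (d - c))).
Proof.
move=> ab cd [hX hY] hM.
(* The affine part has the primitive A, so only the error term contributes. *)
pose A (z : R[i]) : R[i] := (Phi z0 - D * z0) * z + D / 2 * (z * z).
have dA (z : R[i]) : is_derive z 1 A (Phi z0 + D * (z - z0)).
  have := cderivD (cderivZ (Phi z0 - D * z0) (cderiv_id z))
    (cderivZ (D / 2) (cderivM (cderiv_id z) (cderiv_id z))).
  by apply: cderiv_eq => //; field.
have dMx (x : R) : is_derive x 1 (M *: id) M.
  by apply: is_derive_eq; rewrite /GRing.scale/= mulr1.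
have hor y : c <= y <= d ->
    normc ((X y b - A (b +i* y)) - (X y a - A (a +i* y))) <= M * b - M * a.
  move=> cyd; pose P x := X y x - A (x +i* y).
  apply: (@mean_value_le R P (fun x => Phi (x +i* y) - (Phi z0 + D * (x +i* y - z0)) * 1)
    (M *: id) (fun=> M)) => // x axb.
    by apply: rderivB; [exact: hX|apply: rderiv_comp (dA _) (rderiv_horizontal _ _)].
  by rewrite mulr1 opprD addrA hM.
have ver x : a <= x <= b ->
    normc (('i * Y x d - A (x +i* d)) - ('i * Y x c - A (x +i* c))) <= M * d - M * c.
  move=> axb; pose P y := 'i * Y x y - A (x +i* y).
  apply: (@mean_value_le R P (fun y => 'i * Phi (x +i* y) - (Phi z0 + D * (x +i* y - z0)) * 'i)
    (M *: id) (fun=> M)) => // y cyd.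
    apply: rderivB; first by apply: rderivZ; exact: hY.
    by apply: rderiv_comp (dA _) (rderiv_vertical _ _).
  by rewrite mulrC -mulrBl normcM normc_i mulr1 opprD addrA hM.
have -> : rectangle_integral X Y a b c d =
    ((X c b - A (b +i* c)) - (X c a - A (a +i* c)))
  + (('i * Y b d - A (b +i* d)) - ('i * Y b c - A (b +i* c)))
  - ((X d b - A (b +i* d)) - (X d a - A (a +i* d)))
  - (('i * Y a d - A (a +i* d)) - ('i * Y a c - A (a +i* c))).
  rewrite /rectangle_integral; ring.
have h1 := hor c; have h2 := ver b; have h3 := hor d; have h4 := ver a.
rewrite !lexx ab cd in h1 h2 h3 h4.
move: (h1 isT) (h2 isT) (h3 isT) (h4 isT).
set u1 := X c b - _ - _; set u2 := 'i * Y b d - _ - _.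
set u3 := X d b - _ - _; set u4 := 'i * Y a d - _ - _ => k1 k2 k3 k4.
have t1 := ler_normcB (u1 + u2 - u3) u4; have t2 := ler_normcB (u1 + u2) u3.
have t3 := ler_normcD u1 u2; lra.
Qed.

Lemma nested_halving (x : nat -> R) (w : R) : 0 <= w ->
  (forall n, x n <= x n.+1 /\ x n.+1 + w / 2 ^+ n.+1 <= x n + w / 2 ^+ n) ->
  exists x0, forall n, x n <= x0 <= x n + w / 2 ^+ n.
Proof.
move=> w0 h.
have mono n k : x n <= x (k + n)%N.
  by elim: k => // k ih; rewrite addSn (le_trans ih)//; case: (h (k + n)%N).
have anti n k : x (k + n)%N + w / 2 ^+ (k + n) <= x n + w / 2 ^+ n.
  by elim: k => // k ih; rewrite addSn (le_trans _ ih)//; case: (h (k + n)%N).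
have pos n : 0 <= w / 2 ^+ n by rewrite divr_ge0 ?exprn_ge0.
have all m n : x m <= x n + w / 2 ^+ n.
  have [le|/ltnW le] := leqP m n.
    by rewrite -(subnK le) (le_trans (mono m (n - m)%N))// lerDl.
  have := anti n (m - n)%N; rewrite subnK//; apply: le_trans.
  by rewrite lerDl.
have ub : has_ubound (range x) by exists (x 0%N + w / 2 ^+ 0) => _ [m _ <-].
exists (sup (range x)) => n; apply/andP; split.
  by apply: ub_le_sup => //; exists n.
by apply: ge_sup; [exists (x 0%N); exists 0%N|move=> _ [m _ <-]].
Qed.

(** Goursat: halving the rectangle repeatedly, one of the four quarters keeps at
    least a quarter of the integral, while near the limit point the integral
    is little-o of the area since an affine function contributes nothing. *)
Lemma goursat Phi X Y a b c d : a <= b -> c <= d ->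
  edge_primitives Phi X Y a b c d ->
  (forall x y, a <= x <= b -> c <= y <= d -> derivable Phi (x +i* y) 1) ->
  rectangle_integral X Y a b c d = 0.
Proof.
move=> ab cd prim der; set w := b - a; set h := d - c.
have w0 : 0 <= w by rewrite subr_ge0. have h0 : 0 <= h by rewrite subr_ge0.
pose I (p : R * R) n :=
  rectangle_integral X Y p.1 (p.1 + w / 2 ^+ n) p.2 (p.2 + h / 2 ^+ n).
have step (np : nat * (R * R)) : exists p' : R * R,
    [/\ p'.1 = np.2.1 \/ p'.1 = np.2.1 + w / 2 ^+ np.1.+1,
        p'.2 = np.2.2 \/ p'.2 = np.2.2 + h / 2 ^+ np.1.+1 &
        normc (I np.2 np.1) <= 4 * normc (I p' np.1.+1)].
  case: np => n [x y] /=; set w' := w / 2 ^+ n.+1; set h' := h / 2 ^+ n.+1.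
  have ew : w / 2 ^+ n = w' + w'.
    by rewrite /w' exprS; field; rewrite expf_neq0// pnatr_eq0.
  have eh : h / 2 ^+ n = h' + h'.
    by rewrite /h' exprS; field; rewrite expf_neq0// pnatr_eq0.
  have e : I (x, y) n = I (x, y) n.+1 + I (x + w', y) n.+1 + I (x, y + h') n.+1
      + I (x + w', y + h') n.+1.
    by rewrite /I /rectangle_integral /= ew eh -/w' -/h' !addrA; ring.
  have le4 : normc (I (x, y) n) <= normc (I (x, y) n.+1) + normc (I (x + w', y) n.+1)
      + normc (I (x, y + h') n.+1) + normc (I (x + w', y + h') n.+1).
    rewrite e; apply: le_trans (ler_normcD _ _) _; rewrite lerD2r.
    by apply: le_trans (ler_normcD _ _) _; rewrite lerD2r; exact: ler_normcD.
  have [k1|k1] := leP (normc (I (x, y) n)) (4 * normc (I (x, y) n.+1)).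
    by exists (x, y) => /=; split=> //; left.
  have [k2|k2] := leP (normc (I (x, y) n)) (4 * normc (I (x + w', y) n.+1)).
    by exists (x + w', y) => /=; split=> //; [right|left].
  have [k3|k3] := leP (normc (I (x, y) n)) (4 * normc (I (x, y + h') n.+1)).
    by exists (x, y + h') => /=; split=> //; [left|right].
  exists (x + w', y + h') => /=; split=> //; [by right|by right|].
  lra.
have [next nextP] := choice step.
(* s n is the lower left corner of the n-th nested rectangle, of sides w / 2 ^ n
   and h / 2 ^ n. *)
pose s := fix s n := if n is n'.+1 then next (n', s n') else (a, c).
have sS n := nextP (n, s n).
have half (v : R) n : v / 2 ^+ n = v / 2 ^+ n.+1 + v / 2 ^+ n.+1.
  by rewrite exprS; field; rewrite expf_neq0// pnatr_eq0.
have pos (v : R) n : 0 <= v -> 0 <= v / 2 ^+ n by move=> ?; rewrite divr_ge0 ?exprn_ge0.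
have [x0 hx0] : exists x0, forall n, (s n).1 <= x0 <= (s n).1 + w / 2 ^+ n.
  apply: (@nested_halving (fun n => (s n).1) w w0) => n; rewrite (half w n).
  by have /= [[] -> _ _] := sS n; have := pos w n.+1 w0; split; lra.
have [y0 hy0] : exists y0, forall n, (s n).2 <= y0 <= (s n).2 + h / 2 ^+ n.
  apply: (@nested_halving (fun n => (s n).2) h h0) => n; rewrite (half h n).
  by have /= [_ [] -> _] := sS n; have := pos h n.+1 h0; split; lra.
have inside n : [/\ a <= (s n).1, (s n).1 + w / 2 ^+ n <= b, c <= (s n).2 &
    (s n).2 + h / 2 ^+ n <= d].
  elim: n => [|n [i1 i2 i3 i4]]; first by rewrite /= expr0 !divr1 /w /h; split; lra.
  rewrite (half w n) in i2; rewrite (half h n) in i4.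
  have /= [h1 h2 _] := sS n.
  move: (pos w n.+1 w0) (pos h n.+1 h0) i2 i4 h1 h2.
  move: (w / _) (h / _) (next _).1 (next _).2 => u v x' y' p1 p2 i2 i4.
  clear - i1 i3 p1 p2 i2 i4.
  by move=> [->|->] [->|->]; split; lra.
have big n : normc (rectangle_integral X Y a b c d) <= 4 ^+ n * normc (I (s n) n).
  elim: n => [|n ih].
    rewrite mul1r /I /= expr0 !divr1 /w /h.
    by rewrite [a + _]addrC [c + _]addrC !subrK.
  apply: le_trans ih _; rewrite exprSr -mulrA ler_pM2l ?exprn_gt0//.
  by have [] := sS n.
have [D /is_derivecP hD] : exists D, is_derive (x0 +i* y0) 1 Phi D.
  have /derivableP hD : derivable Phi (x0 +i* y0) 1.
    have := hx0 0%N; have := hy0 0%N; have [] := inside 0%N => i1 i2 i3 i4 j1 j2.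
    by apply: der; lra.
  by eexists; exact: hD.
have small e : 0 < e -> normc (rectangle_integral X Y a b c d) <= e * (2 * (w + h) ^+ 2).
  move=> e0; have [r r0 hr] := hD e e0.
  have [n hn] : exists n, (w + h) / 2 ^+ n < r.
    have K0 : 0 < w + h + 1 by move: w0 h0; clear; lra.
    have rK : 0 < r / (w + h + 1) by rewrite divr_gt0.
    have [n _ hn] := near_infty_natSinv_expn_lt (PosNum rK); exists n.
    have := hn n (leqnn n); rewrite /= ltr_pdivlMr// mul1r mulrC; apply: le_lt_trans.
    by rewrite ler_wpM2r ?invr_ge0 ?exprn_ge0// lerDl.
  have [i1 i2 i3 i4] := inside n; have p1 := pos w n w0; have p2 := pos h n h0.
  have le : normc (I (s n) n) <= (e * ((w + h) / 2 ^+ n)) * (2 * ((w + h) / 2 ^+ n)).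
    rewrite [(w + h) / 2 ^+ n](mulrDl w h).
    have := @rectangle_integral_affine_le Phi X Y (s n).1 ((s n).1 + w / 2 ^+ n)
      (s n).2 ((s n).2 + h / 2 ^+ n) (x0 +i* y0) D (e * (w / 2 ^+ n + h / 2 ^+ n)).
    have -> : (s n).1 + w / 2 ^+ n - (s n).1 = w / 2 ^+ n by rewrite addrAC subrr add0r.
    have -> : (s n).2 + h / 2 ^+ n - (s n).2 = h / 2 ^+ n by rewrite addrAC subrr add0r.
    apply; rewrite ?lerDl//.
      by apply: edge_primitives_sub prim.
    move=> x y hx hy.
    have zz : normc (x +i* y - (x0 +i* y0)) <= w / 2 ^+ n + h / 2 ^+ n.
      apply: le_trans (normc_le_ReIm _) _ => /=.
      by apply: lerD; rewrite ler_norml; have := hx0 n; have := hy0 n; lra.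
    apply: le_trans (hr _ _) _; last by rewrite ler_pM2l.
    by apply: le_lt_trans zz _; rewrite -mulrDl.
  apply: le_trans (big n) _; apply: le_trans (ler_wpM2l _ le) _; first by rewrite exprn_ge0.
  rewrite le_eqVlt; apply/orP; left; apply/eqP.
  have -> : 4 ^+ n = 2 ^+ n * 2 ^+ n :> R by rewrite -exprMn; congr (_ ^+ _); ring.
  by field; rewrite expf_neq0// pnatr_eq0.
apply/eqP; rewrite -normc_eq0 eq_le normc_ge0 andbT leNgt; apply/negP => p.
set N := normc _ in p small.
have K0 : 0 < 2 * (w + h) ^+ 2 + 1 by rewrite ltr_wpDl// mulr_ge0// exprn_ge0// addr_ge0.
have := small (N / (2 * (w + h) ^+ 2 + 1) / 2); rewrite !divr_gt0// => /(_ isT).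
rewrite leNgt => /negP; apply.
have -> : N / (2 * (w + h) ^+ 2 + 1) / 2 * (2 * (w + h) ^+ 2) =
    (N / 2) * (2 * (w + h) ^+ 2 / (2 * (w + h) ^+ 2 + 1)).
  by field; rewrite lt0r_neq0.
have q1 : 2 * (w + h) ^+ 2 / (2 * (w + h) ^+ 2 + 1) <= 1.
  by rewrite ler_pdivrMr// mul1r lerDl.
apply: (@le_lt_trans _ _ (N / 2 * 1)); first by rewrite ler_pM2l// divr_gt0.
lra.
Qed.

End Goursat.

(** * Exponential and logarithm *)

Section ExpLog.
Context {R : realType}.
Implicit Types (z w h : R[i]).

Lemma cexpD z w : cexp (z + w) = cexp z * cexp w.
Proof.
apply: complexP; rewrite /cexp !reimE/= !mul0r !addr0 !subr0 expRD ?cosD ?sinD; ring.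
Qed.

Lemma cexp0 : cexp 0 = 1 :> R[i].
Proof. by rewrite /cexp/= expR0 cos0 sin0 mul1r. Qed.

Lemma normc_cexp z : normc (cexp z) = expR (Re z).
Proof.
by rewrite /cexp normcM normc_real ger0_norm ?expR_ge0//= cos2Dsin2 sqrtr1 mulr1.
Qed.

Lemma cexp_neq0 z : cexp z != 0.
Proof. by rewrite -normc_eq0 normc_cexp expR_eq0. Qed.

Lemma cexpN z : cexp (- z) = (cexp z)^-1.
Proof.
by apply: (mulfI (cexp_neq0 z)); rewrite -cexpD subrr cexp0 divff ?cexp_neq0.
Qed.

Lemma cexp_real (x : R) : cexp x%:C = (expR x)%:C.
Proof. by rewrite /cexp/= cos0 sin0 mulr1. Qed.

Lemma cexp_pi : cexp ('i * (pi : R)%:C) = -1.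
Proof.
rewrite /cexp !reimE/= !mul0r !mul1r subr0 expR0 add0r cospi sinpi mul1r.
by apply/eqP; rewrite eq_complex/= oppr0 !eqxx.
Qed.

Lemma rderiv_cexp_line h (t : R) :
  rderiv (fun t => cexp (t%:C * h)) t (h * cexp (t%:C * h)).
Proof.
have eq (s : R) : cexp (s%:C * h) =
    (expR (s * Re h))%:C * (cos (s * Im h) +i* sin (s * Im h)).
  by rewrite /cexp !reimE/= !mul0r subr0 addr0.
have dl (v : R) : is_derive t 1 (fun s => s * v) v.
  have -> : (fun s => s * v) = v *: id by apply/funext => s; rewrite /GRing.scale/= mulrC.
  by apply: is_derive_eq; rewrite /GRing.scale/= mulr1.
have de := rderiv_real (@is_derive1_comp R expR _ t _ _ (is_derive_expR _) (dl (Re h))).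
have dcs : rderiv (fun s => cos (s * Im h) +i* sin (s * Im h)) t
    ((- sin (t * Im h) * Im h) +i* (cos (t * Im h) * Im h)).
  split.
  - exact: (@is_derive1_comp R cos _ t _ _ (is_derive_cos _) (dl (Im h))).
  - exact: (@is_derive1_comp R sin _ t _ _ (is_derive_sin _) (dl (Im h))).
apply: rderiv_eq (rderivM de dcs); first by apply/funext => s; rewrite eq.
by rewrite eq; apply: complexP; rewrite !reimE/=; ring.
Qed.

(** Two mean value estimates along the segment from 0 to h, for [cexp - 1] and then for
    [cexp - 1 - h]. *)
Lemma cexp_sub1_le h : normc h <= 1 -> normc (cexp h - 1 - h) <= expR 1 * normc h ^+ 2.
Proof.
move=> h1; pose E (t : R) := cexp (t%:C * h).
have dlin (M : R) (t : R) : is_derive t 1 (M *: id) M.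
  by apply: is_derive_eq; rewrite /GRing.scale/= mulr1.
have first t : 0 <= t <= 1 -> normc (E t - 1) <= expR 1 * normc h.
  move=> /andP[t0 t1].
  have -> : E t - 1 = E t - E 0 by rewrite /E mul0r cexp0.
  apply: (@le_trans _ _ ((expR 1 * normc h) * t - (expR 1 * normc h) * 0)); last first.
    by rewrite mulr0 subr0 ler_piMr// mulr_ge0 ?expR_ge0 ?normc_ge0.
  apply: (mean_value_le (h := fun s => h * E s) (G := (expR 1 * normc h) *: id)
    (g := fun=> expR 1 * normc h) t0) => // s /andP[s0 s1].
    exact: rderiv_cexp_line.
  rewrite normcM mulrC ler_wpM2r ?normc_ge0// normc_cexp ler_expR !reimE/= mul0r subr0.
  apply: le_trans (ler_norm _) _; rewrite normrM.
  rewrite -[leRHS]mulr1; apply: ler_pM; rewrite ?normr_ge0//.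
    by rewrite ger0_norm// (le_trans s1).
  exact: le_trans (ler_Re_normc _) h1.
pose Q (t : R) := E t - t%:C * h.
have -> : cexp h - 1 - h = Q 1 - Q 0 by rewrite /Q /E !mul1r !mul0r cexp0; ring.
pose K := expR 1 * normc h ^+ 2.
have -> : expR 1 * normc h ^+ 2 = (K *: id) 1 - (K *: (id : R -> R)) 0.
  by rewrite !fctE /GRing.scale/= mulr1 mulr0 subr0.
apply: (mean_value_le (h := fun s => h * E s - h) (G := K *: id) (g := fun=> K)).
- exact: ler01.
- move=> s _; apply: rderivB; first exact: rderiv_cexp_line.
  have := rderivM (rderiv_real (is_derive_id s 1)) (rderiv_cst h s).
  by apply: rderiv_eq; rewrite // mul1r mulr0 addr0.
- move=> s s01; rewrite -[X in _ - X]mulr1 -mulrBr normcM /K expr2 mulrCA.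
  by rewrite ler_wpM2l ?normc_ge0// first.
Qed.

Lemma is_derive_cexp z : is_derive z 1 (@cexp R) (cexp z).
Proof.
apply/is_derivecP => e e0; set K := normc (cexp z) * expR 1.
have K0 : 0 < K by rewrite /K normc_cexp mulr_gt0 ?expR_gt0.
exists (Num.min 1 (e / K)); first by rewrite lt_min ltr01 divr_gt0.
move=> w; rewrite lt_min => /andP[/ltW w1 w2]; set h := w - z in w1 w2 *.
have -> : cexp w - cexp z - cexp z * h = cexp z * (cexp h - 1 - h).
  have -> : w = z + h by rewrite /h addrC subrK.
  by rewrite cexpD; ring.
rewrite normcM; apply: (@le_trans _ _ (normc (cexp z) * (expR 1 * normc h ^+ 2))).
  by rewrite ler_wpM2l ?normc_ge0// cexp_sub1_le.
rewrite mulrA -/K expr2 mulrA ler_wpM2r ?normc_ge0// mulrC -ler_pdivlMr//.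
exact: ltW.
Qed.

(** What is needed of the principal logarithm near 1; every other local branch is
    a translate of it. *)
Lemma cexp_local_inverse (e : R) : 0 < e -> exists2 r : R, 0 < r &
  forall z, normc (z - 1) < r -> exists2 k, normc k < e & cexp k = z.
Proof.
move=> e0; have e20 : 0 < e / 2 by rewrite divr_gt0.
have asin0 : asin (0 : R) = 0.
  by rewrite -[RHS]sinK ?sin0// in_itv/= oppr_le0 divr_ge0 ?pi_ge0.
have := @continuous_ln R 1 ltr01; move/cvgrPdist_lt => /(_ _ e20)[r1 /= r10 h1].
have : {for (0 : R), continuous (@asin R)} by apply: continuous_asin; rewrite ltrN10 ltr01.
move/cvgrPdist_lt => /(_ _ e20)[r2 /= r20 h2].
exists (Num.min (1 / 2) (Num.min r1 (r2 / 2))); first by rewrite !lt_min r10 !divr_gt0.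
move=> z; rewrite !lt_min => /and3P[z12 zr1 zr2].
set n := normc z; set x := Re z; set y := Im z.
have nz : `|n - 1| <= normc (z - 1).
  have a1 := lerB_normc z 1; have a2 := lerB_normc 1 z.
  by rewrite normc1 -/n in a1 a2; rewrite normcB in a2; rewrite ler_norml; lra.
have n0 : 1 / 2 < n by move: nz; rewrite ler_norml; lra.
have n00 : 0 < n by lra.
have n2 : n ^+ 2 = x ^+ 2 + y ^+ 2 by exact: sqr_normcE.
have x0 : 0 < x.
  by have := ler_Re_normc (z - 1); rewrite !reimE/= -/x ler_norml; lra.
have yle : `|y| <= normc (z - 1).
  by have := ler_Im_normc (z - 1); rewrite !reimE/= subr0.
have u1 : -1 <= y / n <= 1.
  rewrite -ler_norml normrM normfV (gtr0_norm n00) ler_pdivrMr// mul1r.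
  exact: ler_Im_normc.
exists (ln n +i* asin (y / n)).
  apply: le_lt_trans (normc_le_ReIm _) _ => /=.
  have := h1 n; rewrite /= ln1 sub0r normrN distrC => /(_ (le_lt_trans nz zr1)).
  have := h2 (y / n); rewrite /= asin0 !sub0r !normrN => h2'.
  have {}h2' : `|asin (y / n)| < e / 2.
    apply: h2'; rewrite normrM normfV (gtr0_norm n00) ltr_pdivrMr//.
    by apply: (@lt_trans _ _ (r2 * (1 / 2))); [lra|rewrite ltr_pM2l].
  by lra.
rewrite /cexp/= lnK ?posrE// asinK ?in_itv// cos_asin//.
have -> : 1 - (y / n) ^+ 2 = (x / n) ^+ 2.
  rewrite !expr_div_n -[1](@divff _ (n ^+ 2)) ?expf_neq0 ?lt0r_neq0//.
  by rewrite -mulrBl n2 addrK.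
rewrite sqrtr_sqr ger0_norm ?divr_ge0 ?(ltW x0) ?(ltW n00)//.
by apply: complexP; rewrite !reimE/= !mul0r ?subr0 ?addr0 mulrC mulfVK ?lt0r_neq0.
Qed.

(** Two logarithms of one number differ by an imaginary period; in the strip that
    defines the branch the difference is smaller than 2 pi. *)
Lemma clog_cexp w : - (pi / 2) < Im w <= 3 * pi / 2 -> clog (cexp w) = w.
Proof.
move=> hw; rewrite /clog; set P := [set _ | _].
have Pw : P w by [].
have [e hv] : P (xget 0 P) by case: xgetP => // /(_ w).
set v := xget 0 P in e hv *.
have : cexp (v - w) = 1 by rewrite cexpD cexpN e divff ?cexp_neq0.
move=> e1; have := congr1 (@normc R) e1; rewrite normc_cexp normc1 => /eqP re0.
have {}re0 : Re (v - w) = 0 by apply: expR_inj; rewrite expR0; exact/eqP.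
move: e1; rewrite /cexp re0 expR0 mul1r => -[c1 s0].
have {}hv : - (pi *+ 2) < Im (v - w) < pi *+ 2.
  move: hw hv => /andP[? ?] /andP[? ?]; rewrite imD imN mulr2n; apply/andP; split; lra.
have im0 : Im (v - w) = 0.
  set t := Im (v - w) in c1 hv *.
  have c2 : cos `|t| = 1 by case: (ler0P t) => _ //; rewrite cosN.
  have t2 : `|t| < pi *+ 2 by rewrite ltr_norml.
  have [tp|tp] := leP `|t| pi.
    apply/eqP; rewrite -normr_eq0; apply/eqP; apply: (@cos_inj R).
    + by rewrite in_itv/= normr_ge0.
    + by rewrite in_itv/= lexx pi_ge0.
    + by rewrite c2 cos0.
  have : cos (pi *+ 2 - `|t|) = 1.
    by rewrite addrC cosD2pi cosN.
  rewrite -[1]cos0 => /(@cos_inj R); rewrite !in_itv/= lexx pi_ge0.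
  have -> : 0 <= pi *+ 2 - `|t| <= pi by rewrite mulr2n in t2 *; apply/andP; split; lra.
  move=> /(_ isT isT) h; exfalso; move: h t2; rewrite mulr2n; lra.
by apply/eqP; rewrite -subr_eq0; apply/eqP/complexP; rewrite ?re0 ?im0.
Qed.

Lemma polar_upper z : z != 0 -> 0 <= Im z -> exists2 w, cexp w = z & 0 <= Im w <= pi.
Proof.
move=> z0 y0; set n := normc z; have n0 : 0 < n by rewrite normc_gt0.
have u1 : -1 <= Re z / n <= 1.
  rewrite -ler_norml normrM normfV (gtr0_norm n0) ler_pdivrMr// mul1r.
  exact: ler_Re_normc.
exists (ln n +i* acos (Re z / n)); last by rewrite /= acos_ge0 ?acos_lepi.
rewrite /cexp/= lnK ?posrE// acosK ?in_itv// sin_acos//.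
have -> : 1 - (Re z / n) ^+ 2 = (Im z / n) ^+ 2.
  rewrite !expr_div_n -[1](@divff _ (n ^+ 2)) ?expf_neq0 ?lt0r_neq0//.
  by rewrite -mulrBl sqr_normcE addrC addKr.
rewrite sqrtr_sqr ger0_norm ?divr_ge0 ?(ltW n0)//.
by apply: complexP; rewrite !reimE/= !mul0r ?subr0 ?addr0 mulrC mulfVK ?lt0r_neq0.
Qed.

(** Near [z = cexp w] the logarithm of z' is w + k with [cexp k = z' / z], and
    [cexp k - 1] differs from k by a small multiple of k. *)
Lemma is_derive_clog w : - (pi / 2) < Im w < 3 * pi / 2 ->
  is_derive (cexp w) 1 (@clog R) (cexp w)^-1.
Proof.
move=> /andP[w1 w2]; set z := cexp w; have z0 : z != 0 by exact: cexp_neq0.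
have n0 : 0 < normc z by rewrite normc_gt0.
apply/is_derivecP => e e0.
pose e' := Num.min (1 / 2) (e * normc z / 2).
have e'0 : 0 < e' by rewrite lt_min !divr_gt0// mulr_gt0.
have /is_derivecP/(_ _ e'0)[r1 r10 h1] := is_derive_cexp 0.
pose gap := Num.min r1 (Num.min (Im w + pi / 2) (3 * pi / 2 - Im w)).
have gap0 : 0 < gap by rewrite !lt_min r10; apply/andP; split; lra.
have [r2 r20 h2] := cexp_local_inverse gap0.
exists (r2 * normc z); first by rewrite mulr_gt0.
move=> z' z'r; have [|k kgap kz] := h2 (z' / z).
  have -> : z' / z - 1 = (z' - z) / z by field.
  by rewrite normcM normcV ltr_pdivrMr.
have ez' : z' = cexp (w + k) by rewrite cexpD kz mulrC divfK.
move: kgap; rewrite !lt_min => /and3P[k1 k2 k3].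
have hk := ler_Im_normc k; move: hk; rewrite ler_norml => /andP[hk1 hk2].
rewrite ez' clog_cexp; last by rewrite imD; apply/andP; split; lra.
rewrite clog_cexp; last by apply/andP; split; lra.
have hk : normc (cexp k - 1 - k) <= e' * normc k.
  by have := h1 k; rewrite subr0 cexp0 mul1r; exact.
have -> : w + k - w - z^-1 * (cexp (w + k) - z) = - (cexp k - 1 - k).
  by rewrite cexpD -/z; field.
rewrite normcNE; apply: (le_trans hk).
have -> : cexp (w + k) - z = z * (cexp k - 1) by rewrite cexpD -/z; ring.
rewrite normcM.
have kle : normc k <= 2 * normc (cexp k - 1).
  have e12 : e' <= 1 / 2 by rewrite ge_min lexx.
  have := lerB_normc k (- (cexp k - 1 - k)).
  have -> : k - - (cexp k - 1 - k) = cexp k - 1 by ring.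
  rewrite normcNE.
  have : e' * normc k <= 1 / 2 * normc k by rewrite ler_wpM2r ?normc_ge0.
  lra.
have e2 : e' <= e * normc z / 2 by rewrite ge_min lexx orbT.
apply: (@le_trans _ _ (e * normc z / 2 * (2 * normc (cexp k - 1)))).
  by apply: ler_pM; rewrite ?normc_ge0 ?(ltW e'0).
by rewrite le_eqVlt; apply/orP; left; apply/eqP; field.
Qed.

End ExpLog.

(** * Taylor and Laurent expansions *)

Section Peano.
Context {R : realType}.
Implicit Types (z w : R[i]) (f g h : R[i] -> R[i]) (p q : {poly R[i]}).

Lemma normc_horner_le p w : 1 <= normc w ->
  normc p.[w] <= (\sum_(i < size p) normc p`_i) * normc w ^+ (size p).-1.
Proof.
move=> w1; rewrite horner_coef mulr_suml; apply: le_trans (ler_normc_sum _ _ _) _.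
apply: ler_sum => i _; rewrite normcM normcX ler_wpM2l ?normc_ge0//.
by rewrite ler_weXn2l// -ltnS prednK// (leq_ltn_trans _ (ltn_ord i)).
Qed.

Lemma normc_horner_bounded p : exists2 M, 0 < M &
  forall w, normc w <= 1 -> normc p.[w] <= M.
Proof.
exists (\sum_(i < size p) normc p`_i + 1).
  by rewrite ltr_wpDl// sumr_ge0// => i _; rewrite normc_ge0.
move=> w w1; rewrite horner_coef; apply: le_trans (ler_normc_sum _ _ _) _.
apply: (@le_trans _ _ (\sum_(i < size p) normc p`_i)); last by rewrite lerDl.
apply: ler_sum => i _; rewrite normcM normcX ler_piMr ?normc_ge0//.
by rewrite exprn_ile1 ?normc_ge0.
Qed.

Lemma cderiv_horner p z : is_derive z 1 (fun w => p.[w]) (p^`()).[z].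
Proof.
elim/poly_ind: p => [|p c ih].
  by apply: cderiv_eq (cderiv_cst 0 z); rewrite ?deriv0 ?horner0//; apply/funext => w; rewrite horner0.
have := cderivD (cderivM ih (cderiv_id z)) (cderiv_cst c z); apply: cderiv_eq.
  by apply/funext => w; rewrite !hornerE.
by rewrite derivD derivM derivX derivC !hornerE.
Qed.

Lemma cderiv_near f g z (d : R[i]) : (\forall w \near z, f w = g w) ->
  is_derive z 1 f d -> is_derive z 1 g d.
Proof.
move=> /nearcP[r1 r10 fg] /is_derivecP h; apply/is_derivecP => e /h[r2 r20 k].
exists (Num.min r1 r2); first by rewrite lt_min r10.
move=> w; rewrite lt_min => /andP[w1 w2]; rewrite -!fg ?subrr ?normc0//; exact: k.
Qed.

(** An asymptotic expansion, not a convergent series: such expansions pass to products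
    and to primitives of functions not yet known to be analytic. *)
Definition peano h z (N : nat) := exists p (K r : R),
  0 < r /\ forall w, normc (w - z) < r -> normc (h w - p.[w - z]) <= K * normc (w - z) ^+ N.

Lemma peano_bounded h z N : peano h z N ->
  exists M r : R, [/\ 0 <= M, 0 < r & forall w, normc (w - z) < r -> normc (h w) <= M].
Proof.
move=> [p [K [r [r0 hp]]]]; have [M M0 hM] := normc_horner_bounded p.
exists (`|K| + M), (Num.min r 1); split; first by rewrite addr_ge0// ltW.
  by rewrite lt_min r0 ltr01.
move=> w; rewrite lt_min => /andP[w1 /ltW w2].
have := ler_normcD (h w - p.[w - z]) p.[w - z]; rewrite subrK => /le_trans; apply.
apply: lerD; last exact: hM.
apply: le_trans (hp _ w1) _; apply: le_trans (ler_norm _) _; rewrite normrM.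
by rewrite ler_piMr// ger0_norm ?exprn_ge0 ?exprn_ile1 ?normc_ge0.
Qed.

Lemma peanoM f g z N : peano f z N -> peano g z N -> peano (fun w => f w * g w) z N.
Proof.
move=> pf pg; have [M [r3 [M0 r30 hM]]] := peano_bounded pg.
move: pf pg => [p [K1 [r1 [r10 h1]]]] [q [K2 [r2 [r20 h2]]]].
have [B B0 hB] := normc_horner_bounded p.
exists (p * q), (K1 * M + B * K2), (Num.min (Num.min r1 r2) (Num.min r3 1)).
split; first by rewrite !lt_min r10 r20 r30 ltr01.
move=> w; rewrite !lt_min => /andP[/andP[w1 w2] /andP[w3 /ltW w4]].
have -> : f w * g w - (p * q).[w - z] =
    (f w - p.[w - z]) * g w + p.[w - z] * (g w - q.[w - z]).
  by rewrite hornerM; ring.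
apply: le_trans (ler_normcD _ _) _; rewrite !normcM mulrDl; apply: lerD.
  rewrite mulrAC; apply: ler_pM; rewrite ?normc_ge0//; [exact: h1|exact: hM].
rewrite -mulrA; apply: ler_pM; rewrite ?normc_ge0//; [exact: hB|exact: h2].
Qed.

Lemma peanoZ (a : R[i]) f z N : peano f z N -> peano (fun w => a * f w) z N.
Proof.
move=> [p [K [r [r0 h]]]]; exists (a *: p), (normc a * K), r; split=> // w /h k.
by rewrite hornerZ -mulrBr normcM -mulrA ler_wpM2l ?normc_ge0.
Qed.

Lemma peano_poly p z N : peano (fun w => p.[w]) z N.
Proof.
exists (p \Po ('X + z%:P)), 0, 1; split; first exact: ltr01.
by move=> w _; rewrite horner_comp !hornerE subrK subrr normc0.
Qed.

Lemma peano0 h z : derivable h z 1 -> peano h z 0.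
Proof.
move=> /cderivable_continuous/(_ ltr01)[r r0 hr]; exists (h z)%:P, 1, r; split => // w wr.
by rewrite hornerC expr0 mulr1 ltW// hr.
Qed.

Lemma ex_antiderivative p (c : R[i]) : exists2 q, q^`() = p & q.[0] = c.
Proof.
exists (\poly_(i < (size p).+1) (if i is i'.+1 then p`_i' / i'.+1%:R else c)); last first.
  by rewrite horner_coef0 coef_poly.
apply/polyP => i; rewrite coef_deriv coef_poly ltnS.
case: ltnP => [_|ip]; last by rewrite mul0rn nth_default.
by rewrite -[LHS]mulr_natr divfK// pnatr_eq0.
Qed.

(** Integration along segments gains one order. *)
Lemma peano_integral h h' z (N : nat) : (\forall w \near z, is_derive (w : R[i]) 1 h (h' w)) ->
  peano h' z N -> peano h z N.+1.
Proof.
move=> /nearcP[r1 r10 hd] [p [K [r2 [r20 hp]]]].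
have [q qp q0] := ex_antiderivative p (h z).
exists q, K, (Num.min r1 r2); split; first by rewrite lt_min r10.
move=> w; rewrite lt_min => /andP[w1 w2].
pose seg (t : R) : R[i] := z + t%:C * (w - z).
pose D (v : R[i]) := h v - q.[v - z].
have segE t : seg t - z = t%:C * (w - z) by rewrite /seg addrAC subrr add0r.
have seg_le t : 0 <= t <= 1 -> normc (seg t - z) <= normc (w - z).
  move=> /andP[t0 t1]; rewrite segE normcM normc_real ger0_norm//.
  by rewrite ler_piMl// normc_ge0.
have dseg (t : R) : rderiv seg t (w - z).
  have := rderivD (rderiv_cst z t) (rderivM (rderiv_real (is_derive_id t 1)) (rderiv_cst (w - z) t)).
  by apply: rderiv_eq => //; rewrite mulr0 addr0 add0r mul1r.
have dD (t : R) : 0 <= t <= 1 ->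
    is_derive (seg t) 1 D (h' (seg t) - p.[seg t - z]).
  move=> t01; apply: cderivB; first by apply: hd; apply: le_lt_trans (seg_le _ t01) w1.
  rewrite -qp; have := cderiv_comp (cderivB (cderiv_id (seg t)) (cderiv_cst z (seg t)))
    (cderiv_horner q (seg t - z)).
  by apply: cderiv_eq; rewrite ?subr0 ?mulr1.
have -> : h w - q.[w - z] = D (seg 1) - D (seg 0).
  have -> : seg 1 = w by rewrite /seg mul1r addrC subrK.
  have -> : seg 0 = z by rewrite /seg mul0r addr0.
  by rewrite /D subrr q0 subrr subr0.
have -> : K * normc (w - z) ^+ N.+1 = (K * normc (w - z) ^+ N.+1) * 1 - (K * normc (w - z) ^+ N.+1) * 0.
  by rewrite mulr1 mulr0 subr0.
have dG (M x : R) : is_derive x 1 (fun s => M * s) M.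
  have := is_deriveZ M (is_derive_id x 1); rewrite /GRing.scale/= mulr1; exact.
apply: (mean_value_le (P := D \o seg)
  (h := fun t => (h' (seg t) - p.[seg t - z]) * (w - z))
  (G := fun s => (K * normc (w - z) ^+ N.+1) * s)
  (g := fun=> K * normc (w - z) ^+ N.+1)) => //.
- by move=> t t01; exact: rderiv_comp (dD t t01) (dseg t).
- move=> t t01; rewrite normcM exprSr mulrA ler_wpM2r ?normc_ge0//.
  have sr : normc (seg t - z) < r2 by apply: le_lt_trans (seg_le _ t01) w2.
  apply: le_trans (hp _ sr) _.
  have [K0|K0] := leP 0 K.
    by rewrite ler_wpM2l// lerXn2r ?nnegrE ?normc_ge0// seg_le.
  have K00 : K * normc (seg t - z) ^+ N <= 0.
    by rewrite nmulr_rle0// exprn_ge0// normc_ge0.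
  have nn := le_trans (normc_ge0 _) (hp _ w2).
  by rewrite (le_trans K00).
Qed.

(** Bootstrapping: when h' is built from h by products, an expansion of h to the
    order N yields one of h', and integrating it one of h to the order N + 1. *)
Lemma peano_ode h h' z :
  (\forall w \near z, is_derive (w : R[i]) 1 h (h' w)) ->
  (forall N, peano h z N -> peano h' z N) -> forall N, peano h z N.
Proof.
move=> hd hN; elim=> [|N ih]; last exact: peano_integral hd (hN _ ih).
apply: peano0; move/nearcP : hd => [r r0 /(_ z)].
by rewrite subrr normc0 => /(_ r0)[].
Qed.

Lemma near_horner_neq0 q z : q.[z] != 0 -> \forall w \near z, q.[w] != 0.
Proof.
move=> qz; have n0 : 0 < normc q.[z] by rewrite normc_gt0.
have [dq _] := cderiv_horner q z.
have [r r0 hr] := cderivable_continuous dq n0; apply/nearcP; exists r => // w /hr.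
by apply: contraTneq => ->; rewrite sub0r normcNE ltxx.
Qed.

Lemma cderiv_hornerV q z : q.[z] != 0 ->
  is_derive z 1 (fun w => q.[w]^-1) ((-1) * ((q^`()).[z] * (q.[z]^-1 * q.[z]^-1))).
Proof.
move=> qz; have := cderiv_comp (cderiv_horner q z) (cderivV qz); apply: cderiv_eq => //.
by rewrite expr2; field.
Qed.

Lemma peano_hornerV q z N : q.[z] != 0 -> peano (fun w => q.[w]^-1) z N.
Proof.
move=> qz; move: N; apply: peano_ode.
  by apply: filterS (near_horner_neq0 qz) => w qw; exact: cderiv_hornerV qw.
by move=> N h; apply: peanoZ; apply: peanoM; [exact: peano_poly|exact: peanoM].
Qed.

Lemma cderiv_cexp_i z : is_derive z 1 (fun w => cexp ('i * w)) ('i * cexp ('i * z)).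
Proof.
have := cderiv_comp (cderivZ 'i (cderiv_id z)) (is_derive_cexp ('i * z)).
by apply: cderiv_eq => //; rewrite mulr1 mulrC.
Qed.

Lemma peano_cexp_i z N : peano (fun w => cexp ('i * w)) z N.
Proof.
move: N; apply: peano_ode; first by apply: filterE => w; exact: cderiv_cexp_i.
by move=> N; exact: peanoZ.
Qed.

Lemma peanoX h z N n : peano h z N -> peano (fun w => h w ^+ n) z N.
Proof.
move=> ph; elim: n => [|n ih].
  by have := peano_poly 1 z N; rewrite (_ : (fun _ => _) = fun=> 1)//; apply/funext => w; rewrite hornerC.
have := peanoM ph ih; rewrite (_ : (fun w => h w * _) = fun w => h w ^+ n.+1)//.
by apply/funext => w; rewrite exprS.
Qed.

(** A quotient by a power of [w - z0] of a function with expansions of all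
    orders has a Laurent expansion; the regular part is again differentiable at
    z0 since it is polynomial up to a quadratic error. *)
Lemma ex_residue h z0 (n : nat) : (0 < n)%N ->
  (\forall w \near z0, derivable h w 1) -> (forall N, peano h z0 N) ->
  exists c, is_residue (fun w => h w / (w - z0) ^+ n) z0 c.
Proof.
move=> n0 hd /(_ n.+2)[p [K [r [r0 hp]]]].
pose P := take_poly n p; pose Q := drop_poly n p.
pose g w := if w == z0 then Q.[0] else (h w - P.[w - z0]) / (w - z0) ^+ n.
have PQ v : p.[v] = P.[v] + Q.[v] * v ^+ n.
  by rewrite -[in LHS](poly_take_drop n p) hornerD hornerM hornerXn.
(* The coefficient of 1 / v^(k+1) in p / v^n is that of v^(n-k-1) in p. *)
have Fg : \forall w \near z0^', h w / (w - z0) ^+ n =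
    \sum_(k < n) p`_(n - k.+1) / (w - z0) ^+ k.+1 + g w.
  apply/dnearcP; exists 1 => // w /andP[+ _]; rewrite normc_gt0 subr_eq0 => wz.
  rewrite /g (negbTE wz).
  have wz' : w - z0 != 0 by rewrite subr_eq0.
  have -> : \sum_(k < n) p`_(n - k.+1) / (w - z0) ^+ k.+1 = P.[w - z0] / (w - z0) ^+ n.
    rewrite /P /take_poly horner_poly mulr_suml (reindex_inj rev_ord_inj)/=.
    apply: eq_bigr => i _; rewrite subnSK// subKn ?(ltnW (ltn_ord i))//.
    have -> : (w - z0) ^+ n = (w - z0) ^+ (n - i) * (w - z0) ^+ i.
      by rewrite -exprD subnK// ltnW.
    by field; rewrite !expf_neq0.
  by rewrite -mulrDl [P.[_] + _]addrC subrK.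
have hol : holomorphic_near g z0.
  move: hd => /nearcP[r1 r10 hd].
  rewrite /holomorphic_near.
  apply/nearcP.
  exists r1; first exact: r10.
  move=> w wr.
  have [->|wz] := eqVneq w z0.
    (* The difference of g and the polynomial Q is quadratic at z0. *)
    have dQ := cderiv_comp (cderivB (cderiv_id z0) (cderiv_cst z0 z0))
      (cderiv_horner Q (z0 - z0)).
    suff dE : is_derive z0 1 (fun w => g w - Q.[w - z0]) 0.
      have [+ _] := cderivD dE dQ; rewrite (_ : (fun _ => _) = g)//.
      by apply/funext => v /=; rewrite subrK.
    apply/is_derivecP => e e0; exists (Num.min r (e / (`|K| + 1))).
      by rewrite lt_min r0 divr_gt0// ltr_wpDl.
    move=> v; rewrite lt_min => /andP[v1 v2].
    rewrite mul0r subr0 [g z0]/g eqxx subrr subrr subr0.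
    rewrite /g; case: eqVneq => [->|vz]; first by rewrite !subrr normc0 mulr0.
    have vz' : v - z0 != 0 by rewrite subr_eq0.
    have n0' : 0 < normc (v - z0) by rewrite normc_gt0.
    have -> : (h v - P.[v - z0]) / (v - z0) ^+ n - Q.[v - z0] =
        (h v - p.[v - z0]) / (v - z0) ^+ n.
      by rewrite PQ; field; rewrite expf_neq0.
    rewrite normcM normcV normcX ler_pdivrMr ?exprn_gt0//.
    apply: le_trans (hp v v1) _; rewrite !exprS !mulrA ler_wpM2r ?exprn_ge0 ?normc_ge0//.
    rewrite ler_wpM2r ?normc_ge0//.
    apply: (@le_trans _ _ ((`|K| + 1) * normc (v - z0))).
      by rewrite ler_wpM2r ?normc_ge0// (le_trans (ler_norm _))// lerDl.
    by rewrite mulrC -ler_pdivlMr ?ltW// ltr_wpDl.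
  have wz' : w - z0 != 0 by rewrite subr_eq0.
  have dw := cderivB (cderiv_id w) (cderiv_cst z0 w).
  have dh := derivableP (hd w wr).
  have dP := cderiv_comp dw (cderiv_horner P (w - z0)).
  have dV := cderiv_comp (cderivX n dw) (cderivV (expf_neq0 n wz')).
  have [] // := @cderiv_near _ g w _ _ (cderivM (cderivB dh dP) dV).
  apply/nearcP; exists (normc (w - z0)); first by rewrite normc_gt0.
  move=> v vw; rewrite /g; case: eqVneq => // vz.
  by move: vw; rewrite vz normcB ltxx.
exists p`_(n - 1), n, (fun k => p`_(n - k.+1)), g.
by split; [exact: n0|exact: hol|exact: Fg|].
Qed.

End Peano.

(** * Integration along a half annulus *)

Section Contour.
Context {R : realType}.
Implicit Types (z w : R[i]) (H Phi : R[i] -> R[i]).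

Lemma ex_rprimitive (P : R -> R[i]) :
  (forall x e : R, 0 < e -> exists2 r : R, 0 < r &
     forall y, `|y - x| < r -> normc (P y - P x) < e) ->
  exists Q, forall x, rderiv Q x (P x).
Proof.
move=> h.
have cRe : continuous (fun x : R => Re (P x)).
  move=> x; apply/cvgrPdist_lt => e /(h x)[r r0 k]; exists r => //= y.
  rewrite /ball_/= distrC => /k; apply: le_lt_trans.
  by rewrite distrC -reN -reD ler_Re_normc.
have cIm : continuous (fun x : R => Im (P x)).
  move=> x; apply/cvgrPdist_lt => e /(h x)[r r0 k]; exists r => //= y.
  rewrite /ball_/= distrC => /k; apply: le_lt_trans.
  by rewrite distrC -imN -imD ler_Im_normc.
have [A hA] := ex_primitive cRe; have [B hB] := ex_primitive cIm.
by exists (fun x => A x +i* B x) => x; split; [exact: hA|exact: hB].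
Qed.

Lemma ex_edge_primitives Phi (a b c d : R) : c <= d ->
  (forall x y, c <= y <= d -> derivable Phi (x +i* y) 1) ->
  exists X Y, edge_primitives Phi X Y a b c d.
Proof.
move=> cd dPhi.
have pX (y : R) : exists Q, forall x, c <= y <= d ->
    rderiv Q x (Phi (x +i* y)).
  have [cyd|ncyd] := boolP (c <= y <= d); last by exists (fun=> 0).
  have [|Q hQ] := @ex_rprimitive (fun x => Phi (x +i* y)).
    move=> x e e0; have [r r0 hr] := cderivable_continuous (dPhi x y cyd) e0.
    exists r => // x' x'r; apply: hr; apply: le_lt_trans (normc_le_ReIm _) _.
    by rewrite !reimE/= subrr normr0 addr0.
  by exists Q => x _; exact: hQ.
have [X hX] := choice pX.
(* Vertical lines meet the domain of Phi in a segment only; clamping the ordinate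
   makes the integrand continuous on the whole line. *)
pose cl (y : R) := Num.max c (Num.min d y).
have cl_itv y : c <= cl y <= d.
  by rewrite /cl le_max lexx/= ge_max cd/= ge_min lexx.
have cl_id y : c <= y <= d -> cl y = y.
  by move=> /andP[cy yd]; rewrite /cl min_r// max_r.
have cl_lip y y' : `|cl y - cl y'| <= `|y - y'|.
  clear; rewrite /cl; case: (leP d y) => ?; case: (leP d y') => ?;
    rewrite /Num.max; do ?case: ifPn; rewrite -?leNgt => *; rewrite ler_norml;
    have := ler_norm (y - y'); have := ler_norm (- (y - y')); rewrite normrN => *;
    apply/andP; split; lra.
have pY (x : R) : exists Q, forall y, rderiv Q y (Phi (x +i* cl y)).
  apply: (@ex_rprimitive (fun y => Phi (x +i* cl y))).
  move=> y e e0; have [r r0 hr] := cderivable_continuous (dPhi x _ (cl_itv y)) e0.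
  exists r => // y' y'r; apply: hr; apply: le_lt_trans (normc_le_ReIm _) _.
  by rewrite !reimE/= subrr normr0 add0r (le_lt_trans (cl_lip _ _)).
have [Y hY] := choice pY.
exists X, Y; split=> [y x cyd _|x y _ cyd]; first exact: hX.
by rewrite -{2}(cl_id y cyd); exact: hY.
Qed.

Lemma expR_half_ln (x : R) : 0 < x -> expR (ln x / 2) = Num.sqrt x.
Proof.
move=> x0; rewrite -[in RHS](lnK x0) -[in RHS](@divfK _ 2 _ (ln x)) ?pnatr_eq0//.
by rewrite expRM_natr sqrtr_sqr ger0_norm// expR_ge0.
Qed.

Lemma is_derive_scale (M x : R) : is_derive x 1 (fun s => M * s) M.
Proof. by have := is_deriveZ M (is_derive_id x 1); rewrite /GRing.scale/= mulr1; exact. Qed.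

(** Jordan's inequality, in the form of a bound for the increment of a primitive:
    [exp (- r sin y)] is at most [1 / r] plus [exp (- r sin y) * |cos y|], and the
    latter is up to sign an explicit derivative on each half of [0, pi]. *)
Lemma jordan_increment (P h : R -> R[i]) (r K : R) : 0 < r -> 0 <= K ->
  (forall y, 0 <= y <= pi -> rderiv P y (h y)) ->
  (forall y, 0 <= y <= pi -> normc (h y) <= K * (expR (- (r * sin y)) + r^-1)) ->
  normc (P pi - P 0) <= K * (2 * pi + 2) / r.
Proof.
move=> r0 K0 hP hle; have pi0 := @pi_gt0 R.
(* Split exp (- r sin y) by sin^2 + cos^2 = 1, and use x exp (- x) <= 1 for
   x = r sin y, sin y <= 1 and cos^2 <= |cos|. *)
have ptw y : 0 <= y <= pi -> expR (- (r * sin y)) <= r^-1 + expR (- (r * sin y)) * `|cos y|.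
  move=> /andP[y0 ypi]; set E := expR _; have E0 : 0 < E by exact: expR_gt0.
  have s0 : 0 <= sin y by apply: sin_ge0_pi; rewrite y0.
  have c2 := cos2Dsin2 y.
  have rE : r * sin y * E <= 1.
    have e1 := @expR_ge1Dx R (r * sin y).
    have -> : E = (expR (r * sin y))^-1 by rewrite /E expRN.
    by rewrite ler_pdivrMr ?expR_gt0// mul1r (le_trans _ e1)// lerDr.
  have cc : cos y ^+ 2 <= `|cos y|.
    by rewrite -real_normK ?num_real// expr2 ler_piMr// ler_norml cos_geN1 cos_le1.
  have s1 : sin y <= 1 by exact: sin_le1.
  have i0 : 0 < r^-1 by rewrite invr_gt0.
  have eE : E = r^-1 * (r * sin y * E) * sin y + E * cos y ^+ 2.
    transitivity (E * (cos y ^+ 2 + sin y ^+ 2)); first by rewrite c2 mulr1.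
    by field; rewrite lt0r_neq0.
  rewrite [leLHS]eE; apply: lerD; last by rewrite ler_pM2l.
  rewrite -mulrA ler_piMr// ?(ltW i0)//.
  by apply: mulr_ile1 => //; rewrite !mulr_ge0// ltW.
have dE (y : R) : is_derive y 1 (fun t => expR (- (r * sin t)))
    (expR (- (r * sin y)) * (- (r * cos y))).
  have ds := is_deriveN (is_deriveZ r (is_derive_sin y)).
  exact: (@is_derive1_comp R expR (fun t => - (r * sin t)) _ _ _ (is_derive_expR _) ds).
(* s = -1 on [0, pi / 2] and s = 1 on [pi / 2, pi], the sign opposite to cos. *)
pose G s (y : R) := K * ((2 / r) * y + s / r * expR (- (r * sin y))).
pose g s (y : R) := K * ((2 / r) + s / r * (expR (- (r * sin y)) * (- (r * cos y)))).
have dG s (y : R) : is_derive y 1 (G s) (g s y).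
  have := is_deriveZ K (is_deriveD (is_derive_scale (2 / r) y) (is_deriveZ (s / r) (dE y))).
  by rewrite /GRing.scale/=; exact.
have gE s y : g s y = K * (2 / r - s * (expR (- (r * sin y)) * cos y)).
  by rewrite /g; field; rewrite lt0r_neq0.
have le1 : normc (P (pi / 2) - P 0) <= G (-1) (pi / 2) - G (-1) 0.
  apply: (mean_value_le (h := h) (g := g (-1))) => //; first by rewrite divr_ge0 ?ltW.
  - by move=> y /andP[y0 y1]; apply: hP; apply/andP; split; lra.
  - move=> y /andP[y0 y1]; have yp : 0 <= y <= pi by apply/andP; split; lra.
    apply: le_trans (hle y yp) _; rewrite gE ler_wpM2l//.
    have := ptw y yp; rewrite ger0_norm; last by apply: cos_ge0_pihalf; apply/andP; split; lra.
    lra.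
have le2 : normc (P pi - P (pi / 2)) <= G 1 pi - G 1 (pi / 2).
  apply: (mean_value_le (h := h) (g := g 1)) => //; first lra.
  - by move=> y /andP[y0 y1]; apply: hP; apply/andP; split; lra.
  - move=> y /andP[y0 y1]; have yp : 0 <= y <= pi by apply/andP; split; lra.
    apply: le_trans (hle y yp) _; rewrite gE ler_wpM2l//.
    have := ptw y yp; rewrite ler0_norm; first lra.
    have -> : cos y = - cos (pi - y) by rewrite cosB cospi sinpi; ring.
    by rewrite oppr_le0; apply: cos_ge0_pihalf; apply/andP; split; lra.
have -> : P pi - P 0 = (P pi - P (pi / 2)) + (P (pi / 2) - P 0) by ring.
apply: le_trans (ler_normcD _ _) _; apply: le_trans (lerD le2 le1) _.
have E0 := expR_gt0 (- (r * sin (pi / 2 : R))).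
rewrite /G sinpi sin0 mulr0 oppr0 expR0.
set E := expR _ in E0 *.
rewrite -subr_ge0.
have -> : K * (2 * pi + 2) / r - (K * (2 / r * pi + 1 / r * 1) - K * (2 / r * (pi / 2) + 1 / r * E) +
   (K * (2 / r * (pi / 2) + -1 / r * E) - K * (2 / r * 0 + -1 / r * 1))) = K * 2 * E / r.
  by field; rewrite lt0r_neq0.
by apply: divr_ge0; [apply: mulr_ge0; [exact: mulr_ge0|exact: ltW]|exact: ltW].
Qed.

(** Cauchy's theorem for the boundary of a half annulus, which the exponential
    turns into a rectangle; there the cut of the logarithm and the corner at 0
    have disappeared. *)
Lemma half_annulus H (B : R -> R[i]) (K A : R) : 0 <= K ->
  (forall z, z != 0 -> 0 <= Im z -> derivable H z 1) ->
  (forall x : R, 0 < x -> rderiv B x (H x%:C + H (- x%:C))) ->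
  (forall w, 0 <= Im w <= pi -> A <= Re w ->
     normc (H (cexp w) * cexp w) <=
       K * expR (Re w / 2) * (expR (- Im (cexp w)) + expR (- Re w))) ->
  (forall w, 0 <= Im w <= pi -> Re w <= - A ->
     normc (H (cexp w) * cexp w) <= K * expR (Re w / 2)) ->
  forall a b, a <= b -> a <= - A -> A <= b ->
  normc (B (expR b) - B (expR a)) <=
    K * (2 * pi + 2) * expR (- b / 2) + K * pi * expR (a / 2).
Proof.
move=> K0 dH dB big small a b ab aA Ab; have pi0 := @pi_gt0 R.
pose Phi w := H (cexp w) * cexp w.
have dPhi x y : 0 <= y <= pi -> derivable Phi (x +i* y) 1.
  move=> /andP[y0 ypi]; set w := x +i* y.
  have im0 : 0 <= Im (cexp w).
    rewrite /cexp !reimE/= mul0r addr0 mulr_ge0 ?expR_ge0//.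
    by apply: sin_ge0_pi; rewrite y0.
  have dh := derivableP (dH _ (cexp_neq0 w) im0).
  by have [] := cderivM (cderiv_comp (is_derive_cexp w) dh) (is_derive_cexp w).
have [X [Y [hX hY]]] := ex_edge_primitives a b (ltW pi0) dPhi.
have := goursat ab (ltW pi0) (conj hX hY) (fun x y _ => dPhi x y).
rewrite /rectangle_integral.
have bottom (x : R) : Phi (x +i* 0) = (expR x)%:C * H (expR x)%:C.
  by rewrite /Phi complexr0 cexp_real mulrC.
have top (x : R) : Phi (x +i* pi) = - ((expR x)%:C * H (- (expR x)%:C)).
  have -> : x +i* pi = x%:C + 'i * (pi : R)%:C.
    by apply: complexP; rewrite !reimE/=; ring.
  by rewrite /Phi cexpD cexp_pi cexp_real mulrN1 mulrN mulrC.
have real_sides : (X 0 b - X 0 a) - (X pi b - X pi a) = B (expR b) - B (expR a).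
  apply/eqP; rewrite -subr_eq0 -normc_eq0 eq_le normc_ge0 andbT.
  pose D x := X 0 x - X pi x - B (expR x).
  have -> : X 0 b - X 0 a - (X pi b - X pi a) - (B (expR b) - B (expR a)) = D b - D a.
    by rewrite /D; ring.
  rewrite -[leRHS](subrr (0 : R)).
  apply: (@mean_value_le R D (fun=> 0) (fun=> 0) (fun=> 0)) => // [x axb|x _]; last first.
    by rewrite normc0.
  have d1 := hX 0 x; have d2 := hX pi x; rewrite !lexx (ltW pi0) in d1 d2.
  have d3 := rderiv_comp_real (is_derive_expR x) (dB _ (expR_gt0 x)).
  apply: rderiv_eq (rderivB (rderivB (d1 isT axb) (d2 isT axb)) d3) => //.
  by rewrite bottom top; ring.
move=> cauchy.
have -> : B (expR b) - B (expR a) = 'i * (Y a pi - Y a 0) - 'i * (Y b pi - Y b 0).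
  rewrite -real_sides; apply/eqP; rewrite -subr_eq0; apply/eqP; rewrite -[RHS]cauchy; ring.
apply: le_trans (ler_normcB _ _) _; rewrite !normcM !normc_i !mul1r addrC; apply: lerD.
- have eb : K * (2 * pi + 2) * expR (- b / 2) = K * expR (b / 2) * (2 * pi + 2) / expR b.
    have -> : - b / 2 = b / 2 - b by field.
    by rewrite expRB; field; rewrite lt0r_neq0 ?expR_gt0.
  rewrite eb; apply: (@jordan_increment _ (fun y => Phi (b +i* y))).
  + exact: expR_gt0.
  + by rewrite mulr_ge0 ?expR_ge0.
  + by move=> y ypi; apply: hY; rewrite // ab lexx.
  + move=> y ypi; apply: le_trans (big _ _ _) _ => //=.
    by rewrite mul0r addr0 (expRN b).
- have -> : K * pi * expR (a / 2) = K * expR (a / 2) * pi - K * expR (a / 2) * 0 by ring.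
  apply: (@mean_value_le R (Y a) (fun y => Phi (a +i* y)) _ (fun=> K * expR (a / 2))).
  + exact: ltW.
  + by move=> y ypi; apply: hY; rewrite // ab lexx.
  + by move=> y _; exact: is_derive_scale.
  + by move=> y ypi; exact: small.
Qed.

End Contour.

(** * Improper integrals through primitives *)

Section Improper.
Context {R : realType}.
Implicit Types (z w l : R[i]) (P h : R -> R[i]).

Definition rderivable h x := exists d, rderiv h x d.

Lemma rderivable_cvg h x (e : R) : rderivable h x -> 0 < e ->
  exists2 r : R, 0 < r & forall y, `|y - x| < r -> normc (h y - h x) < e.
Proof.
move=> [d /rderivP/(_ _ ltr01)[r r0 k]] e0.
have K0 : 0 < normc d + 1 by rewrite ltr_wpDl ?normc_ge0.
exists (Num.min r (e / (normc d + 1))); first by rewrite lt_min r0 divr_gt0.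
move=> y; rewrite lt_min => /andP[y1 y2].
have := ler_normcD (h y - h x - d * (y - x)%:C) (d * (y - x)%:C).
rewrite subrK normcM normc_real => /le_lt_trans; apply.
apply: (@le_lt_trans _ _ ((normc d + 1) * `|y - x|)).
  by rewrite mulrDl addrC lerD2l; exact: k.
by rewrite mulrC -ltr_pdivlMr.
Qed.

(** The logarithm carries the half-line to the whole line, where primitives exist. *)
Lemma ex_primitive_pos h : (forall x : R, 0 < x -> rderivable h x) ->
  exists P, forall x, 0 < x -> rderiv P x (h x).
Proof.
move=> dh; pose g (s : R) := (expR s)%:C * h (expR s).
have [|Q hQ] := @ex_rprimitive R g.
  move=> s e; apply: rderivable_cvg; have [d hd] := dh _ (expR_gt0 s).
  have d1 := rderiv_real (is_derive_expR s).
  by have := rderivM d1 (rderiv_comp_real (is_derive_expR s) hd); eexists; exact: H.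
exists (Q \o (@ln R)) => x x0.
have := rderiv_comp_real (is_derive1_ln x0) (hQ (ln x)); apply: rderiv_eq => //.
rewrite /g lnK ?posrE// mulrA -rmorphM mulVf ?lt0r_neq0// rmorph1 mul1r//.
Qed.

Lemma Rintegral_FTC (F f : R -> R) (a b : R) : a < b ->
  (forall x, a <= x <= b -> is_derive x 1 F (f x)) ->
  (forall x, a <= x <= b -> {for x, continuous f}) ->
  \int[lebesgue_measure]_(x in `[a, b]) f x = F b - F a.
Proof.
move=> ab dF cf; rewrite /Rintegral (@continuous_FTC2 R f F a b ab)//.
- apply: continuous_in_subspaceT => x; rewrite inE/= in_itv/= => xab.
  exact: cf.
- have cF x : a <= x <= b -> {for x, continuous F}.
    by move=> xab; apply: differentiable_continuous; apply/derivable1_diffP; have [] := dF x xab.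
  split.
  + by move=> x; rewrite in_itv/= => /andP[/ltW ax /ltW xb]; have [] := dF x; rewrite ?ax ?xb.
  + by apply: cvg_at_right_filter; apply: cF; rewrite lexx ltW.
  + by apply: cvg_at_left_filter; apply: cF; rewrite lexx ltW.
- move=> x; rewrite in_itv/= => /andP[/ltW ax /ltW xb].
  by rewrite derive1E; have [] := dF x; rewrite ?ax ?xb.
Qed.

Lemma cintegral_primitive P h (a b : R) : a < b ->
  (forall x, a <= x <= b -> rderiv P x (h x)) ->
  (forall x, a <= x <= b -> rderivable h x) ->
  cintegral h a b = P b - P a.
Proof.
move=> ab dP dh; apply: complexP; rewrite !reimE /cintegral/=.
- apply: (@Rintegral_FTC (Re \o P)) => // x xab; first by have [] := dP x xab.
  by have [d /rderiv_continuous[]] := dh x xab.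
- apply: (@Rintegral_FTC (Im \o P)) => // x xab; first by have [] := dP x xab.
  by have [d /rderiv_continuous[]] := dh x xab.
Qed.

Definition contour_filter : set_system (R * R) := filter_prod (0 : R)^'+ +oo.

Let F := contour_filter.

Lemma near_contour (A : set (R * R)) (r T : R) : 0 < r ->
  (forall a b, 0 < a -> a < r -> T < b -> a < b -> A (a, b)) -> \forall ab \near F, A ab.
Proof.
move=> r0 h; have r10 : 0 < Num.min r 1 by rewrite lt_min r0 ltr01.
exists ([set a | 0 < a < Num.min r 1], [set b | Num.max T 1 < b]) => /=.
  split.
  - near=> a; apply/andP; split; near: a; [exact: nbhs_right_gt|exact: nbhs_right_lt].
  - by near=> b; near: b; apply: nbhs_pinfty_gt; exact: num_real.
move=> [a b] /= [/andP[a0]]; rewrite lt_min gt_max => /andP[ar a1] /andP[Tb b1].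
by apply: h => //; exact: lt_trans b1.
Unshelve. all: by end_near. Qed.

Lemma cvg_improper_integral P h l :
  (forall x, 0 < x -> rderiv P x (h x)) -> (forall x, 0 < x -> rderivable h x) ->
  (P ab.2 - P ab.1) @[ab --> F] --> l -> improper_integral_filter h --> l.
Proof.
move=> dP dh Pl; rewrite /improper_integral_filter; apply: cvg_trans Pl.
apply: near_eq_cvg; apply: (@near_contour _ 1 1 ltr01) => a b a0 a1 b1 ab /=.
by rewrite (cintegral_primitive (P := P))// => x /andP[ax _]; [apply: dP|apply: dh];
  exact: lt_le_trans ax.
Qed.

Lemma cvgc_cauchy (G : set_system R) {GG : ProperFilter G} P :
  (forall e : R, 0 < e -> exists c, \forall y \near G, normc (P y - c) < e) ->
  exists l, P @ G --> l.
Proof.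
move=> h.
have hRe : cvg (Re (P y) @[y --> G]).
  apply/cauchy_cvgP; apply: cauchy_exP => e e0; have [c hc] := h e e0; exists (Re c).
  apply: filterS hc => y; apply: le_lt_trans.
  by rewrite /= distrC -reN -reD ler_Re_normc.
have hIm : cvg (Im (P y) @[y --> G]).
  apply/cauchy_cvgP; apply: cauchy_exP => e e0; have [c hc] := h e e0; exists (Im c).
  apply: filterS hc => y; apply: le_lt_trans.
  by rewrite /= distrC -imN -imD ler_Im_normc.
exists (lim (Re (P y) @[y --> G]) +i* lim (Im (P y) @[y --> G])).
by apply/cvgc_ReIm.
Qed.

(** The bound integrates to a multiple of sqrt x, which is small near 0. *)
Lemma primitive_cvg0 P h (K r : R) : 0 <= K -> 0 < r ->
  (forall x, 0 < x -> rderiv P x (h x)) ->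
  (forall x, 0 < x <= r -> normc (h x) <= K / Num.sqrt x) ->
  exists l, P x @[x --> (0 : R)^'+] --> l.
Proof.
move=> K0 r0 dP hK.
have inc a b : 0 < a -> a <= b -> b <= r -> normc (P b - P a) <= 2 * K * Num.sqrt b.
  move=> a0 ab b1; apply: (@le_trans _ _ (2 * K * Num.sqrt b - 2 * K * Num.sqrt a)).
    pose G x := 2 * K * Num.sqrt x.
    have dG (x : R) : a <= x <= b -> is_derive x 1 G (K / Num.sqrt x).
      move=> /andP[ax _]; have x0 : 0 < x by exact: lt_le_trans ax.
      have := is_deriveZ (2 * K) (is_derive1_sqrt x0); rewrite /GRing.scale/=.
      have -> // : 2 * K * (2 * Num.sqrt x)^-1 = K / Num.sqrt x.
      by field; rewrite lt0r_neq0// sqrtr_gt0.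
    have dPab x : a <= x <= b -> rderiv P x (h x).
      by move=> /andP[ax _]; apply: dP; exact: lt_le_trans ax.
    apply: (mean_value_le ab dPab dG) => x /andP[ax xb].
    by apply: hK; rewrite (lt_le_trans a0)// (le_trans xb).
  by rewrite lerBlDr lerDl !mulr_ge0 ?sqrtr_ge0.
apply: cvgc_cauchy => e e0.
have K10 : 0 < 2 * K + 1 by rewrite ltr_wpDl ?mulr_ge0.
pose b := Num.min r ((e / (2 * K + 1) / 2) ^+ 2).
have b0 : 0 < b by rewrite lt_min r0 exprn_gt0 ?divr_gt0.
exists (P b); near=> a.
have a0 : 0 < a by near: a; exact: nbhs_right_gt.
have ab : a <= b by near: a; exact: nbhs_right_le.
rewrite normcB; apply: le_lt_trans (inc a b a0 ab _) _; first by rewrite /b ge_min lexx.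
have sb : Num.sqrt b <= e / (2 * K + 1) / 2.
  rewrite -[leRHS]ger0_norm ?divr_ge0 ?(ltW e0) ?(ltW K10)// -sqrtr_sqr ler_wsqrtr//.
  by rewrite /b ge_min lexx orbT.
apply: (@le_lt_trans _ _ ((2 * K + 1) * (e / (2 * K + 1) / 2))).
  by apply: ler_pM; rewrite ?mulr_ge0 ?sqrtr_ge0// lerDl.
have -> : (2 * K + 1) * (e / (2 * K + 1) / 2) = e / 2 by field; rewrite lt0r_neq0.
by rewrite gtr_pMr// invf_lt1// ltr1n.
Unshelve. all: by end_near. Qed.

Lemma is_derive_sqrtV (x : R) : 0 < x ->
  is_derive x 1 (fun y => (Num.sqrt y)^-1) (- (2 * (x * Num.sqrt x))^-1).
Proof.
move=> x0; have s0 : 0 < Num.sqrt x by rewrite sqrtr_gt0.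
have := is_deriveV (lt0r_neq0 s0) (is_derive1_sqrt x0); rewrite /GRing.scale/=.
have -> // : - (Num.sqrt x ^- 2) * (2 * Num.sqrt x)^-1 = - (2 * (x * Num.sqrt x))^-1.
by rewrite sqr_sqrtr ?ltW//; field; rewrite !lt0r_neq0.
Qed.

(** Integration by parts: for a bounded oscillating factor [c = C'] it is enough
    that [g] tends to 0 and that [g'] is absolutely integrable at infinity. *)
Lemma primitive_cvgy P (C c : R -> R) (g g' : R -> R[i]) (K x0 : R) : 0 <= K -> 0 < x0 ->
  (forall x : R, is_derive x 1 C (c x)) -> (forall x, `|C x| <= 1) ->
  (forall x, 0 < x -> rderiv g x (g' x)) ->
  (forall x, x0 <= x -> normc (g x) <= K / Num.sqrt x) ->
  (forall x, x0 <= x -> normc (g' x) <= K / (x * Num.sqrt x)) ->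
  (forall x, 0 < x -> rderiv P x (g x * (c x)%:C)) ->
  exists l, P x @[x --> +oo] --> l.
Proof.
move=> K0 x00 dC C1 dg hg hg' dP.
have pos x : x0 <= x -> 0 < x by exact: lt_le_trans.
pose Q x := P x - g x * (C x)%:C.
have inc a b : x0 <= a -> a <= b -> normc (Q b - Q a) <= 2 * K / Num.sqrt a.
  move=> xa ab.
  apply: (@le_trans _ _ ((- (2 * K)) * (Num.sqrt b)^-1 - (- (2 * K)) * (Num.sqrt a)^-1)).
    pose G x := (- (2 * K)) * (Num.sqrt x)^-1.
    have dG (x : R) : a <= x <= b -> is_derive x 1 G (K / (x * Num.sqrt x)).
      move=> /andP[ax _]; have xp := pos _ (le_trans xa ax).
      have := is_deriveZ (- (2 * K)) (is_derive_sqrtV xp); rewrite /GRing.scale/=.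
      have -> // : - (2 * K) * - (2 * (x * Num.sqrt x))^-1 = K / (x * Num.sqrt x).
      by field; rewrite !lt0r_neq0 ?sqrtr_gt0.
    have dQ x : a <= x <= b -> rderiv Q x (- (g' x * (C x)%:C)).
      move=> /andP[ax _]; have xp := pos _ (le_trans xa ax).
      have := rderivB (dP x xp) (rderivM (dg x xp) (rderiv_real (dC x))).
      by apply: rderiv_eq => //; ring.
    apply: (mean_value_le ab dQ dG) => x /andP[ax _].
    rewrite normcNE normcM normc_real.
    apply: le_trans (hg' _ (le_trans xa ax)); rewrite ler_piMr ?normc_ge0//.
  have : 0 <= 2 * K / Num.sqrt b by rewrite !mulr_ge0 ?invr_ge0 ?sqrtr_ge0.
  lra.
apply: cvgc_cauchy => e e0.
have K10 : 0 < 4 * K + 1 by rewrite ltr_wpDl ?mulr_ge0.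
pose a := Num.max x0 (((4 * K + 1) / e) ^+ 2).
have xa : x0 <= a by rewrite le_max lexx.
have a0 : 0 < a := pos _ xa.
have sa : (4 * K + 1) / e <= Num.sqrt a.
  rewrite -[leLHS]ger0_norm ?divr_ge0 ?(ltW e0) ?(ltW K10)// -sqrtr_sqr ler_wsqrtr//.
  by rewrite /a le_max lexx orbT.
exists (Q a); near=> b.
have ab : a <= b by near: b; apply: nbhs_pinfty_ge; exact: num_real.
have -> : P b - Q a = (Q b - Q a) + g b * (C b)%:C by rewrite /Q; ring.
apply: le_lt_trans (ler_normcD _ _) _.
have k1 := inc a b xa ab.
have k2 : normc (g b * (C b)%:C) <= K / Num.sqrt a.
  rewrite normcM normc_real; apply: (@le_trans _ _ (normc (g b))).
    by rewrite ler_piMr ?normc_ge0.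
  apply: le_trans (hg _ (le_trans xa ab)) _; rewrite ler_wpM2l//.
  by rewrite lef_pV2 ?posrE ?sqrtr_gt0 ?ler_wsqrtr// (lt_le_trans a0).
have s0 : 0 < Num.sqrt a by rewrite sqrtr_gt0.
have k3 : (4 * K + 1) / Num.sqrt a <= e.
  by rewrite ler_pdivrMr// -ler_pdivrMl// mulrC.
have i0 : 0 < (Num.sqrt a)^-1 by rewrite invr_gt0.
have k4 : 0 <= K / Num.sqrt a by rewrite mulr_ge0// ltW.
have : (4 * K + 1) / Num.sqrt a = 4 * (K / Num.sqrt a) + (Num.sqrt a)^-1 by ring.
have : 2 * K / Num.sqrt a = 2 * (K / Num.sqrt a) by ring.
lra.
Unshelve. all: by end_near. Qed.

Lemma cvg_contour P l0 l1 : P x @[x --> (0 : R)^'+] --> l0 -> P x @[x --> +oo] --> l1 ->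
  (P ab.2 - P ab.1) @[ab --> F] --> l1 - l0.
Proof.
move=> /cvgcP h0 /cvgcP h1; apply/cvgcP => e e0.
have e20 : 0 < e / 2 by rewrite divr_gt0.
exists ([set a | normc (P a - l0) < e / 2], [set b | normc (P b - l1) < e / 2]) => /=.
  by split; [exact: h0|exact: h1].
move=> [a b] /= [ha hb].
have -> : P b - P a - (l1 - l0) = (P b - l1) - (P a - l0) by ring.
by apply: le_lt_trans (ler_normcB _ _) _; lra.
Qed.

(** Convergence of an improper integral, stated through a primitive: in this form it is
    linear in the integrand without integrability side conditions. *)
Definition improper h l := (forall x : R, 0 < x -> rderivable h x) /\
  exists P, (forall x, 0 < x -> rderiv P x (h x)) /\
            (P ab.2 - P ab.1) @[ab --> F] --> l.

Lemma improper_cvg h l : improper h l -> improper_integral_filter h --> l.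
Proof. by move=> [dh [P [dP hP]]]; exact: cvg_improper_integral dP dh hP. Qed.

Lemma improper_lim h l : improper h l -> improper_integral h = l.
Proof.
move=> /improper_cvg; rewrite /improper_integral /improper_integral_filter => hl.
exact: cvg_lim.
Qed.

Lemma improper_unique h h' l l' : (forall x, 0 < x -> h x = h' x) ->
  improper h l -> improper h' l' -> l = l'.
Proof.
move=> hh' hl [_ [P [dP hP]]]; have [dh _] := hl.
have dPh x : 0 < x -> rderiv P x (h x) by move=> x0; rewrite hh'//; exact: dP.
rewrite -(improper_lim hl); have := cvg_improper_integral dPh dh hP.
rewrite /improper_integral /improper_integral_filter => hl'.
exact: cvg_lim.
Qed.

Lemma improperD h h' l l' : improper h l -> improper h' l' ->
  improper (fun x => h x + h' x) (l + l').
Proof.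
move=> [dh [P [dP hP]]] [dh' [P' [dP' hP']]]; split.
  by move=> x x0; have [d k] := dh x x0; have [d' k'] := dh' x x0; exists (d + d'); exact: rderivD.
exists (fun x => P x + P' x); split; first by move=> x x0; exact: rderivD (dP x x0) (dP' x x0).
have -> : (fun ab : R * R => P ab.2 + P' ab.2 - (P ab.1 + P' ab.1)) =
    (fun ab => (P ab.2 - P ab.1) + (P' ab.2 - P' ab.1)) by apply/funext => ab; ring.
exact: cvgcD hP hP'.
Qed.

Lemma improperZ (c : R[i]) h l : improper h l -> improper (fun x => c * h x) (c * l).
Proof.
move=> [dh [P [dP hP]]]; split.
  by move=> x x0; have [d k] := dh x x0; exists (c * d); exact: rderivZ.
exists (fun x => c * P x); split; first by move=> x x0; exact: rderivZ (dP x x0).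
move: hP => /cvgcP hP; apply/cvgcP => e e0.
have c0 : 0 < normc c + 1 by rewrite ltr_wpDl ?normc_ge0.
have e20 : 0 < e / (normc c + 1) by rewrite divr_gt0.
apply: filterS (hP _ e20) => ab k.
have -> : c * P ab.2 - c * P ab.1 - c * l = c * (P ab.2 - P ab.1 - l) by ring.
rewrite normcM; move: k; rewrite ltr_pdivlMr// mulrC; apply: le_lt_trans.
by rewrite ler_wpM2r ?normc_ge0// lerDl.
Qed.

Lemma improper_sum (n : nat) (h : nat -> R -> R[i]) (l : nat -> R[i]) :
  (forall k, improper (h k) (l k)) ->
  improper (fun x => \sum_(k < n) h k x) (\sum_(k < n) l k).
Proof.
move=> hl; elim: n => [|n ih].
  rewrite big_ord0; have := improperZ 0 (hl 0%N); rewrite mul0r.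
  by congr improper; apply/funext => x; rewrite big_ord0 mul0r.
rewrite big_ord_recr/=; have := improperD ih (hl n).
by congr improper; apply/funext => x; rewrite big_ord_recr.
Qed.

End Improper.

(** * Decay of rational functions *)

Section RationalDecay.
Context {R : realType}.
Implicit Types (z w : R[i]) (p q : {poly R[i]}).

(** Half an exponential dominates every power: on a circle of radius [expR t] the m-th
    power of the logarithm costs at most the square root of the radius. *)
Lemma pow_log_le (k : nat) : exists2 C : R, 0 < C &
  forall t, 0 <= t -> (t + pi) ^+ k <= C * expR (t / 2).
Proof.
have pi0 := @pi_gt0 R.
case: k => [|k].
  by exists 1; rewrite ?ltr01// => t t0; rewrite expr0 mul1r -expR0 ler_expR divr_ge0.
set n := k.+1; have n0 : 0 < n%:R :> R by rewrite ltr0n.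
have c0 : 0 < 2 * n%:R + pi :> R by rewrite addr_gt0// mulr_gt0.
exists ((2 * n%:R + pi) ^+ n); first by rewrite exprn_gt0.
move=> t t0; pose s := t / (2 * n%:R).
have s0 : 0 <= s by rewrite divr_ge0// mulr_ge0// ltW.
have -> : t / 2 = n%:R * s by rewrite /s; field; rewrite lt0r_neq0.
have a1 : 0 <= t + pi by rewrite addr_ge0// ltW.
have a2 : 0 <= (2 * n%:R + pi) * expR s.
  by apply: mulr_ge0; [exact: ltW|exact: expR_ge0].
rewrite expRM_natl -exprMn lerXn2r ?nnegrE//.
have e1 := @expR_ge1Dx R s.
have -> : t = (2 * n%:R) * s by rewrite /s; field; rewrite lt0r_neq0.
rewrite [leRHS](mulrDl (2 * n%:R) pi); apply: lerD.
  by rewrite ler_pM2l ?mulr_gt0// (le_trans _ e1)// lerDr.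
by rewrite ler_peMr ?(ltW pi0)// (le_trans _ e1)// lerDl.
Qed.

Lemma ln_pow_le (k : nat) : exists2 C : R, 0 < C &
  forall x, 0 < x -> `|ln x| ^+ k <= C * expR (`|ln x| / 2).
Proof.
have [C C0 hC] := pow_log_le k; exists C => // x x0.
apply: le_trans (hC _ (normr_ge0 (ln x))).
have p0 := @pi_ge0 R.
have a1 : 0 <= `|ln x| + pi by apply: addr_ge0.
by rewrite lerXn2r ?nnegrE// lerDl.
Qed.

(** The radius is such that the leading term is at least twice the sum of the others. *)
Lemma normc_horner_ge q : q != 0 -> exists c r : R, [/\ 0 < c, 1 <= r &
  forall z, r <= normc z -> c * normc z ^+ (size q).-1 <= normc q.[z]].
Proof.
move=> q0; set n := (size q).-1.
have sq : size q = n.+1 by rewrite /n prednK// size_poly_gt0.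
pose t := take_poly n q; pose A := \sum_(i < size t) normc t`_i.
have l0 : 0 < normc (lead_coef q) by rewrite normc_gt0 lead_coef_eq0.
have A0 : 0 <= A by rewrite sumr_ge0// => i _; rewrite normc_ge0.
exists (normc (lead_coef q) / 2), (1 + 2 * A / normc (lead_coef q)); split.
- by rewrite divr_gt0.
- by rewrite lerDl divr_ge0 ?mulr_ge0 ?(ltW l0).
move=> z zr; have z1 : 1 <= normc z.
  by apply: le_trans zr; rewrite lerDl divr_ge0 ?mulr_ge0 ?(ltW l0).
have z0 : 0 < normc z by exact: lt_le_trans z1.
have qE : q.[z] = lead_coef q * z ^+ n + t.[z].
  by rewrite /t /take_poly horner_poly horner_coef sq big_ord_recr/= addrC lead_coefE sq.
have tle : normc t.[z] <= normc (lead_coef q) / 2 * normc z ^+ n.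
  have h := normc_horner_le t z1; rewrite -/A in h; apply: le_trans h _.
  have [A00|A00] := eqVneq A 0.
    by rewrite A00 mul0r mulr_ge0 ?exprn_ge0 ?divr_ge0 ?(ltW l0) ?(ltW z0).
  have [n0|n0] := posnP n.
    by move: A00; rewrite /A /t n0 take_poly0l size_poly0 big_ord0 eqxx.
  rewrite -(prednK n0) exprS mulrA; apply: ler_pM; rewrite ?A0 ?exprn_ge0 ?(ltW z0)//.
    rewrite -ler_pdivrMl ?divr_gt0// invf_div mulrAC (le_trans _ zr)//.
    by rewrite [2 * A]mulrC mulrAC lerDr.
  by rewrite ler_weXn2l// -!subn1 leq_sub2r// size_take_poly.
rewrite qE; have := lerB_normc (lead_coef q * z ^+ n) (- t.[z]).
rewrite opprK normcNE normcM normcX.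
have -> : normc (lead_coef q) * normc z ^+ n =
    normc (lead_coef q) / 2 * normc z ^+ n + normc (lead_coef q) / 2 * normc z ^+ n by field.
lra.
Qed.

Lemma ratfun_decay p q (d : nat) : q != 0 -> p = 0 \/ (size p + d <= size q)%N ->
  exists C r : R, [/\ 0 < C, 1 <= r &
    forall z, r <= normc z -> normc (p.[z] / q.[z]) <= C / normc z ^+ d].
Proof.
move=> q0 hp; have [c [r [c0 r1 hr]]] := normc_horner_ge q0.
pose A := \sum_(i < size p) normc p`_i.
have A0 : 0 <= A by rewrite sumr_ge0// => i _; rewrite normc_ge0.
exists ((A + 1) / c), r; split => //; first by rewrite divr_gt0// ltr_wpDl.
move=> z zr; have z1 := le_trans r1 zr; have z0 : 0 < normc z by exact: lt_le_trans z1.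
have [->|p0] := eqVneq p 0.
  by rewrite horner0 mul0r normc0 divr_ge0 ?exprn_ge0 ?divr_ge0 ?addr_ge0 ?(ltW z0) ?(ltW c0).
case: hp => [/eqP|hp]; first by rewrite (negbTE p0).
have sp : (0 < size p)%N by rewrite size_poly_gt0.
rewrite normcM normcV.
have qz : 0 < normc q.[z].
  by apply: lt_le_trans (hr z zr); rewrite mulr_gt0// exprn_gt0.
rewrite ler_pdivrMr// mulrAC ler_pdivlMr ?exprn_gt0//.
rewrite -[leRHS]mulrA [c^-1 * _]mulrC mulrA ler_pdivlMr//.
apply: (@le_trans _ _ ((A * normc z ^+ (size p).-1) * normc z ^+ d * c)).
  rewrite ler_pM2r// ler_pM2r ?exprn_gt0//; exact: normc_horner_le.
have -> : A * normc z ^+ (size p).-1 * normc z ^+ d * c = A * (normc z ^+ ((size p).-1 + d) * c).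
  by rewrite exprD; ring.
apply: (@le_trans _ _ ((A + 1) * (normc z ^+ (size q).-1 * c))).
  apply: ler_pM; rewrite ?mulr_ge0 ?exprn_ge0 ?(ltW z0) ?(ltW c0)//; first by rewrite lerDl.
  rewrite ler_pM2r// ler_weXn2l// -ltnS prednK ?size_poly_gt0//.
  by rewrite -addSn prednK.
by rewrite ler_pM2l ?ltr_wpDl// mulrC hr.
Qed.

Section OnTheLine.
Variables (p q : {poly R[i]}).
Hypotheses (q_neq0 : forall x : R, q.[x%:C] != 0) (deg_lt : (size p < size q)%N).

Let q0 : q != 0. Proof. by rewrite -size_poly_gt0 (leq_trans _ deg_lt). Qed.

Definition dratfun z : R[i] :=
  (p^`()).[z] / q.[z] - (p.[z] / q.[z]) * ((q^`()).[z] / q.[z]).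

Lemma cderiv_ratfun z : q.[z] != 0 -> is_derive z 1 (ratfun p q) (dratfun z).
Proof.
move=> qz; have := cderivM (cderiv_horner p z) (cderiv_hornerV qz).
by apply: cderiv_eq => //; rewrite /dratfun; field.
Qed.

Lemma rderiv_ratfun (x : R) : rderiv (fun x => ratfun p q x%:C) x (dratfun x%:C).
Proof.
have := rderiv_comp (cderiv_ratfun (q_neq0 x)) (rderiv_real (is_derive_id x 1)).
by apply: rderiv_eq; rewrite ?mulr1.
Qed.

Lemma ratfun_cvg0 : exists C r : R, [/\ 0 < C, 0 < r &
  forall z, normc z < r -> normc (ratfun p q z) <= C].
Proof.
have [df _] := cderiv_ratfun (q_neq0 0).
have [r r0 hr] := cderivable_continuous df ltr01.
exists (normc (ratfun p q 0) + 1), r; split => //; first by rewrite ltr_wpDl ?normc_ge0.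
move=> z zr; have := hr z; rewrite subr0 => /(_ zr) h.
have := ler_normcD (ratfun p q z - ratfun p q 0) (ratfun p q 0); rewrite subrK; lra.
Qed.

Lemma ratfun_cvgy : exists C r : R, [/\ 0 < C, 1 <= r &
  forall z, r <= normc z -> normc (ratfun p q z) <= C / normc z].
Proof.
have [|C [r [C0 r1 h]]] := @ratfun_decay p q 1 q0; first by right; rewrite addn1.
by exists C, r; split.
Qed.

Lemma dratfun_cvgy : exists C r : R, [/\ 0 < C, 1 <= r &
  forall z, r <= normc z -> normc (dratfun z) <= C / normc z ^+ 2].
Proof.
have [C1 [r1 [C10 r11 h1]]] := ratfun_cvgy.
have [|C2 [r2 [C20 r21 h2]]] := @ratfun_decay p^`() q 2 q0.
  have [->|p0] := eqVneq p 0; [by left; rewrite deriv0|right].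
  by rewrite addn2; apply: leq_trans deg_lt; rewrite ltnS; exact: lt_size_deriv.
have [|C3 [r3 [C30 r31 h3]]] := @ratfun_decay q^`() q 1 q0.
  by right; rewrite addn1; exact: lt_size_deriv.
exists (C2 + C1 * C3), (Num.max r1 (Num.max r2 r3)); split.
- by rewrite addr_gt0// mulr_gt0.
- by rewrite le_max r11.
move=> z; rewrite !ge_max => /and3P[z1 z2 z3].
apply: le_trans (ler_normcB _ _) _; rewrite mulrDl; apply: lerD; first exact: h2.
rewrite normcM expr2 invfM mulrACA; apply: ler_pM; rewrite ?normc_ge0//.
  exact: h1.
by have := h3 z z3; rewrite expr1.
Qed.

(** At infinity, f ln^k tends to 0 and its derivative is of size ln^k x / x^2, so
    integration by parts against [c = C'] applies; at 0 the power of the logarithm is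
    absolutely integrable. *)
Lemma oscillating_integral (C c : R -> R) (k : nat) :
  (forall x : R, is_derive x 1 C (c x)) -> (forall x : R, rderivable (fun x => (c x)%:C) x) ->
  (forall x, `|C x| <= 1) -> (forall x, `|c x| <= 1) ->
  exists l, improper (fun x => ratfun p q x%:C * (c x)%:C * (ln x ^+ k)%:C) l.
Proof.
move=> dC dc C1 c1.
set h : R -> R[i] := (fun x => _ * _ * _).
pose g x := ratfun p q x%:C * ((ln x)%:C ^+ k).
pose g' x := dratfun x%:C * ((ln x)%:C ^+ k) +
  ratfun p q x%:C * (k%:R * (ln x)%:C ^+ k.-1 * x^-1%:C).
have dg x : 0 < x -> rderiv g x (g' x).
  move=> x0; apply: rderivM; first exact: rderiv_ratfun.
  have := rderiv_comp (cderivX k (cderiv_id _)) (rderiv_real (is_derive1_ln x0)).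
  by apply: rderiv_eq; rewrite ?mulr1.
have hE x : h x = g x * (c x)%:C by rewrite /h /g rmorphXn; ring.
have dh x : 0 < x -> rderivable h x.
  move=> x0; have [d hd] := dc x; exists (g' x * (c x)%:C + g x * d).
  have -> : h = fun x => g x * (c x)%:C by apply/funext.
  exact: rderivM (dg x x0) hd.
have [P hP] := ex_primitive_pos dh.
have [Ck Ck0 hCk] := ln_pow_le k.
have normln (x : R) n : normc ((ln x)%:C ^+ n) = `|ln x| ^+ n.
  by rewrite normcX normc_real.
have lnp (x : R) : 1 <= x -> expR (`|ln x| / 2) = Num.sqrt x.
  by move=> x1; rewrite ger0_norm ?ln_ge0// expR_half_ln// (lt_le_trans ltr01).
have lnm (x : R) : 0 < x <= 1 -> expR (`|ln x| / 2) = (Num.sqrt x)^-1.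
  move=> /andP[x0 x1]; rewrite ler0_norm ?ln_le0//.
  by rewrite mulNr expRN expR_half_ln.
have [l0 hl0] : exists l : R[i], P x @[x --> (0 : R)^'+] --> l.
  have [A [r [A0 r0 hr]]] := ratfun_cvg0.
  apply: (@primitive_cvg0 R P h (A * Ck) (Num.min 1 (r / 2))) => //.
  - by rewrite mulr_ge0// ltW.
  - by rewrite lt_min ltr01 divr_gt0.
  move=> x /andP[x0]; rewrite le_min => /andP[x1 xr].
  rewrite hE normcM normc_real; apply: (@le_trans _ _ (normc (g x))).
    by rewrite ler_piMr ?normc_ge0.
  rewrite /g normcM normln -mulrA; apply: ler_pM; rewrite ?normc_ge0 ?exprn_ge0//.
    by apply: hr; rewrite normc_real gtr0_norm//; lra.
  by apply: le_trans (hCk x x0) _; rewrite lnm ?x0.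
have [l1 hl1] : exists l : R[i], P x @[x --> +oo] --> l.
  have [A [r [A0 r1 hr]]] := ratfun_cvgy.
  have [A' [r' [A'0 r'1 hr']]] := dratfun_cvgy.
  have [Ck' Ck'0 hCk'] := ln_pow_le k.-1.
  pose K := A * Ck + A' * Ck + A * k%:R * Ck'.
  have t1 : 0 < A * Ck by rewrite mulr_gt0.
  have t2 : 0 < A' * Ck by rewrite mulr_gt0.
  have t3 : 0 <= A * k%:R * Ck' by rewrite !mulr_ge0 ?ler0n// ltW.
  have K0 : 0 <= K by rewrite /K; lra.
  have x1 x : Num.max r r' <= x -> 1 <= x.
    by rewrite ge_max => /andP[rx _]; exact: le_trans rx.
  have ssq (x : R) : 1 <= x -> x = Num.sqrt x * Num.sqrt x.
    by move=> ?; rewrite -expr2 sqr_sqrtr// (le_trans ler01).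
  have spos (x : R) : 1 <= x -> 0 < Num.sqrt x.
    by move=> ?; rewrite sqrtr_gt0 (lt_le_trans ltr01).
  apply: (@primitive_cvgy R P C c g g' K (Num.max r r')) => //.
  - by rewrite lt_max (lt_le_trans ltr01).
  - move=> x xr; have x1' := x1 x xr; have x0 : 0 < x := lt_le_trans ltr01 x1'.
    have nx : normc (x%:C : R[i]) = x by rewrite normc_real gtr0_norm.
    rewrite /g normcM normln; apply: (@le_trans _ _ ((A / x) * (Ck * Num.sqrt x))).
      apply: ler_pM; rewrite ?normc_ge0 ?exprn_ge0//.
        by rewrite -[in leRHS]nx; apply: hr; rewrite nx; move: xr; rewrite ge_max => /andP[].
      by apply: le_trans (hCk x x0) _; rewrite lnp.
    have s0 := spos x x1'.
    have -> : A / x * (Ck * Num.sqrt x) = A * Ck / Num.sqrt x.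
      by rewrite [in _ / x](ssq x x1'); field; rewrite lt0r_neq0.
    by rewrite ler_pM2r ?invr_gt0// /K; lra.
  - move=> x xr; have x1' := x1 x xr; have x0 : 0 < x := lt_le_trans ltr01 x1'.
    have nx : normc (x%:C : R[i]) = x by rewrite normc_real gtr0_norm.
    have s0 := spos x x1'; move: xr; rewrite ge_max => /andP[xr xr'].
    have b1 : normc (dratfun x%:C * ((ln x)%:C ^+ k)) <= A' * Ck / (x * Num.sqrt x).
      rewrite normcM normln; apply: (@le_trans _ _ ((A' / x ^+ 2) * (Ck * Num.sqrt x))).
        apply: ler_pM; rewrite ?normc_ge0 ?exprn_ge0//.
          by rewrite -[in leRHS]nx; apply: hr'; rewrite nx.
        by apply: le_trans (hCk x x0) _; rewrite lnp.
      rewrite le_eqVlt; apply/orP; left; apply/eqP.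
      move: s0 (ssq x x1'); move: (Num.sqrt x) => s s0 ->.
      by field; rewrite lt0r_neq0.
    have b2 : normc (ratfun p q x%:C * (k%:R * (ln x)%:C ^+ k.-1 * x^-1%:C)) <=
        A * k%:R * Ck' / (x * Num.sqrt x).
      rewrite normcM (normcM (k%:R * _)) (normcM k%:R) normln normc_real.
      have -> : normc (k%:R : R[i]) = k%:R.
        by rewrite -(rmorph_nat (real_complex R)) normc_real ger0_norm// ler0n.
      rewrite (@gtr0_norm _ x^-1) ?invr_gt0//.
      apply: (@le_trans _ _ ((A / x) * (k%:R * (Ck' * Num.sqrt x) * x^-1))).
        apply: ler_pM; rewrite ?normc_ge0 ?mulr_ge0 ?exprn_ge0 ?ler0n ?invr_ge0 ?(ltW x0)//.
          by rewrite -[in leRHS]nx; apply: hr; rewrite nx.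
        rewrite ler_pM2r ?invr_gt0// ler_wpM2l ?ler0n//.
        by apply: le_trans (hCk' x x0) _; rewrite lnp.
      rewrite le_eqVlt; apply/orP; left; apply/eqP.
      move: s0 (ssq x x1'); move: (Num.sqrt x) => s s0 ->.
      by field; rewrite lt0r_neq0.
    apply: le_trans (ler_normcD _ _) _; apply: le_trans (lerD b1 b2) _.
    rewrite -mulrDl ler_pM2r ?invr_gt0 ?mulr_gt0//.
    by rewrite /K; lra.
  - by move=> x x0; rewrite -hE; exact: hP.
exists (l1 - l0); split; first exact: dh.
by exists P; split; [exact: hP|exact: cvg_contour hl0 hl1].
Qed.

End OnTheLine.

End RationalDecay.

(** * Poles, residues and principal parts *)

Section Poles.
Context {R : realType}.
Implicit Types (z w : R[i]) (u F : R[i] -> R[i]) (p q : {poly R[i]}).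

Lemma derivable_not_pole F z : derivable F z 1 -> ~ is_pole F z.
Proof.
move=> /cderivable_continuous/(_ ltr01)[r1 r10 h1] [_ /cvgryPge].
move=> /(_ (normc (F z) + 1))/dnearcP[r2 r20 h2].
pose r := Num.min r1 r2 / 2; have r0 : 0 < r by rewrite divr_gt0// lt_min r10.
have rle : r < r1 /\ r < r2.
  have : Num.min r1 r2 <= r1 by rewrite ge_min lexx.
  have : Num.min r1 r2 <= r2 by rewrite ge_min lexx orbT.
  by move: r0; rewrite /r; split; lra.
have nr : normc (z + r%:C - z) = r by rewrite addrAC subrr add0r normc_real gtr0_norm.
have k1 := h1 (z + r%:C); have k2 := h2 (z + r%:C); rewrite nr in k1 k2.
have {}k1 := k1 rle.1; have {}k2 := k2 _.
have : normc (F z) + 1 <= normc (F (z + r%:C)) by apply: k2; rewrite r0 rle.2.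
have := lerB_normc (F (z + r%:C)) (F z); lra.
Qed.

Lemma near_punctured_horner_neq0 q z0 : q != 0 -> \forall w \near z0^', q.[w] != 0.
Proof.
move=> q0; have [n [q1 nz qE]] := multiplicity_XsubC q z0.
rewrite q0/= in nz; have /near_horner_neq0/nearcP[r r0 h] : q1.[z0] != 0 by exact: nz.
apply/dnearcP; exists r => // w /andP[w0 wr].
rewrite qE !hornerE; apply: mulf_neq0; first exact: h.
by apply: expf_neq0; rewrite -normc_gt0.
Qed.

Lemma cderivable_ratfun p q z : q.[z] != 0 -> derivable (ratfun p q) z 1.
Proof. by move=> qz; have [] := cderivM (cderiv_horner p z) (cderiv_hornerV qz). Qed.

Lemma is_pole_quotient u p q z0 : q != 0 -> root q z0 -> p.[z0] != 0 -> u z0 != 0 ->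
  (\forall w \near z0, derivable u w 1) -> is_pole (fun w => u w * ratfun p q w) z0.
Proof.
move=> q0 /eqP qz pz uz du; split.
  move/nearcP : du => [r r0 du].
  have /dnearcP[r' r'0 h] := near_punctured_horner_neq0 z0 q0.
  apply/dnearcP; exists (Num.min r r'); first by rewrite lt_min r0.
  move=> w /andP[w0]; rewrite lt_min => /andP[w1 w2].
  have qw : q.[w] != 0 by apply: h; rewrite w0.
  by have [] := cderivM (derivableP (du w w1)) (derivableP (@cderivable_ratfun p _ _ qw)).
have [r r0 duz] : exists2 r : R, 0 < r & forall w, normc (w - z0) < r -> derivable u w 1.
  by apply/nearcP.
have du0 : derivable u z0 1 by apply: duz; rewrite subrr normc0.
have [dv _] := cderivM (derivableP du0) (cderiv_horner p z0).
have c0 : 0 < normc (u z0 * p.[z0]) by rewrite normc_gt0 mulf_neq0.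
set c := normc _ in c0.
have c20 : 0 < c / 2 by rewrite divr_gt0.
have [r1 r10 h1] := cderivable_continuous dv c20.
apply/cvgryPge => A; have A0 : 0 < `|A| + 1 by rewrite ltr_wpDl.
have e0 : 0 < c / 2 / (`|A| + 1) by rewrite divr_gt0.
have [dq _] := cderiv_horner q z0.
have [r2 r20 h2] := cderivable_continuous dq e0.
have /dnearcP[r3 r30 h3] := near_punctured_horner_neq0 z0 q0.
apply/dnearcP; exists (Num.min r1 (Num.min r2 r3)); first by rewrite !lt_min r10 r20.
move=> w /andP[w0]; rewrite !lt_min => /and3P[w1 w2 w3].
have qw : q.[w] != 0 by apply: h3; rewrite w0.
have n1 : c / 2 <= normc (u w * p.[w]).
  have := lerB_normc (u z0 * p.[z0]) (u z0 * p.[z0] - u w * p.[w]).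
  by rewrite subKr normcB -/c; have := h1 w w1; lra.
have n2 : normc q.[w] < c / 2 / (`|A| + 1) by have := h2 w w2; rewrite qz subr0.
rewrite /ratfun mulrA normcM normcV ler_pdivlMr ?normc_gt0//.
apply: le_trans n1; apply: (@le_trans _ _ ((`|A| + 1) * normc q.[w])).
  by rewrite ler_wpM2r ?normc_ge0// (le_trans (ler_norm _))// lerDl.
by rewrite mulrC -ler_pdivlMr// ltW.
Qed.

(** Points of the closed upper half plane have a logarithm of imaginary part in
    [0, pi], away from the ends of the strip that defines the branch. *)
Lemma clog_upper z : z != 0 -> 0 <= Im z ->
  [/\ cexp (clog z) = z, 0 <= Im (clog z) <= pi & is_derive z 1 (@clog R) z^-1].
Proof.
move=> z0 y0; have [w wz /andP[w0 wpi]] := polar_upper z0 y0; have pi0 := @pi_gt0 R.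
rewrite -wz clog_cexp; last by apply/andP; split; lra.
by split => //; [rewrite w0|apply: is_derive_clog; apply/andP; split; lra].
Qed.

Lemma near_upper z : 0 < Im z -> \forall w \near z, 0 < Im w.
Proof.
move=> y0; apply/nearcP; exists (Im z) => // w wz.
have := ler_Im_normc (w - z); rewrite imD imN ler_norml; lra.
Qed.

Lemma upper_neq0 z : 0 < Im z -> z != 0.
Proof. by apply: contraTneq => ->; rewrite ltxx. Qed.

Definition exp_log (m : nat) z := cexp ('i * z) * clog z ^+ m.

Lemma cderivable_exp_log (m : nat) z : z != 0 -> 0 <= Im z -> derivable (exp_log m) z 1.
Proof.
move=> z0 y0; have [_ _ dl] := clog_upper z0 y0.
by have [] := cderivM (cderiv_cexp_i z) (cderivX m dl).
Qed.

(** The logarithm vanishes at 1 only, so it creates no zero in the open upper half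
    plane and the poles of the integrand there are those of the rational function. *)
Lemma exp_log_neq0 (m : nat) z : 0 < Im z -> exp_log m z != 0.
Proof.
move=> y0; rewrite mulf_neq0 ?cexp_neq0// expf_neq0//.
have [e _ _] := clog_upper (upper_neq0 y0) (ltW y0).
apply/eqP => l0; move: y0; rewrite -e l0 cexp0 /= ltxx//.
Qed.

Lemma peano_exp_log (m : nat) z N : 0 < Im z -> peano (exp_log m) z N.
Proof.
move=> y0; apply: peanoM; first exact: peano_cexp_i; apply: peanoX.
have dl : \forall w \near z, is_derive (w : R[i]) 1 (@clog R) w^-1.
  apply: filterS (near_upper y0) => w w0.
  by have [] := clog_upper (upper_neq0 w0) (ltW w0).
move: N; apply: peano_ode dl _ => N _.
have := @peano_hornerV R 'X z N; rewrite hornerX => /(_ (upper_neq0 y0)).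
by congr peano; apply/funext => w; rewrite hornerX.
Qed.

Lemma exp_log_funE p q (m : nat) :
  exp_log_fun (ratfun p q) m = fun w => exp_log m w * ratfun p q w.
Proof. by apply/funext => w; rewrite /exp_log_fun /exp_log mulrAC. Qed.

Lemma is_residue_exp_log p q (m : nat) z0 : q != 0 -> root q z0 -> 0 < Im z0 ->
  let F := exp_log_fun (ratfun p q) m in is_residue F z0 (residue F z0).
Proof.
move=> q0 rz y0; rewrite /= /residue; apply: xgetPex.
have [n [q1 nz qE]] := multiplicity_XsubC q z0.
rewrite q0/= in nz.
have n0 : (0 < n)%N.
  by rewrite lt0n; apply: contraTneq rz => n0; rewrite qE n0 expr0 mulr1.
pose h w := exp_log m w * (p.[w] * q1.[w]^-1).
have -> : exp_log_fun (ratfun p q) m = fun w => h w / (w - z0) ^+ n.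
  apply/funext => w; rewrite exp_log_funE /h /ratfun qE hornerM horner_exp hornerXsubC.
  by rewrite invfM !mulrA.
apply: ex_residue => //.
- move: (near_upper y0) (near_horner_neq0 nz); apply: filterS2 => w w0 qw.
  have du := derivableP (@cderivable_exp_log m w (upper_neq0 w0) (ltW w0)).
  by have [] := cderivM du (cderivM (cderiv_horner p w) (cderiv_hornerV qw)).
- move=> N; apply: peanoM; first exact: peano_exp_log.
  by apply: peanoM; [exact: peano_poly|exact: peano_hornerV].
Qed.

End Poles.

Section PrincipalPart.
Context {R : realType}.
Variables (z0 : R[i]) (n : nat) (a : nat -> R[i]).
Hypothesis y0 : 0 < Im z0.

Lemma realC_div (u v : R) : (u / v)%:C = u%:C / v%:C :> R[i].
Proof. exact: fmorph_div. Qed.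

(** Subtracting a simple pole at the conjugate point, which lies outside the contour,
    makes the principal part decay quadratically: half circles then contribute
    nothing and only the integral over the real line remains. *)
Definition corrected_part (z : R[i]) : R[i] :=
  \sum_(k < n.+1) a k / (z - z0) ^+ k.+1 - a 0%N / (z - z0^*%C).

Definition corrected_part_primitive (x : R) : R[i] :=
  \sum_(k < n) (- (a k.+1 / k.+1%:R) / (x%:C - z0) ^+ k.+1) +
  a 0%N * (2 * 'i) * (atan ((x - Re z0) / Im z0))%:C.

Let sub_neq0 (x : R) : x%:C - z0 != 0.
Proof.
rewrite subr_eq0; apply: contraTneq y0 => <- /=; by rewrite ltxx.
Qed.

Let subJ_neq0 (x : R) : x%:C - z0^*%C != 0.
Proof.
rewrite subr_eq0; apply: contraTneq y0 => e.
have : Im (x%:C : R[i]) = Im (z0^*%C) by rewrite e.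
by case: z0 => u v /= /eqP; rewrite eq_sym oppr_eq0 => /eqP ->; rewrite ltxx.
Qed.

Lemma cderiv_sub_inv (c z : R[i]) (k : nat) : z - c != 0 ->
  is_derive z 1 (fun w => ((w - c) ^+ k.+1)^-1) (- (k.+1%:R / (z - c) ^+ k.+2)).
Proof.
move=> zc; have d := cderivB (cderiv_id z) (cderiv_cst c z).
have := cderiv_comp (cderivX k.+1 d) (cderivV (expf_neq0 k.+1 zc)).
apply: cderiv_eq => //=; rewrite subr0 mulr1 !exprS.
have [k0|k0] := eqVneq k 0%N; first by rewrite k0 !expr0; field.
by field; rewrite expf_neq0 ?zc.
Qed.

Lemma cderivable_corrected_part z : z != z0 -> 0 <= Im z ->
  derivable corrected_part z 1.
Proof.
move=> zz yz.
have zz' : z - z0 != 0 by rewrite subr_eq0.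
have zJ : z - z0^*%C != 0.
  rewrite subr_eq0; apply: contraTneq yz => ->.
  by move: y0; case: z0 => u v /= v0; rewrite -ltNge oppr_lt0.
have dsum : exists d, is_derive z 1 (fun z => \sum_(k < n.+1) a k / (z - z0) ^+ k.+1) d.
  elim: n => [|n' [d ih]].
    exists (a 0%N * (- (1%:R / (z - z0) ^+ 2))).
    apply: cderiv_eq (cderivZ (a 0%N) (cderiv_sub_inv 0 zz')) => //.
    by apply/funext => w; rewrite big_ord_recl big_ord0 addr0.
  exists (d + a n'.+1 * - (n'.+2%:R / (z - z0) ^+ n'.+3)).
  apply: cderiv_eq (cderivD ih (cderivZ (a n'.+1) (cderiv_sub_inv n'.+1 zz'))) => //.
  by apply/funext => w; rewrite [in RHS]big_ord_recr.
have [d hd] := dsum.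
have [] // := cderivB hd (cderivZ (a 0%N) (cderiv_sub_inv 0 zJ)).
Qed.

(** 1 / (x - z0) - 1 / (x - conj z0) is 2 i times the derivative of
    atan ((x - Re z0) / Im z0). *)
Lemma rderiv_corrected_part_primitive (x : R) :
  rderiv corrected_part_primitive x (corrected_part x%:C).
Proof.
have dx := rderiv_real (is_derive_id x 1).
have dk (k : nat) : rderiv (fun x : R => - (a k.+1 / k.+1%:R) / (x%:C - z0) ^+ k.+1) x
    (a k.+1 / (x%:C - z0) ^+ k.+2).
  have := rderiv_comp (cderivZ (- (a k.+1 / k.+1%:R)) (cderiv_sub_inv k (sub_neq0 x))) dx.
  apply: rderiv_eq => //; rewrite mulr1.
  have s0 := sub_neq0 x; rewrite !exprS.
  have k0 : k.+1%:R != 0 :> R[i] by rewrite pnatr_eq0.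
  have xk : (x%:C - z0) ^+ k != 0 by rewrite expf_neq0.
  move: (k.+1%:R) k0 (_ ^+ k) xk => K K0 X X0.
  by field; apply/and3P; split.
have dsum : rderiv (fun x : R => \sum_(k < n) (- (a k.+1 / k.+1%:R) / (x%:C - z0) ^+ k.+1)) x
    (\sum_(k < n) a k.+1 / (x%:C - z0) ^+ k.+2).
  exact: (@rderiv_sum R 'I_n _
    (fun k x => - (a k.+1 / k.+1%:R) / (x%:C - z0) ^+ k.+1)
    (fun k => a k.+1 / (x%:C - z0) ^+ k.+2) x (fun k => dk k)).
have dat : is_derive x 1 (fun x => atan ((x - Re z0) / Im z0))
    ((1 + ((x - Re z0) / Im z0) ^+ 2)^-1 * (Im z0)^-1).
  have dlin : is_derive x 1 (fun x => (x - Re z0) / Im z0) (Im z0)^-1.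
    have -> : (fun x => (x - Re z0) / Im z0) = (Im z0)^-1 *: (fun x => x - Re z0).
      by apply/funext => t; rewrite !fctE /GRing.scale/= mulrC.
    have := is_deriveZ (Im z0)^-1 (is_deriveB (is_derive_id x 1) (is_derive_cst (Re z0) x 1)).
    by rewrite subr0 /GRing.scale/= mulr1; exact.
  exact: (@is_derive1_comp R atan _ x _ _ (is_derive1_atan _) dlin).
have := rderivD dsum (rderivZ (a 0%N * (2 * 'i)) (rderiv_real dat)).
apply: rderiv_eq => //; rewrite /corrected_part big_ord_recl/= addrAC addrC; congr (_ + _).
have e : (x%:C - z0)^-1 - (x%:C - z0^*%C)^-1 =
    2 * 'i * ((1 + ((x - Re z0) / Im z0) ^+ 2)^-1 * (Im z0)^-1)%:C.
  have s0 := sub_neq0 x; have s1 := subJ_neq0 x.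
  have -> : (x%:C - z0)^-1 - (x%:C - z0^*%C)^-1 =
      (z0 - z0^*%C) / ((x%:C - z0) * (x%:C - z0^*%C)) by field; apply/andP; split.
  have -> : z0 - z0^*%C = 2 * 'i * (Im z0)%:C by rewrite subcJ mulrAC.
  have -> : (x%:C - z0) * (x%:C - z0^*%C) = ((x - Re z0) ^+ 2 + Im z0 ^+ 2)%:C.
    by case: z0 => u v; apply: complexP; rewrite !reimE/=; ring.
  have D0 : 0 < (x - Re z0) ^+ 2 + Im z0 ^+ 2 by rewrite ltr_wpDl ?sqr_ge0// exprn_gt0.
  transitivity (2 * 'i * (Im z0 / ((x - Re z0) ^+ 2 + Im z0 ^+ 2))%:C).
    by rewrite realC_div mulrA.
  by congr (_ * _%:C); field; rewrite !lt0r_neq0// addrC.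
by rewrite -mulrA -e expr1 mulrBr.
Qed.

End PrincipalPart.

(** * Asymptotics of the corrected principal parts *)

Section CorrectedPart.
Context {R : realType}.
Variables (z0 : R[i]) (n : nat) (a : nat -> R[i]).
Hypothesis y0 : 0 < Im z0.

Let T := corrected_part z0 n a.
Let V := corrected_part_primitive z0 n a.

Lemma normc_inv_sub_le (c z : R[i]) : 2 + 2 * normc c <= normc z ->
  [/\ 0 < normc z, z - c != 0, normc (z - c)^-1 <= 2 / normc z & 2 / normc z <= 1].
Proof.
move=> cz; have c0 := normc_ge0 c; have z0' : 0 < normc z by lra.
have zc : normc z / 2 <= normc (z - c) by have := lerB_normc z c; lra.
have zc0 : 0 < normc (z - c) by lra.
split => //; first by rewrite -normc_gt0.
- by rewrite normcV -invf_div lef_pV2 ?posrE// divr_gt0.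
- by rewrite ler_pdivrMr// mul1r; lra.
Qed.

Lemma normc_conj (z : R[i]) : normc z^*%C = normc z.
Proof. by case: z => u v; rewrite /= sqrrN. Qed.

Lemma corrected_part_decay : exists C r : R, [/\ 0 < C, 1 <= r &
  forall z, r <= normc z -> normc (T z) <= C / normc z ^+ 2].
Proof.
pose A := \sum_(k < n) normc (a k.+1).
have A0 : 0 <= A by rewrite sumr_ge0// => i _; rewrite normc_ge0.
have B0 : 0 <= normc (a 0%N * (z0 - z0^*%C)) by rewrite normc_ge0.
exists (4 * (A + normc (a 0%N * (z0 - z0^*%C)) + 1)), (2 + 2 * normc z0).
have n0 := normc_ge0 z0; split; [lra|lra|move=> z zr].
have [zp s0 i0 i1] := normc_inv_sub_le zr.
have [_ s1 j0 _] : [/\ 0 < normc z, z - z0^*%C != 0,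
    normc (z - z0^*%C)^-1 <= 2 / normc z & 2 / normc z <= 1].
  by apply: normc_inv_sub_le; rewrite normc_conj.
have q0 : 0 <= 2 / normc z by rewrite divr_ge0 ?normc_ge0.
have -> : T z = \sum_(k < n) a k.+1 * (z - z0)^-1 ^+ k.+2 +
    a 0%N * (z0 - z0^*%C) * ((z - z0)^-1 * (z - z0^*%C)^-1).
  rewrite /T /corrected_part big_ord_recl/= addrAC addrC; congr (_ + _).
    by apply: eq_bigr => i _; rewrite exprVn.
  by rewrite expr1; field; apply/andP; split.
have e4 : (2 / normc z) ^+ 2 = 4 / normc z ^+ 2.
  by rewrite expr_div_n; congr (_ / _); ring.
have -> : 4 * (A + normc (a 0%N * (z0 - z0^*%C)) + 1) / normc z ^+ 2 =
    A * (2 / normc z) ^+ 2 + normc (a 0%N * (z0 - z0^*%C)) * (2 / normc z) ^+ 2 +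
    (2 / normc z) ^+ 2 by rewrite e4; ring.
have p2 : 0 <= (2 / normc z) ^+ 2 by rewrite exprn_ge0.
have t1 : normc (\sum_(k < n) a k.+1 * (z - z0)^-1 ^+ k.+2) <= A * (2 / normc z) ^+ 2.
  apply: le_trans (ler_normc_sum _ _ _) _; rewrite mulr_suml; apply: ler_sum => k _.
  rewrite normcM normcX ler_wpM2l ?normc_ge0//.
  apply: (@le_trans _ _ ((2 / normc z) ^+ k.+2)).
    by rewrite lerXn2r ?nnegrE ?normc_ge0.
  by rewrite -[k.+2]/(2 + k)%N exprD ler_piMr// exprn_ile1.
have t2 : normc (a 0%N * (z0 - z0^*%C) * ((z - z0)^-1 * (z - z0^*%C)^-1)) <=
    normc (a 0%N * (z0 - z0^*%C)) * (2 / normc z) ^+ 2.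
  rewrite normcM (normcM (z - z0)^-1) ler_wpM2l// expr2.
  by apply: ler_pM; rewrite ?normc_ge0.
have := ler_normcD (\sum_(k < n) a k.+1 * (z - z0)^-1 ^+ k.+2)
  (a 0%N * (z0 - z0^*%C) * ((z - z0)^-1 * (z - z0^*%C)^-1)).
lra.
Qed.

(** A primitive of the corrected part folded onto the positive half-line. *)
Definition corrected_part_odd (x : R) := V x - V (- x).

Lemma rderiv_corrected_part_odd (x : R) :
  rderiv corrected_part_odd x (T x%:C + T (- x%:C)).
Proof.
have d1 := rderiv_corrected_part_primitive n a y0 x.
have d2 := rderiv_comp_real (is_deriveNid x 1) (rderiv_corrected_part_primitive n a y0 (- x)).
have := rderivB d1 d2; apply: rderiv_eq => //.
by rewrite !rmorphN rmorph1 mulN1r opprK.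
Qed.

Lemma corrected_part_odd_cvg0 : corrected_part_odd x @[x --> (0 : R)^'+] --> (0 : R[i]).
Proof.
apply/cvgcP => e e0; have e20 : 0 < e / 2 by rewrite divr_gt0.
have [|r r0 hr] := @rderivable_cvg R V 0 (e / 2) _ e20.
  by eexists; exact: rderiv_corrected_part_primitive.
near=> x; have x0 : 0 < x by near: x; exact: nbhs_right_gt.
have xr : x < r by near: x; exact: nbhs_right_lt.
have := hr x; have := hr (- x); rewrite !subr0 normrN gtr0_norm// => /(_ xr) k1 /(_ xr) k2.
rewrite [X in normc X](_ : _ = (V x - V 0) - (V (- x) - V 0)); last first.
  by rewrite /corrected_part_odd; ring.
by apply: le_lt_trans (ler_normcB _ _) _; lra.
Unshelve. all: by end_near. Qed.

Lemma atan_affine_cvgy (c b : R) : 0 < b -> atan ((x + c) / b) @[x --> +oo] --> (pi / 2 : R).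
Proof.
move=> b0; have h : ((x + c) / b) @[x --> +oo] --> +oo.
  apply/cvgryPge => A; near=> x; rewrite ler_pdivlMr// -lerBlDr.
  by near: x; apply: nbhs_pinfty_ge; exact: num_real.
exact: (cvg_comp _ _ h (@cvgy_atan R)).
Unshelve. all: by end_near. Qed.

(** The residue comes from the total variation pi of the arctangent. *)
Lemma corrected_part_odd_cvgy :
  corrected_part_odd x @[x --> +oo] --> (2 * (pi : R)%:C * 'i * a 0%N : R[i]).
Proof.
pose A := \sum_(k < n) normc (- (a k.+1 / k.+1%:R)).
have A0 : 0 <= A by rewrite sumr_ge0// => i _; rewrite normc_ge0.
pose S (x : R) := \sum_(k < n) (- (a k.+1 / k.+1%:R) / (x%:C - z0) ^+ k.+1).
have Sle x : 2 + 2 * normc z0 <= `|x| -> normc (S x) <= A * (2 / `|x|).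
  rewrite -normc_real => xr; have [zp s0 i0 i1] := normc_inv_sub_le xr.
  have q0 : 0 <= 2 / normc (x%:C : R[i]) by rewrite divr_ge0 ?normc_ge0.
  apply: le_trans (ler_normc_sum _ _ _) _; rewrite mulr_suml; apply: ler_sum => k _.
  rewrite -exprVn normcM normcX ler_wpM2l ?normc_ge0//.
  apply: (@le_trans _ _ ((2 / normc (x%:C : R[i])) ^+ k.+1)).
    by rewrite lerXn2r ?nnegrE ?normc_ge0.
  by rewrite exprS ler_piMr// exprn_ile1.
pose B (x : R) := atan ((x + - Re z0) / Im z0) + atan ((x + Re z0) / Im z0).
have WE x : corrected_part_odd x = S x - S (- x) + a 0%N * (2 * 'i) * (B x)%:C.
  rewrite /corrected_part_odd /V /corrected_part_primitive -/(S x) -/(S (- x)) /B.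
  have -> : (- x - Re z0) / Im z0 = - ((x + Re z0) / Im z0) by rewrite -opprD mulNr.
  by rewrite atanN rmorphN (rmorphD (real_complex R)); ring.
have hB : B x @[x --> +oo] --> (pi : R).
  rewrite [X in _ --> X](_ : pi = pi / 2 + pi / 2); last by rewrite -splitr.
  by apply: cvgD; exact: atan_affine_cvgy.
apply/cvgcP => e e0.
pose c := normc (a 0%N * (2 * 'i)) + 1.
have c0 : 0 < c by rewrite ltr_wpDl ?normc_ge0.
have e2 : 0 < e / 2 / c by rewrite !divr_gt0.
move/cvgrPdist_lt : hB => /(_ _ e2) hB.
near=> x.
have x0 : 0 < x by near: x; apply: nbhs_pinfty_gt; exact: num_real.
have xr : 2 + 2 * normc z0 <= x by near: x; apply: nbhs_pinfty_ge; exact: num_real.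
have xe : (8 * A + 1) / e <= x by near: x; apply: nbhs_pinfty_ge; exact: num_real.
have hBx : `|pi - B x| < e / 2 / c by near: x.
have k1 := Sle x; have k2 := Sle (- x); rewrite normrN gtr0_norm// in k1 k2.
have {}k1 := k1 xr; have {}k2 := k2 xr.
rewrite [X in normc X](_ : _ =
    (S x - S (- x)) - a 0%N * (2 * 'i) * (pi - B x)%:C); last first.
  by rewrite WE (rmorphB (real_complex R)); ring.
have k3 : normc (a 0%N * (2 * 'i) * (pi - B x)%:C) <= e / 2.
  rewrite normcM normc_real; apply: (@le_trans _ _ (c * (e / 2 / c))).
    by apply: ler_pM; rewrite ?normc_ge0// ?lerDl// ltW.
  by rewrite mulrC divfK// lt0r_neq0.
have k4 : A * (2 / x) < e / 4.
  rewrite mulrA ltr_pdivrMr//; move: xe; rewrite ler_pdivrMr//; lra.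
have := ler_normcB (S x - S (- x)) (a 0%N * (2 * 'i) * (pi - B x)%:C).
have := ler_normcB (S x) (S (- x)); lra.
Unshelve. all: by end_near. Qed.

End CorrectedPart.

(** * Estimates on half circles *)

Section HalfPlaneIntegral.
Context {R : realType}.
Implicit Types (z w : R[i]) (H : R[i] -> R[i]).

(** In terms of the end points a and b the arcs contribute multiples of sqrt a and of
    1 / sqrt b, so both disappear in the limit. *)
Lemma half_annulus_cvg H (B : R -> R[i]) (K A : R) : 0 <= K ->
  (forall z, z != 0 -> 0 <= Im z -> derivable H z 1) ->
  (forall x : R, 0 < x -> rderiv B x (H x%:C + H (- x%:C))) ->
  (forall w, 0 <= Im w <= pi -> A <= Re w ->
     normc (H (cexp w) * cexp w) <=
       K * expR (Re w / 2) * (expR (- Im (cexp w)) + expR (- Re w))) ->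
  (forall w, 0 <= Im w <= pi -> Re w <= - A ->
     normc (H (cexp w) * cexp w) <= K * expR (Re w / 2)) ->
  (B ab.2 - B ab.1) @[ab --> @contour_filter R] --> (0 : R[i]).
Proof.
move=> K0 dH dB big small; apply/cvgcP => e e0; have pi0 := @pi_gt0 R.
(* K * (2 * pi + 2) and K * pi, the constants of the two arcs, are at most M. *)
pose M := K * (2 * pi + 2) + 1.
have M0 : 0 < M by rewrite ltr_wpDl ?mulr_ge0// addr_ge0// mulr_ge0// ltW.
have KM : K * pi <= M.
  by rewrite /M; have := mulr_ge0 K0 (ltW pi0); lra.
pose s := e / (2 * M); have s0 : 0 < s by rewrite divr_gt0// mulr_gt0.
apply: (@near_contour R _ (Num.min (s ^+ 2) (expR (- A))) (Num.max (s ^- 2) (expR A))).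
  by rewrite lt_min exprn_gt0//= expR_gt0.
move=> a b a0; rewrite lt_min gt_max => /andP[as2 aA] /andP[bs2 bA] ab.
have b0 : 0 < b := lt_trans a0 ab.
rewrite subr0 /=.
have := half_annulus K0 dH dB big small (a := ln a) (b := ln b).
rewrite ler_ln ?posrE// (ltW ab) !lnK ?posrE// => /(_ isT).
have -> : ln a <= - A by rewrite -ler_expR lnK ?posrE// ltW.
have -> : A <= ln b by rewrite -ler_expR lnK ?posrE// ltW.
move=> /(_ isT isT) /le_lt_trans; apply.
rewrite mulNr expRN !expR_half_ln//.
have sa : Num.sqrt a < s.
  by rewrite -[ltRHS]gtr0_norm// -sqrtr_sqr ltr_sqrt// exprn_gt0.
have sb : (Num.sqrt b)^-1 < s.
  rewrite -[ltRHS]invrK ltf_pV2 ?posrE ?invr_gt0 ?sqrtr_gt0//.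
  by rewrite -[ltLHS]gtr0_norm ?invr_gt0// -sqrtr_sqr ltr_sqrt// exprVn.
have sb0 : 0 < (Num.sqrt b)^-1 by rewrite invr_gt0 sqrtr_gt0.
have t1 : K * (2 * pi + 2) * (Num.sqrt b)^-1 < M * s.
  apply: (@le_lt_trans _ _ (M * (Num.sqrt b)^-1)); last by rewrite ltr_pM2l.
  by rewrite ler_pM2r// lerDl.
have t2 : K * pi * Num.sqrt a <= M * s.
  by apply: ler_pM; rewrite ?sqrtr_ge0 ?(ltW sa)// mulr_ge0// ltW.
have : M * s = e / 2 by rewrite /s; field; rewrite lt0r_neq0.
lra.
Qed.

Lemma cderivable_sum (s : seq R[i]) (f : R[i] -> R[i] -> R[i]) z :
  (forall c, c \in s -> derivable (f c) z 1) ->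
  derivable (fun w => \sum_(c <- s) f c w) z 1.
Proof.
elim: s => [|c s ih] h.
  have -> : (fun w => \sum_(c <- [::]) f c w) = fun=> 0.
    by apply/funext => w; rewrite big_nil.
  by have [] := cderiv_cst 0 z.
have -> : (fun w => \sum_(c <- c :: s) f c w) = fun w => f c w + \sum_(c <- s) f c w.
  by apply/funext => w; rewrite big_cons.
have d1 := derivableP (h c (mem_head c s)).
have [|] := cderivD d1 (derivableP (ih _)) => //.
by move=> c' c's; apply: h; rewrite inE c's orbT.
Qed.

Lemma cderivable_near (f g : R[i] -> R[i]) z : (\forall w \near z, f w = g w) ->
  derivable f z 1 -> derivable g z 1.
Proof. by move=> fg /derivableP df; have [] := cderiv_near fg df. Qed.

Lemma sum_decay (s : seq R[i]) (T : R[i] -> R[i] -> R[i]) :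
  (forall c, c \in s -> exists C r : R, [/\ 0 < C, 1 <= r &
     forall z, r <= normc z -> normc (T c z) <= C / normc z ^+ 2]) ->
  exists C r : R, [/\ 0 < C, 1 <= r &
     forall z, r <= normc z -> normc (\sum_(c <- s) T c z) <= C / normc z ^+ 2].
Proof.
elim: s => [|c s ih] h.
  exists 1, 1; split=> // z _; rewrite big_nil normc0 mul1r invr_ge0 exprn_ge0//.
  exact: normc_ge0.
have [|C [r [C0 r1 hr]]] := ih; first by move=> c' c's; apply: h; rewrite inE c's orbT.
have [C' [r' [C'0 r'1 hr']]] := h c (mem_head c s).
exists (C' + C), (Num.max r' r); split; [exact: addr_gt0|by rewrite le_max r'1|].
move=> z; rewrite ge_max => /andP[z1 z2]; rewrite big_cons mulrDl.
by apply: le_trans (ler_normcD _ _) _; apply: lerD; [exact: hr'|exact: hr].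
Qed.

Lemma sum_contour_cvg (s : seq R[i]) (W : R[i] -> R -> R[i]) (l : R[i] -> R[i]) :
  (forall c, c \in s ->
     (W c ab.2 - W c ab.1) @[ab --> @contour_filter R] --> l c) ->
  (\sum_(c <- s) W c ab.2 - \sum_(c <- s) W c ab.1) @[ab --> @contour_filter R]
    --> \sum_(c <- s) l c.
Proof.
elim: s => [|c s ih] h.
  rewrite big_nil; apply/cvgcP => e e0; apply: filterE => ab.
  by rewrite !big_nil !subr0 normc0.
have h1 := h c (mem_head c s).
have h2 : forall c, c \in s -> (W c ab.2 - W c ab.1) @[ab --> @contour_filter R] --> l c.
  by move=> c' c's; apply: h; rewrite inE c's orbT.
rewrite big_cons; apply/cvgcP => e e0.
have : (W c ab.2 - W c ab.1 + (\sum_(c <- s) W c ab.2 - \sum_(c <- s) W c ab.1))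
    @[ab --> @contour_filter R] --> l c + \sum_(c <- s) l c.
  exact: cvgcD h1 (ih h2).
move=> /cvgcP/(_ e e0).
apply: filterS => ab; rewrite !big_cons.
by apply: le_lt_trans; rewrite le_eqVlt; apply/orP; left; apply/eqP; congr normc; ring.
Qed.

Variables (p q : {poly R[i]}) (m : nat).
Hypotheses (q_neq0 : forall x : R, q.[x%:C] != 0) (deg_lt : (size p < size q)%N).
Let F := exp_log_fun (ratfun p q) m.
Let q0 : q != 0. Proof. by rewrite -size_poly_gt0 (leq_trans _ deg_lt). Qed.

Lemma cderivable_integrand z : z != 0 -> 0 <= Im z -> q.[z] != 0 -> derivable F z 1.
Proof.
move=> z0 y0 qz; rewrite /F exp_log_funE.
by have [] := cderivM (derivableP (@cderivable_exp_log R m z z0 y0))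
  (derivableP (@cderivable_ratfun R p q z qz)).
Qed.

Lemma rderivable_integrand : forall x : R, 0 < x ->
  rderivable (fun x => F x%:C + F (- x%:C)) x.
Proof.
move=> x x0; have xC0 : x%:C != 0 :> R[i].
  by rewrite eq_complex/= negb_and lt0r_neq0.
have d1 : derivable F x%:C 1 by apply: cderivable_integrand.
have d2 : derivable F (- x%:C) 1.
  have e : - x%:C = (- x)%:C :> R[i] by rewrite rmorphN.
  by apply: cderivable_integrand; rewrite ?oppr_eq0// e.
have dx := rderiv_real (is_derive_id x 1).
have := rderivD (rderiv_comp (derivableP d1) dx) (rderiv_comp (derivableP d2) (rderivN dx)).
by move=> h; eexists; exact: h.
Qed.

(** On a large half circle f is balanced by the factor [cexp w], the derivative of the
    change of variable; the power of the logarithm costs half an exponential. *)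
Lemma integrand_bound_big : exists C r : R, [/\ 0 < C, 1 <= r &
  forall w, 0 <= Im w <= pi -> r <= expR (Re w) -> 0 <= Re w ->
    normc (F (cexp w) * cexp w) <= C * expR (Re w / 2) * expR (- Im (cexp w))].
Proof.
have [C [r [C0 r1 hr]]] := @ratfun_cvgy R p q deg_lt.
have [L L0 hL] := @pow_log_le R m.
exists (C * L), r; split => //; first by rewrite mulr_gt0.
move=> w /andP[w0 wpi] rw re0; have pi0 := @pi_gt0 R.
have nz : normc (cexp w) = expR (Re w) by rewrite normc_cexp.
have E0 := expR_gt0 (Re w).
have lw : clog (cexp w) = w by rewrite clog_cexp//; apply/andP; split; lra.
have nw : normc w <= Re w + pi.
  by apply: le_trans (normc_le_ReIm _) _; rewrite ger0_norm// ger0_norm// lerD2l.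
have h1 : normc (ratfun p q (cexp w)) * expR (Re w) <= C.
  by have := hr (cexp w); rewrite nz => /(_ rw); rewrite ler_pdivlMr.
have h2 : normc w ^+ m <= L * expR (Re w / 2).
  by apply: le_trans (hL _ re0); rewrite lerXn2r ?nnegrE ?normc_ge0// addr_ge0// ltW.
rewrite -nz in h1; rewrite /F /exp_log_fun lw.
have -> : cexp ('i * cexp w) * ratfun p q (cexp w) * w ^+ m * cexp w =
    (ratfun p q (cexp w) * cexp w) * w ^+ m * cexp ('i * cexp w) by ring.
rewrite normcM normc_cexp (normcM (_ * _)) normcX (normcM (ratfun p q _)).
have -> : Re ('i * cexp w) = - Im (cexp w) by rewrite reM/= mul0r mul1r sub0r.
rewrite ler_pM2r ?expR_gt0// -[leRHS]mulrA; apply: ler_pM => //; first by apply: mulr_ge0; exact: normc_ge0.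
by apply: exprn_ge0; exact: normc_ge0.
Qed.

(** On a small half circle the factor [cexp w], of modulus the radius, outweighs the
    power of the logarithm. *)
Lemma integrand_bound_small : exists C r : R, [/\ 0 < C, 0 < r &
  forall w, 0 <= Im w <= pi -> expR (Re w) < r -> Re w <= 0 ->
    normc (F (cexp w) * cexp w) <= C * expR (Re w / 2)].
Proof.
have [C [r [C0 r0 hr]]] := @ratfun_cvg0 R p q q_neq0.
have [L L0 hL] := @pow_log_le R m.
exists (C * L), r; split => //; first by rewrite mulr_gt0.
move=> w /andP[w0 wpi] rw re0; have pi0 := @pi_gt0 R.
have nz : normc (cexp w) = expR (Re w) by rewrite normc_cexp.
have lw : clog (cexp w) = w by rewrite clog_cexp//; apply/andP; split; lra.
have nw : normc w <= - Re w + pi.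
  by apply: le_trans (normc_le_ReIm _) _; rewrite ler0_norm// ger0_norm// lerD2l.
have h1 : normc (ratfun p q (cexp w)) <= C by apply: hr; rewrite nz.
have h2 : normc w ^+ m <= L * expR (- Re w / 2).
  have nre : 0 <= - Re w by rewrite oppr_ge0.
  by apply: le_trans (hL _ nre); rewrite lerXn2r ?nnegrE ?normc_ge0// addr_ge0// ltW.
have im0 : 0 <= Im (cexp w).
  rewrite /cexp !reimE/= mul0r addr0 mulr_ge0 ?expR_ge0//.
  by apply: sin_ge0_pi; rewrite w0.
rewrite /F /exp_log_fun lw.
have -> : cexp ('i * cexp w) * ratfun p q (cexp w) * w ^+ m * cexp w =
    cexp ('i * cexp w) * (ratfun p q (cexp w) * (w ^+ m * cexp w)) by ring.
rewrite normcM normc_cexp (normcM (ratfun p q _)) (normcM (_ ^+ _)) normcX nz.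
have -> : Re ('i * cexp w) = - Im (cexp w) by rewrite reM/= mul0r mul1r sub0r.
apply: (@le_trans _ _ (1 * (C * (L * expR (- Re w / 2) * expR (Re w))))); last first.
  have -> : L * expR (- Re w / 2) * expR (Re w) = L * expR (Re w / 2).
    by rewrite -mulrA -expRD; congr (_ * expR _); field.
  by rewrite mul1r mulrA.
apply: ler_pM; rewrite ?expR_ge0 ?mulr_ge0 ?normc_ge0 ?exprn_ge0 ?expR_ge0//.
- exact: normc_ge0.
- by rewrite expR_le1 oppr_le0.
- apply: ler_pM => //; rewrite ?normc_ge0 ?mulr_ge0 ?exprn_ge0 ?expR_ge0 ?normc_ge0//.
  by rewrite ler_pM2r ?expR_gt0.
Qed.

End HalfPlaneIntegral.

(** * The residue formula *)

Section ResidueFormula.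
Context {R : realType}.
Implicit Types (z w : R[i]).
Variables (p q : {poly R[i]}) (m : nat) (s : seq R[i]).
Hypotheses (q_neq0 : forall x : R, q.[x%:C] != 0) (deg_lt : (size p < size q)%N).
Hypotheses (s_uniq : uniq s) (sP : forall z, (z \in s) = root q z && (0 < Im z)).
Let F := exp_log_fun (ratfun p q) m.
Let q0 : q != 0. Proof. by rewrite -size_poly_gt0 (leq_trans _ deg_lt). Qed.

(** The residue theorem on the half annulus: subtracting the corrected principal
    parts leaves a function that extends holomorphically, whose integral over
    the real axis therefore vanishes in the limit. *)
Lemma residue_formula :
  improper (fun x => F x%:C + F (- x%:C))
    (2 * (pi : R)%:C * 'i * \sum_(z <- s) residue F z).
Proof.
pose data (z : R[i]) (D : nat * (nat -> R[i]) * (R[i] -> R[i])) := z \in s ->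
  [/\ holomorphic_near D.2 z,
      (\forall w \near z^', F w = \sum_(k < D.1.1.+1) D.1.2 k / (w - z) ^+ k.+1 + D.2 w)
    & residue F z = D.1.2 0%N].
have exD z : exists D, data z D.
  have [zs|zs] := boolP (z \in s); last by exists (0%N, fun=> 0, fun=> 0) => /(negP zs).
  move: (zs); rewrite sP => /andP[rz yz].
  have [n [a [g [n0 hg Fg e]]]] := @is_residue_exp_log R p q m z q0 rz yz.
  by exists (n.-1, a, g) => _; split => //=; rewrite prednK.
have [D hD] := choice exD.
have s_im z : z \in s -> 0 < Im z by rewrite sP => /andP[].
pose T z := corrected_part z (D z).1.1 (D z).1.2.
pose G z w := (D z).2 w + (D z).1.2 0%N / (w - z^*%C) - \sum_(c <- rem z s) T c w.
(* H is F minus all principal parts; at a pole z it takes the value of its local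
   holomorphic extension G z. *)
pose H w := if w \in s then G w w else F w - \sum_(c <- s) T c w.
have notin_s z : q.[z] != 0 -> z \notin s.
  by move=> qz; rewrite sP negb_and /root qz.
have upper_q z : 0 <= Im z -> z \notin s -> q.[z] != 0.
  rewrite sP le_eqVlt negb_and => /orP[/eqP y0 _|-> /=]; last by rewrite orbF.
  have -> : z = (Re z)%:C by apply: complexP => //=; rewrite -y0.
  exact: q_neq0.
have near_notin z : \forall w \near z^', w \notin s.
  have /dnearcP[r r0 h] := near_punctured_horner_neq0 z q0.
  by apply/dnearcP; exists r => // w /h; exact: notin_s.
have dT z : 0 <= Im z -> z \notin s -> derivable (fun w => \sum_(c <- s) T c w) z 1.
  move=> y0 zs; apply: cderivable_sum => c cs; apply: cderivable_corrected_part => //.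
    exact: s_im.
  by apply: contraNneq zs => ->.
have dH z : z != 0 -> 0 <= Im z -> derivable H z 1.
  move=> z0 y0; have [zs|zs] := boolP (z \in s).
    have [hol FD _] := hD z zs; have yz := s_im _ zs.
    have dG : derivable (G z) z 1.
      have [d1 _] : derivable (D z).2 z 1 /\ True.
        split; last by []; move: hol => /nearcP[r r0 /(_ z)]; rewrite subrr normc0; exact.
      have d2 : derivable (fun w => \sum_(c <- rem z s) T c w) z 1.
        apply: cderivable_sum => c; rewrite (mem_rem_uniq z s_uniq) inE => /andP[cz cs].
        by apply: cderivable_corrected_part => //; [exact: s_im|rewrite eq_sym].
      have zJ : z - z^*%C != 0.
        rewrite subr_eq0; apply: contraTneq yz => e.
        have : Im z = Im (z^*%C) by rewrite -e.
        case: (z) => u v /= vv; rewrite -leNgt; lra.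
      have d3 := cderivZ ((D z).1.2 0%N) (cderiv_sub_inv 0 zJ).
      have [+ _] := cderivB (cderivD (derivableP d1) d3) (derivableP d2).
      by apply: cderivable_near; apply: filterE => w; rewrite /G expr1.
    apply: cderivable_near dG.
    have /dnearcP[r1 r10 h1] := FD; have /dnearcP[r2 r20 h2] := near_notin z.
    apply/nearcP; exists (Num.min r1 r2); first by rewrite lt_min r10.
    move=> w; rewrite lt_min => /andP[w1 w2].
    have [->|wz] := eqVneq w z; first by rewrite /H zs.
    have wz0 : 0 < normc (w - z) by rewrite normc_gt0 subr_eq0.
    rewrite /H (negbTE (h2 w _)) ?wz0// (h1 w) ?wz0// (big_rem z zs)/=.
    by rewrite /G [T z w]/T /corrected_part; ring.
  have qz := upper_q _ y0 zs.
  have [+ _] := cderivB (derivableP (@cderivable_integrand R p q m z z0 y0 qz))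
    (derivableP (dT z y0 zs)).
  apply: cderivable_near; apply: filterS (near_horner_neq0 qz) => w /notin_s ws.
  by rewrite /H (negbTE ws).
have [P hP] := ex_primitive_pos (@rderivable_integrand R p q m q_neq0).
pose W z := corrected_part_odd z (D z).1.1 (D z).1.2.
pose B x := P x - \sum_(z <- s) W z x.
have Hreal (x : R) : H x%:C = F x%:C - \sum_(c <- s) T c x%:C.
  by rewrite /H (negbTE (notin_s _ (q_neq0 x))).
have dB (x : R) : 0 < x -> rderiv B x (H x%:C + H (- x%:C)).
  move=> x0; have dW : rderiv (fun x => \sum_(z <- s) W z x) x
      (\sum_(z <- s) (T z x%:C + T z (- x%:C))).
    rewrite big_seq; have -> : (fun x => \sum_(z <- s) W z x) =
        fun x => \sum_(z <- s) (if z \in s then W z x else 0).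
      by apply/funext => t; rewrite big_seq [RHS]big_seq; apply: eq_bigr => z ->.
    rewrite big_mkcond; apply: rderiv_sum => z; case: ifPn => zs; last exact: rderiv_cst.
    by apply: rderiv_corrected_part_odd; exact: s_im.
  have := rderivB (hP x x0) dW; apply: rderiv_eq => //.
  have e : - x%:C = (- x)%:C :> R[i] by rewrite rmorphN.
  by rewrite Hreal e Hreal -e big_split/= -/F; ring.
have BW : (B ab.2 - B ab.1) @[ab --> @contour_filter R] --> (0 : R[i]).
  have [C1 [r1 [C10 r11 h1]]] := @integrand_bound_big R p q m deg_lt.
  have [C2 [r2 [C20 r20 h2]]] := @integrand_bound_small R p q m q_neq0.
  have [|C3 [r3 [C30 r31 h3]]] := @sum_decay R s T.
    by move=> c cs; apply: corrected_part_decay; exact: s_im.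
  have [c4 [r4 [c40 r41 h4]]] := normc_horner_ge q0.
  have qz0 : q.[0] != 0 by have := q_neq0 0.
  have [r5 r50 h5] : exists2 r5 : R, 0 < r5 & forall w, normc (w - 0) < r5 -> q.[w] != 0.
    by apply/nearcP; exact: near_horner_neq0.
  have s0 : (0 : R[i]) \notin s by exact: notin_s.
  have [r6 r60 h6] := cderivable_continuous (dT 0 (lexx _) s0) ltr01.
  pose C6 := normc (\sum_(c <- s) T c 0) + 1.
  have C60 : 0 < C6 by rewrite ltr_wpDl ?normc_ge0.
  (* Since A < expR A, the two ranges of Re w keep cexp w beyond r1, r3, r4 or inside
     the discs of radius r2, r5, r6. *)
  pose A := r1 + r3 + r4 + r2^-1 + r5^-1 + r6^-1.
  have i2 : 0 < r2^-1 by rewrite invr_gt0.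
  have i5 : 0 < r5^-1 by rewrite invr_gt0.
  have i6 : 0 < r6^-1 by rewrite invr_gt0.
  have eA : A < expR A.
    by have := @expR_ge1Dx R A; lra.
  pose K := C1 + C2 + C3 + C6.
  have K0 : 0 <= K by rewrite /K; lra.
  apply: (@half_annulus_cvg R H B K A K0 dH dB) => w wpi wA.
  - have wA' : A < expR (Re w) by apply: (lt_le_trans eA); rewrite ler_expR.
    have re0 : 0 <= Re w by apply: le_trans wA; rewrite /A; lra.
    have nz : normc (cexp w) = expR (Re w) by rewrite normc_cexp.
    have ws : cexp w \notin s.
      apply: notin_s; rewrite -normc_gt0.
      have k : r4 <= normc (cexp w) by rewrite nz; move: wA'; rewrite /A; lra.
      by apply: lt_le_trans (h4 _ k); rewrite mulr_gt0// exprn_gt0// nz expR_gt0.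
    have k1 := h1 w wpi; have k3 := h3 (cexp w).
    have {}k1 : normc (F (cexp w) * cexp w) <= C1 * expR (Re w / 2) * expR (- Im (cexp w)).
      by apply: k1 => //; move: wA'; rewrite /A; lra.
    have {}k3 : normc (\sum_(c <- s) T c (cexp w) * cexp w) <=
        C3 * expR (Re w / 2) * expR (- Re w).
      rewrite -mulr_suml normcM nz expRN.
      have r3w : r3 <= normc (cexp w) by rewrite nz; move: wA'; rewrite /A; lra.
      have E0 := expR_gt0 (Re w).
      apply: (@le_trans _ _ (C3 / expR (Re w))).
        have -> : C3 / expR (Re w) = (C3 / expR (Re w) ^+ 2) * expR (Re w).
          by field; rewrite lt0r_neq0.
        by rewrite ler_pM2r// -nz; exact: k3.
      rewrite ler_pM2r ?invr_gt0// ler_peMr ?(ltW C30)//.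
      by rewrite -expR0 ler_expR divr_ge0.
    rewrite /H (negbTE ws) mulrBl mulr_suml.
    apply: le_trans (ler_normcB _ _) _.
    have E1 := expR_gt0 (Re w / 2); have E2 := expR_gt0 (- Im (cexp w)).
    have E3 := expR_gt0 (- Re w).
    rewrite mulrDr; apply: lerD.
      apply: le_trans k1 _; rewrite ler_pM2r// ler_pM2r// /K; lra.
    apply: le_trans k3 _; rewrite ler_pM2r// ler_pM2r// /K; lra.
  - have wA' : expR (Re w) < A^-1.
      apply: (@le_lt_trans _ _ (expR (- A))); first by rewrite ler_expR.
      by rewrite expRN ltf_pV2 ?posrE ?expR_gt0// /A; lra.
    have A0 : 0 < A by rewrite /A; lra.
    have Ar r : 0 < r -> r^-1 <= A -> expR (Re w) < r.
      move=> r0 rA; apply: (lt_le_trans wA'); rewrite -[leRHS]invrK.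
      by rewrite lef_pV2 ?posrE ?invr_gt0.
    have re0 : Re w <= 0 by apply: (le_trans wA); rewrite oppr_le0 ltW.
    have nz : normc (cexp w) = expR (Re w) by rewrite normc_cexp.
    have ws : cexp w \notin s.
      by apply: notin_s; apply: h5; rewrite subr0 nz; apply: Ar => //; rewrite /A; lra.
    have k2 : normc (F (cexp w) * cexp w) <= C2 * expR (Re w / 2).
      by apply: h2 => //; apply: Ar => //; rewrite /A; lra.
    have k6 : normc (\sum_(c <- s) T c (cexp w) * cexp w) <= C6 * expR (Re w / 2).
      rewrite -mulr_suml normcM nz; apply: ler_pM; rewrite ?normc_ge0 ?expR_ge0//.
        have := h6 (cexp w); rewrite subr0 nz => h.
        have {}h := h (Ar _ r60 _); have {}h : normc (\sum_(c <- s) T c (cexp w) - \sum_(c <- s) T c 0) < 1.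
          by apply: h; rewrite /A; lra.
        have := ler_normcD (\sum_(c <- s) T c (cexp w) - \sum_(c <- s) T c 0) (\sum_(c <- s) T c 0).
        by rewrite subrK /C6; lra.
      by rewrite ler_expR; lra.
    rewrite /H (negbTE ws) mulrBl mulr_suml; apply: le_trans (ler_normcB _ _) _.
    have E1 := expR_gt0 (Re w / 2).
    apply: le_trans (lerD k2 k6) _; rewrite -mulrDl ler_pM2r// /K; lra.
split; first exact: rderivable_integrand.
exists P; split; first exact: hP.
have WW c : c \in s -> (W c ab.2 - W c ab.1) @[ab --> @contour_filter R] -->
    2 * (pi : R)%:C * 'i * residue F c.
  move=> cs; have [_ _ ->] := hD c cs; rewrite -[X in _ --> X]subr0.
  apply: cvg_contour; first by apply: corrected_part_odd_cvg0; exact: s_im.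
  by apply: corrected_part_odd_cvgy; exact: s_im.
have := cvgcD BW (sum_contour_cvg WW); rewrite add0r -mulr_sumr => h.
suff -> : (fun ab : R * R => P ab.2 - P ab.1) = (fun ab => B ab.2 - B ab.1 +
  (\sum_(c <- s) W c ab.2 - \sum_(c <- s) W c ab.1)) by exact: h.
by apply/funext => ab; rewrite /B; ring.
Qed.

End ResidueFormula.

(** * Folding the real line *)

Section Assembly.
Context {R : realType}.
Implicit Types (z w : R[i]) (p q : {poly R[i]}).

Lemma ex_upper_roots q : q != 0 -> exists s : seq R[i],
  uniq s /\ forall z, (z \in s) = root q z && (0 < Im z).
Proof.
move=> q0; have [r qE] := closed_field_poly_normal q.
exists [seq z <- undup r | 0 < Im z]; split; first by rewrite filter_uniq ?undup_uniq.
move=> z; rewrite mem_filter mem_undup andbC [in RHS]qE.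
by rewrite rootZ ?lead_coef_eq0// root_prod_XsubC.
Qed.

(** Coprimality keeps the numerator nonzero at a zero of the denominator; so a rational
    function without real poles has a denominator without real zeros. *)
Lemma root_is_pole p q z : coprimep p q -> q != 0 -> root q z -> is_pole (ratfun p q) z.
Proof.
move=> pq q0 rz; have pz : p.[z] != 0.
  by rewrite -rootE; apply: (coprimep_root _ rz); rewrite coprimep_sym.
have -> : ratfun p q = fun w => (fun=> 1) w * ratfun p q w.
  by apply/funext => w; rewrite mul1r.
apply: (@is_pole_quotient R (fun=> 1) p q z q0 rz pz (oner_neq0 _)).
by apply: filterE => w; have [] := cderiv_cst 1 w.
Qed.

Lemma is_pole_integrand p q (m : nat) z : coprimep p q -> q != 0 -> 0 < Im z ->
  is_pole (exp_log_fun (ratfun p q) m) z <-> root q z.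
Proof.
move=> pq q0 yz; split=> [pole|rz].
  apply/negPn/negP => qz; apply: derivable_not_pole pole.
  exact: cderivable_integrand (upper_neq0 yz) (ltW yz) qz.
rewrite exp_log_funE; apply: is_pole_quotient => //.
- by rewrite -rootE; apply: (coprimep_root _ rz); rewrite coprimep_sym.
- exact: exp_log_neq0.
- apply: filterS (near_upper yz) => w w0.
  exact: cderivable_exp_log (upper_neq0 w0) (ltW w0).
Qed.

Lemma cexp_i_real (x : R) : cexp ('i * x%:C) = (cos x)%:C + 'i * (sin x)%:C.
Proof.
have -> : 'i * x%:C = 0 +i* x by apply: complexP; rewrite !reimE/=; ring.
by rewrite /cexp/= expR0; apply: complexP; rewrite !reimE/=; ring.
Qed.

(** Folding the negative half-line onto the positive one: there the logarithm is
    [ln x + i pi], and the binomial theorem expands its power. *)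
Lemma integrand_fold (f : R[i] -> R[i]) (m : nat) (c : R[i]) (x : R) :
  (forall z, f (- z) = c * f z) -> 0 < x ->
  exp_log_fun f m x%:C + exp_log_fun f m (- x%:C) =
  c * (\sum_(k < m.+1) 'C(m, k)%:R * ('i * (pi : R)%:C) ^+ (m - k) *
        (cos_log_integrand f k x - 'i * sin_log_integrand f k x)) +
  (cos_log_integrand f m x + 'i * sin_log_integrand f m x).
Proof.
move=> fc x0; have pi0 := @pi_gt0 R.
have ex : x%:C = cexp (ln x)%:C by rewrite cexp_real lnK ?posrE.
have lx : clog x%:C = (ln x)%:C.
  by rewrite ex clog_cexp//=; apply/andP; split; lra.
have lNx : clog (- x%:C) = 'i * (pi : R)%:C + (ln x)%:C.
  have -> : - x%:C = cexp ('i * (pi : R)%:C + (ln x)%:C).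
    by rewrite cexpD cexp_pi mulN1r -ex.
  by rewrite clog_cexp// !reimE/=; apply/andP; split; lra.
have eN : 'i * - x%:C = 'i * (- x)%:C by rewrite rmorphN.
rewrite /exp_log_fun lx lNx fc eN !cexp_i_real cosN sinN.
rewrite exprDn /cos_log_integrand /sin_log_integrand addrC; congr (_ + _); last first.
  by rewrite rmorphXn; ring.
rewrite !mulr_sumr; apply: eq_bigr => k _.
by rewrite -mulr_natl !rmorphXn (rmorphN (real_complex R)); ring.
Qed.

End Assembly.

Theorem theorem4p1 (R : realType) (p q : {poly R[i]}) (m : nat)
    (lowest_terms : coprimep p q)
    (deg_lt : (size p < size q)%N)
    (no_real_pole : forall x : R, ~ is_pole (ratfun p q) x%:C) :
  let f := ratfun p q in
  let I k := improper_integral (cos_log_integrand f k) in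
  let J k := improper_integral (sin_log_integrand f k) in
  let F := exp_log_fun f m in
  let S := 2 * (pi : R)%:C * 'i%C *
    \sum_(z \in [set z : R[i] | 0 < complex.Im z /\ is_pole F z]) residue F z in
  (* the improper integrals I k and J k converge *)
  (forall k : nat, cvg (improper_integral_filter (cos_log_integrand f k)) /\
                   cvg (improper_integral_filter (sin_log_integrand f k))) /\
  (* f even *)
  ((forall z : R[i], f (- z) = f z) ->
     S = \sum_(k < m.+1) 'C(m, k)%:R * ('i%C * (pi : R)%:C) ^+ (m - k) *
           (I k - 'i%C * J k) + (I m + 'i%C * J m)) /\
  (* f odd *)
  ((forall z : R[i], f (- z) = - f z) ->
     S = - (\sum_(k < m.+1) 'C(m, k)%:R * ('i%C * (pi : R)%:C) ^+ (m - k) *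
           (I k - 'i%C * J k)) + (I m + 'i%C * J m)).
Proof.
move=> f I J F S.
have q0 : q != 0 by rewrite -size_poly_gt0 (leq_trans _ deg_lt).
have q_neq0 (x : R) : q.[x%:C] != 0.
  by apply/negP => rx; apply: (no_real_pole x); exact: root_is_pole.
have cosI k : improper (cos_log_integrand f k) (I k).
  have [|||l hl] := @oscillating_integral R p q q_neq0 deg_lt sin cos k (@is_derive_sin R).
  - by move=> x; eexists; exact: rderiv_real (is_derive_cos x).
  - by move=> x; rewrite ler_norml sin_geN1 sin_le1.
  - by move=> x; rewrite ler_norml cos_geN1 cos_le1.
  - by rewrite /I (improper_lim hl).
have sinI k : improper (sin_log_integrand f k) (J k).
  have dcos (x : R) : is_derive x 1 (fun t => - cos t) (sin x).
    by have := is_deriveN (is_derive_cos x); rewrite opprK; exact.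
  have [|||l hl] := @oscillating_integral R p q q_neq0 deg_lt _ sin k dcos.
  - by move=> x; eexists; exact: rderiv_real (is_derive_sin x).
  - by move=> x; rewrite normrN ler_norml cos_geN1 cos_le1.
  - by move=> x; rewrite ler_norml sin_geN1 sin_le1.
  - by rewrite /J (improper_lim hl).
have [s [s_uniq sP]] := ex_upper_roots q0.
have SE : S = 2 * (pi : R)%:C * 'i * \sum_(z <- s) residue F z.
  rewrite /S; congr (_ * _).
  have -> : [set z : R[i] | 0 < Im z /\ is_pole F z] = [set` s].
    apply/seteqP; split=> z /=; rewrite sP.
      by move=> [yz] /(is_pole_integrand _ lowest_terms q0 yz) ->.
    by move=> /andP[rz yz]; split => //; exact/is_pole_integrand.
  by rewrite -fsbig_seq.
have fold (c : R[i]) : (forall z, f (- z) = c * f z) ->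
    S = c * (\sum_(k < m.+1) 'C(m, k)%:R * ('i * (pi : R)%:C) ^+ (m - k) *
           (I k - 'i * J k)) + (I m + 'i * J m).
  move=> fc; rewrite SE.
  have binom k := improperZ ('C(m, k)%:R * ('i * (pi : R)%:C) ^+ (m - k))
    (improperD (cosI k) (improperZ (- 'i) (sinI k))).
  have rhs := improperD (improperZ c (improper_sum m.+1 binom))
    (improperD (cosI m) (improperZ 'i (sinI m))).
  have lhs := @residue_formula R p q m s q_neq0 deg_lt s_uniq sP.
  rewrite (improper_unique _ lhs rhs).
    by congr (_ * _ + _); apply: eq_bigr => k _; rewrite mulNr.
  move=> x x0; rewrite (integrand_fold _ fc x0); congr (_ * _ + _).
  by apply: eq_bigr => k _; rewrite mulNr.
split; [|split].
- by move=> k; split; apply/cvg_ex; eexists; [exact: improper_cvg (cosI k)|exact: improper_cvg (sinI k)].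
- by move=> even; rewrite (fold 1) ?mul1r// => z; rewrite mul1r.
- by move=> odd; rewrite (fold (-1)) ?mulN1r// => z; rewrite mulN1r.
Qed.
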